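(* Let $B>0$ be a constant and let $n\geq 3$ be a natural number. Given any constant $C\leq \frac{(n-2)^2}{12B}$, the metric $$g=f^{-2}dr^2+r^2\big(\sigma_1^2+\sigma_2^2+f^2\sigma_3^2\big),\qquad f=\sqrt{1+\frac{C}{r^2}+\frac{A}{r^4}+Br^2},$$ with ranges $$r\geq r_0,\qquad 0\leq\psi\leq\frac{4\pi}{n},$$ is geodesically complete and has scalar curvature $-24B$, where $$r_0=\sqrt{\frac{n-2+\sqrt{(n-2)^2-12BC}}{6B}}>0,\qquad A=\frac{1-2n+\sqrt{(n-2)^2-12BC}}{3}\,r_0^4 .$$ Topologically, the manifold is $\mathbb{R}_{\geq 0}\times SU(2)/\mathbb{Z}_n\cong \mathbb{R}_{\geq 0}\times S^3/\mathbb{Z}_n$.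
   Context: $\theta,\phi,\psi$ are the Euler angles on the 3-sphere $S^3\cong SU(2)$, with ranges $0\leq\theta\leq\pi$, $0\leq\phi\leq 2\pi$ and, for $S^3$ itself, $0\leq\psi\leq4\pi$; restricting $\psi$ to $0\leq\psi\leq 4\pi/n$ gives $S^3/\mathbb{Z}_n$. The one-forms $$\sigma_1=\tfrac12(\sin\psi\,d\theta-\sin\theta\cos\psi\,d\phi),\quad \sigma_2=\tfrac12(-\cos\psi\,d\theta-\sin\theta\sin\psi\,d\phi),\quad \sigma_3=\tfrac12(d\psi+\cos\theta\,d\phi)$$ are the Cartan-Maurer one-forms for $SU(2)\cong S^3$, satisfying $d\sigma_1=2\sigma_2\wedge\sigma_3$, $d\sigma_2=2\sigma_3\wedge\sigma_1$, $d\sigma_3=2\sigma_1\wedge\sigma_2$. Here $r$ is the radial coordinate.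
   Formalization: Since f(r0)=0, the manifold cannot literally be R_{≥0}×SU(2)/Z_n (it would have a boundary where g degenerates); what is proved is that it is this product with the ψ-circles over r=r0, and nothing else, collapsed to points. *)

(* Defs.v *)
From HB Require Import structures.
From mathcomp Require Import all_boot all_order all_algebra.
From mathcomp Require Import generic_quotient.
From mathcomp Require Import all_classical all_reals all_analysis.
From mathcomp Require Import ring.
Set Implicit Arguments.
Unset Strict Implicit.
Unset Printing Implicit Defensive.
Import Order.TTheory GRing.Theory Num.Theory.
Import numFieldNormedType.Exports.
Local Open Scope classical_set_scope.
Local Open Scope ring_scope.

(* A point of R^d.+1 is a row vector; with the convention of [jacobian],
   ['d F x v = v *m 'J F x]. *)

Section Calculus.
Context {R : realType} {d : nat}.

Definition partial {W : normedModType R} (i : 'I_d.+1)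
    (F : 'rV[R]_d.+1 -> W) : 'rV[R]_d.+1 -> W :=
  fun x => 'D_(delta_mx 0 i) F x.

Definition iter_partial {W : normedModType R} (s : seq 'I_d.+1)
    (F : 'rV[R]_d.+1 -> W) : 'rV[R]_d.+1 -> W :=
  foldr partial F s.

Definition smooth_on {W : normedModType R} (U : set 'rV[R]_d.+1)
    (F : 'rV[R]_d.+1 -> W) : Prop :=
  forall (s : seq 'I_d.+1) x, U x -> differentiable (iter_partial s F) x.

Definition pullback {m : nat} (F : 'rV[R]_d.+1 -> 'rV[R]_m.+1)
    (G : 'rV[R]_m.+1 -> 'M[R]_m.+1) (x : 'rV[R]_d.+1) : 'M[R]_d.+1 :=
  'J F x *m G (F x) *m ('J F x)^T.

(* In the next four definitions [G x] is the matrix (g_ij) of a metric at [x];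
   [invmx (G x)] is then (g^ij). *)

Definition christoffel (G : 'rV[R]_d.+1 -> 'M[R]_d.+1) (k i j : 'I_d.+1)
    (x : 'rV[R]_d.+1) : R :=
  2^-1 * \sum_l invmx (G x) k l *
    (partial i (fun y => G y j l) x + partial j (fun y => G y i l) x
     - partial l (fun y => G y i j) x).

(* The component R^k_{lij} of R(d_i, d_j) d_l, with the sign convention
   R(X, Y) = [D_X, D_Y] - D_[X, Y]: round spheres have positive curvature. *)
Definition riemann (G : 'rV[R]_d.+1 -> 'M[R]_d.+1) (k l i j : 'I_d.+1)
    (x : 'rV[R]_d.+1) : R :=
  partial i (christoffel G k j l) x - partial j (christoffel G k i l) x
  + \sum_m (christoffel G k i m x * christoffel G m j l x
            - christoffel G k j m x * christoffel G m i l x).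

Definition ricci (G : 'rV[R]_d.+1 -> 'M[R]_d.+1) (l j : 'I_d.+1)
    (x : 'rV[R]_d.+1) : R :=
  \sum_k riemann G k l k j x.

Definition scalar_curvature_in (G : 'rV[R]_d.+1 -> 'M[R]_d.+1)
    (x : 'rV[R]_d.+1) : R :=
  \sum_i \sum_j invmx (G x) i j * ricci G i j x.

End Calculus.

(* Only the restriction of [chart_map] to [chart_dom], and that of [chart_inv]
   to [chart_cod], are meaningful. *)
Record chart (R : realType) (d : nat) (M : topologicalType) := Chart {
  chart_dom : set M;
  chart_map : M -> 'rV[R]_d.+1;
  chart_inv : 'rV[R]_d.+1 -> M }.

Definition chart_cod R d M (c : chart R d M) : set 'rV[R]_d.+1 :=
  chart_map c @` chart_dom c.

Record is_chart R d M (c : chart R d M) : Prop := IsChart {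
  chart_dom_open : open (chart_dom c);
  chart_cod_open : open (chart_cod c);
  chart_mapK : forall p, chart_dom c p -> chart_inv c (chart_map c p) = p;
  chart_map_cts : {within chart_dom c, continuous (chart_map c)};
  chart_inv_cts : {within chart_cod c, continuous (chart_inv c)} }.

Definition transition R d M (c c' : chart R d M) :
    'rV[R]_d.+1 -> 'rV[R]_d.+1 :=
  chart_map c' \o chart_inv c.

(* Riemannian manifolds of dimension d.+1: [metric i] is the matrix of the
   metric in the chart [atlas i]. *)
Record riemannian_manifold (R : realType) (d : nat) := RiemannianManifold {
  mspace : topologicalType;
  mindex : Type;
  atlas : mindex -> chart R d mspace;
  metric : mindex -> 'rV[R]_d.+1 -> 'M[R]_d.+1;
  mspace_hausdorff : hausdorff_space mspace;
  mspace_second_countable : @second_countable mspace;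
  atlas_chart : forall i, is_chart (atlas i);
  atlas_cover : forall p : mspace, exists i, chart_dom (atlas i) p;
  atlas_smooth : forall i j,
    smooth_on
      (chart_map (atlas i) @` (chart_dom (atlas i) `&` chart_dom (atlas j)))
      (transition (atlas i) (atlas j));
  metric_smooth : forall i, smooth_on (chart_cod (atlas i)) (metric i);
  metric_sym : forall i x, chart_cod (atlas i) x ->
    (metric i x)^T = metric i x;
  metric_pos : forall i x (v : 'rV[R]_d.+1), chart_cod (atlas i) x ->
    v != 0 -> 0 < (v *m metric i x *m v^T) 0 0;
  metric_compat : forall i j p,
    chart_dom (atlas i) p -> chart_dom (atlas j) p ->
    metric i (chart_map (atlas i) p) =
      pullback (transition (atlas i) (atlas j)) (metric j)
               (chart_map (atlas i) p) }.

Section RiemannianNotions.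
Context {R : realType} {d : nat} (N : riemannian_manifold R d).

Definition has_scalar_curvature (c : R) : Prop :=
  forall (i : mindex N) (p : mspace N), chart_dom (atlas i) p ->
    scalar_curvature_in (metric i) (chart_map (atlas i) p) = c.

(* [I] is meant to be an open interval. *)
Definition geodesic_on (I : set R) (gamma : R -> mspace N) : Prop :=
  forall t, I t -> {for t, continuous gamma} /\
    forall i : mindex N, chart_dom (atlas i) (gamma t) ->
      let x : R -> 'rV[R]_d.+1 := chart_map (atlas i) \o gamma in
      [/\ \forall s \near t, derivable x s 1,
          derivable (derive1 x) t 1 &
          forall k, derive1 (derive1 x) t 0 k +
            \sum_a \sum_b christoffel (metric i) k a b (x t) *
              derive1 x t 0 a * derive1 x t 0 b = 0].

Definition geodesically_complete : Prop :=
  forall (I : set R) (gamma : R -> mspace N),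
    open I -> is_interval I -> geodesic_on I gamma ->
    exists gamma' : R -> mspace N,
      geodesic_on setT gamma' /\ forall t, I t -> gamma' t = gamma t.

(* [F] is smooth on the open set [U] of R^m.+1, and on [U] the metric of [N]
   pulls back along [F] to [g]. *)
Definition metric_expression {m : nat} (U : set 'rV[R]_m.+1)
    (F : 'rV[R]_m.+1 -> mspace N) (g : 'rV[R]_m.+1 -> 'M[R]_m.+1) : Prop :=
  {within U, continuous F} /\
  forall i : mindex N,
    let V := U `&` (F @^-1` chart_dom (atlas i)) in
    smooth_on V (chart_map (atlas i) \o F) /\
    forall x, V x -> pullback (chart_map (atlas i) \o F) (metric i) x = g x.

End RiemannianNotions.

(* S^3 is the set of (z1, z2) = (x_0 + i x_1, x_2 + i x_3) in C^2 = R^4 of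
   norm 1, identified with SU(2) through the matrix
     [ z1  - conj z2 ]
     [ z2    conj z1 ]
   of which (z1, z2) is the first column. *)

Section SU2.
Context (R : realType).

Definition row4 (a b c e : R) : 'rV[R]_4 := \row_(i < 4) [:: a; b; c; e]`_i.

Definition S3 : set 'rV[R]_4 := [set x | \sum_i x 0 i ^+ 2 = 1].

Local Notation x0 x := (x 0 (0 : 'I_4)).
Local Notation x1 x := (x 0 (1 : 'I_4)).
Local Notation x2 x := (x 0 (2 : 'I_4)).
Local Notation x3 x := (x 0 (3 : 'I_4)).

(* the product of matrices above:
   (z1, z2) (w1, w2) = (z1 w1 - conj z2 w2, z2 w1 + conj z1 w2) *)
Definition su2_mul (x y : 'rV[R]_4) : 'rV[R]_4 :=
  row4 (x0 x * x0 y - x1 x * x1 y - x2 x * x2 y - x3 x * x3 y)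
       (x0 x * x1 y + x1 x * x0 y - x2 x * x3 y + x3 x * x2 y)
       (x2 x * x0 y - x3 x * x1 y + x0 x * x2 y + x1 x * x3 y)
       (x2 x * x1 y + x3 x * x0 y + x0 x * x3 y - x1 x * x2 y).

(* diag(e^{it}, e^{-it}) *)
Definition su2_diag (t : R) : 'rV[R]_4 := row4 (cos t) (sin t) 0 0.

Lemma su2_mul_diag0 x : su2_mul x (su2_diag 0) = x.
Proof.
apply/rowP => i; rewrite /su2_mul /su2_diag !mxE /= cos0 sin0.
by case: i => [[|[|[|[|//]]]] p] /=;
  rewrite ?(mulr0, mulr1, subr0, addr0, add0r);
  by congr (x _ _); apply/val_inj.
Qed.

Lemma su2_mul_diagD x s t :
  su2_mul (su2_mul x (su2_diag s)) (su2_diag t) = su2_mul x (su2_diag (s + t)).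
Proof.
apply/rowP => i; rewrite /su2_mul /su2_diag !mxE /= cosD sinD.
by case: i => [[|[|[|[|//]]]] p] /=; ring.
Qed.

(* Z_n is the subgroup of the diag(e^{2 pi i k/n}, e^{-2 pi i k/n}); SU(2)/Z_n
   is the space of its left cosets. *)
Definition zn_rel (n : nat) : rel (set_type S3) := fun x y =>
  `[< exists k : int,
      \val y = su2_mul (\val x) (su2_diag (k%:~R * (2 * pi / n%:R))) >].

Lemma zn_rel_refl n : reflexive (zn_rel n).
Proof.
by move=> x; apply/asboolP; exists 0; rewrite mul0r su2_mul_diag0.
Qed.

Lemma zn_rel_sym n : symmetric (zn_rel n).
Proof.
suff H x y : zn_rel n x y -> zn_rel n y x by move=> x y; apply/idP/idP; apply: H.
move=> /asboolP[k yE]; apply/asboolP; exists (- k).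
by rewrite yE su2_mul_diagD mulrNz mulNr subrr su2_mul_diag0.
Qed.

Lemma zn_rel_trans n : transitive (zn_rel n).
Proof.
move=> y x z /asboolP[k yE] /asboolP[l zE]; apply/asboolP; exists (k + l).
by rewrite zE yE su2_mul_diagD -mulrDl intrD.
Qed.

Canonical zn_equiv n :=
  EquivRel (zn_rel n) (@zn_rel_refl n) (@zn_rel_sym n) (@zn_rel_trans n).

Definition SU2_mod_Z (n : nat) : topologicalType :=
  quotient_topology {eq_quot zn_equiv n}%qT.

Definition SU2_proj (n : nat) : set_type S3 -> SU2_mod_Z n :=
  fun x => (\pi_{eq_quot zn_equiv n} x)%qT.

(* The Euler angles: z1 = cos(theta/2) e^{i(psi+phi)/2} and
   z2 = sin(theta/2) e^{i(psi-phi)/2}.  With this convention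
   z1 dz2 - z2 dz1 = - sigma2 + i sigma1 and
   conj z1 dz1 + conj z2 dz2 = i sigma3 on S^3 (see [sigma1] below). *)
Definition euler_point (theta phi psi : R) : 'rV[R]_4 :=
  row4 (cos (theta / 2) * cos ((psi + phi) / 2))
       (cos (theta / 2) * sin ((psi + phi) / 2))
       (sin (theta / 2) * cos ((psi - phi) / 2))
       (sin (theta / 2) * sin ((psi - phi) / 2)).

Lemma euler_point_S3 theta phi psi : euler_point theta phi psi \in S3.
Proof.
apply/mem_set; rewrite /S3 /= !big_ord_recl big_ord0 !mxE /= addr0 !exprMn.
rewrite addrA -mulrDr cos2Dsin2 -mulrDr cos2Dsin2 !mulr1.
exact: cos2Dsin2.
Qed.

Definition euler (theta phi psi : R) : set_type S3 :=
  exist _ (euler_point theta phi psi) (euler_point_S3 theta phi psi).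

Definition halfline : set R := [set s | 0 <= s].

Lemma max0_halfline (s : R) : Num.max 0 s \in halfline.
Proof. by apply/mem_set; rewrite /halfline /= le_max lexx. Qed.

(* [s], for [0 <= s], as an element of the half-line *)
Definition to_halfline (s : R) : set_type halfline :=
  exist _ (Num.max 0 s) (max0_halfline s).

End SU2.

(* Coordinates are (r, theta, phi, psi), and a covector is the row of its
   coefficients on (dr, dtheta, dphi, dpsi). *)

Section Metric.
Context {R : realType}.
Implicit Type x : 'rV[R]_4.

Definition coord_r x : R := x 0 0.
Definition coord_theta x : R := x 0 1.
Definition coord_phi x : R := x 0 2.
Definition coord_psi x : R := x 0 3.

Definition d_r : 'rV[R]_4 := row4 1 0 0 0.

Definition sigma1 x : 'rV[R]_4 := 2^-1 *:
  row4 0 (sin (coord_psi x)) (- (sin (coord_theta x) * cos (coord_psi x))) 0.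
Definition sigma2 x : 'rV[R]_4 := 2^-1 *:
  row4 0 (- cos (coord_psi x)) (- (sin (coord_theta x) * sin (coord_psi x))) 0.
Definition sigma3 x : 'rV[R]_4 := 2^-1 *: row4 0 0 (cos (coord_theta x)) 1.

Definition sqform (w : 'rV[R]_4) : 'M[R]_4 := w^T *m w.

Definition profile (A B C r : R) : R :=
  Num.sqrt (1 + C / r ^+ 2 + A / r ^+ 4 + B * r ^+ 2).

Definition g_matrix (A B C : R) x : 'M[R]_4 :=
  let r := coord_r x in
  let f := profile A B C r in
  f ^- 2 *: sqform d_r
  + r ^+ 2 *: (sqform (sigma1 x) + sqform (sigma2 x)
               + f ^+ 2 *: sqform (sigma3 x)).

Definition bolt_radius (n : nat) (B C : R) : R :=
  Num.sqrt ((n%:R - 2 + Num.sqrt ((n%:R - 2) ^+ 2 - 12 * B * C)) / (6 * B)).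

Definition bolt_A (n : nat) (B C : R) : R :=
  (1 - 2 * n%:R + Num.sqrt ((n%:R - 2) ^+ 2 - 12 * B * C)) / 3
  * bolt_radius n B C ^+ 4.

Definition euler_ranges (n : nat) (r0 : R) : set 'rV[R]_4 :=
  [set x | [/\ r0 <= coord_r x, 0 <= coord_theta x <= pi,
               0 <= coord_phi x <= 2 * pi &
               0 <= coord_psi x <= 4 * pi / n%:R]].

Definition euler_ranges_interior (n : nat) (r0 : R) : set 'rV[R]_4 :=
  [set x | [/\ r0 < coord_r x, 0 < coord_theta x < pi,
               0 < coord_phi x < 2 * pi &
               0 < coord_psi x < 4 * pi / n%:R]].

(* where (r, theta, phi, psi) are local coordinates on r > r0 *)
Definition euler_regular (r0 : R) : set 'rV[R]_4 :=
  [set x | r0 < coord_r x /\ 0 < coord_theta x < pi].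

Definition euler_map (n : nat) (r0 : R) x :
    (set_type (@halfline R) * SU2_mod_Z R n)%type :=
  (to_halfline (coord_r x - r0),
   SU2_proj n (euler (coord_theta x) (coord_phi x) (coord_psi x))).

End Metric.

Section Topology.
Context {R : realType}.

Definition quotient_map (X Y : topologicalType) (q : X -> Y) : Prop :=
  (forall y, exists x, q x = y) /\
  forall V : set Y, open V <-> open (q @^-1` V).

(* lying on the same psi-circle *)
Definition same_psi_circle (n : nat) (y y' : SU2_mod_Z R n) : Prop :=
  exists (x x' : set_type (@S3 R)) (t : R),
    [/\ y = SU2_proj n x, y' = SU2_proj n x' &
        \val x' = su2_mul (\val x) (su2_diag t)].

(* [q] presents [M] as R_{>=0} x SU(2)/Z_n with polar coordinates at s = 0:
   the psi-circles of {0} x SU(2)/Z_n, whose length is proportional to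
   r0 f(r0) = 0, are points of [M], and nothing else is identified. *)
Definition polar_presentation (n : nat) (M : topologicalType)
    (q : set_type (@halfline R) * SU2_mod_Z R n -> M) : Prop :=
  quotient_map q /\
  forall u v, q u = q v <->
    u = v \/ [/\ \val u.1 = 0, \val v.1 = 0 & same_psi_circle u.2 v.2].

End Topology.

(* Main.v *)
Require Import Defs.
From mathcomp Require Import all_boot all_order all_algebra.
From mathcomp Require Import all_classical all_reals all_analysis.
From mathcomp Require Import ring lra.
Set Implicit Arguments.
Unset Strict Implicit.
Unset Printing Implicit Defensive.
Import Order.TTheory GRing.Theory Num.Theory.
Import numFieldNormedType.Exports.
Local Open Scope classical_set_scope.
Local Open Scope ring_scope.

(** With [x = r ^ 2] and [x0 = r0 ^ 2], the constants are such that
[r ^ 4 * f ^ 2 = (x - x0) * Q] where [Q] is positive for [x >= x0] and equals [n * x0]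
at [x0] ([bolt_C], [bolt_AE], [bolt_profileE]). Hence [f] vanishes at [r0], and near
[r0] the metric transverse to the sphere [r = r0] is that of a plane with polar
coordinates [sqrt t] and [n * psi / 2], where [t = x - x0]. The period [4 pi / n] of
[psi] makes the second one an honest angle, so that the metric closes up smoothly over
the bolt [r = r0].

The underlying manifold is a complex line bundle over the sphere of [psi]-circles. For a
point [(z1, z2)] of the 3-sphere and [t >= 0], coordinates are [w = z2 / z1] on the base and
[zeta = sqrt t * (z1 / |z1|) ^ n] in the fibre; exchanging [z1] and [z2] gives a second
chart, and the transition is [(w, zeta) -> (1 / w, zeta * (w / |w|) ^ n)] ([clutch]). In
both charts the metric is [model_metric], a combination of [|D zeta| ^ 2],
[Im (conj zeta * D zeta) ^ 2] and [|dw| ^ 2] whose coefficients are rational functions of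
[t = |zeta| ^ 2] without pole. It is positive definite ([model_metric_pos]), it is
invariant under the transition ([clutch_pullback]), and in Euler coordinates it is the
given metric ([euler_chart_pullback], [g_matrixE]). The total space is realized in [R^7] by
[|z1| ^ 2 - |z2| ^ 2], [z1 * conj z2] and [sqrt t] times the [n]-th powers of [z1] and [z2].
It inherits its separation properties from there. The map onto it from the product of a
half-line and [SU(2) / Z_n] is a quotient map because over bounded radii its source is
compact ([bolt_map_quotient]), and the phase by which two points with the same image differ is
computed in [rotate_of_hopf].

Completeness rests on the function [ln (1 + t)]. Its gradient is bounded
([log_fibre2_gradient]) because [f] grows linearly in [r], and its sublevel sets are
covered by a ball in each of the two charts ([base_ball]). The energy of a geodesic is
constant ([geodesic_energy]), so that on a bounded time interval a geodesic stays in
such a sublevel set with bounded velocity; there the geodesic equation has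
solutions for a time bounded from below, and the geodesic can be prolonged
([complete_of_proper_function]). This uses existence and uniqueness for ordinary
differential equations, by Picard iteration, and the invariance of the geodesic
equation under changes of charts ([christoffel_transform]).

In Euler coordinates the Christoffel symbols and the Ricci tensor of a metric of this
form with arbitrary [F = f ^ 2] are explicit, and the scalar curvature is
[- (F'' + 7 F' / r + 8 (F - 1) / r ^ 2)] ([euler_scalar_curvature]). The
terms [C / r ^ 2] and [A / r ^ 4] do not contribute, and [B * r ^ 2] contributes
[- 24 B]. The scalar curvature is invariant under changes of coordinates
([scalar_curvature_transform]), which gives the value wherever neither [w] nor [zeta]
vanishes, and by continuity everywhere ([model_metric_curvature]). *)

(** * Norms and gradients *)

Section RowNorm.
Context {R : realType} {d : nat}.
Implicit Type v : 'rV[R]_d.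

Lemma rV_norm_le v e : 0 <= e -> (forall j, `|v 0 j| <= e) -> `|v| <= e.
Proof.
move=> e0 ve; change (mx_norm v <= e); rewrite mx_normrE.
by apply: bigmax_le => //= -[p q] _ /=; rewrite (ord1 p).
Qed.

Lemma rV_coord_le v j : `|v 0 j| <= `|v|.
Proof.
change (`|v 0 j| <= mx_norm v); rewrite mx_normrE.
exact: (@le_bigmax _ _ _ 0 (fun ij : 'I_1 * 'I_d => `|v ij.1 ij.2|) (0, j)).
Qed.

End RowNorm.

Section NearDifferentiable.
Context {R : realType} {V W : normedModType R}.

Lemma near_eq_differentiable (f g : V -> W) (x : V) :
  {near x, f =1 g} -> differentiable f x -> differentiable g x.
Proof.
move=> fg df.
have gE : g \o shift x = cst (g x) + 'd f x +o_ 0 id.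
  apply/eqaddoP => e e0; have /eqaddoP/(_ e e0) := diff_locally df.
  have -> : f x = g x by exact: (nbhs_singleton fg).
  have H1 : \forall h \near (0 : V), f (h + x) = g (h + x).
    have : \forall y \near x, f y = g y by exact: fg.
    by rewrite (near_shift 0 x); apply: filterS => h /=; rewrite subr0.
  move=> H2; near=> h.
  have -> : (g \o shift x - (cst (g x) + 'd f x)) h =
            (f \o shift x - (cst (g x) + 'd f x)) h.
    by rewrite !fctE /= (near H1 h).
  exact: (near H2 h).
apply/diff_locallyP; rewrite (diff_unique _ gE); last exact: diff_continuous.
by split => //; exact: diff_continuous.
Unshelve. all: by end_near. Qed.

End NearDifferentiable.

Section Gradient.
Context {R : realType} {d : nat}.
Local Notation V := 'rV[R]_d.+1.
Implicit Types (f g : V -> R) (x : V) (D E : 'I_d.+1 -> R).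

Lemma partial_near {W : normedModType R} (f g : V -> W) x i :
  {near x, f =1 g} -> partial i f x = partial i g x.
Proof. exact: near_eq_derive. Qed.

(** Differentiability and the values of the partial derivatives travel together, so that
a gradient is computed by composing the rules below. *)
Definition grad f x D := differentiable f x /\ forall i, partial i f x = D i.

Lemma grad_near f g x D : {near x, f =1 g} -> grad f x D -> grad g x D.
Proof.
move=> fg [df fD]; split; first exact: near_eq_differentiable df.
by move=> i; rewrite -(partial_near i fg).
Qed.

Lemma grad_eq f x D E : grad f x D -> D =1 E -> grad f x E.
Proof. by move=> [df fD] DE; split => // i; rewrite fD DE. Qed.

Lemma gradE f x : differentiable f x -> grad f x (fun i => partial i f x).
Proof. by []. Qed.

Lemma grad_cst (a : R) x : grad (fun=> a) x (fun=> 0).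
Proof.
by split; [exact: differentiable_cst | move=> i; exact: derive_cst].
Qed.

Lemma grad_coord j x : grad (fun y : V => y 0 j) x (fun i => (i == j)%:R).
Proof.
split; first exact: differentiable_coord.
move=> i; rewrite /partial deriveE; last exact: differentiable_coord.
have @f : {linear V -> R}.
  by exists (fun N : V => N 0 j); do 2![eexists]; do ?[constructor];
     rewrite ?mxE// => ? *; rewrite ?mxE//; move=> ?; rewrite !mxE.
rewrite (_ : (fun _ => _) = f) // diff_lin; last exact: coord_continuous.
by rewrite /= mxE eqxx /= eq_sym.
Qed.

Lemma gradD f g x D E : grad f x D -> grad g x E ->
  grad (fun y => f y + g y) x (fun i => D i + E i).
Proof.
move=> [df fD] [dg gE]; split; first exact: differentiableD.
by move=> i; rewrite -fD -gE /partial -deriveD //; exact: diff_derivable.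
Qed.

Lemma gradN f x D : grad f x D -> grad (fun y => - f y) x (fun i => - D i).
Proof.
move=> [df fD]; split; first exact: differentiableN.
by move=> i; rewrite -fD /partial -deriveN //; exact: diff_derivable.
Qed.

Lemma gradB f g x D E : grad f x D -> grad g x E ->
  grad (fun y => f y - g y) x (fun i => D i - E i).
Proof. by move=> fD gE; exact: gradD fD (gradN gE). Qed.

Lemma gradM f g x D E : grad f x D -> grad g x E ->
  grad (fun y => f y * g y) x (fun i => D i * g x + f x * E i).
Proof.
move=> [df fD] [dg gE]; split; first exact: differentiableM.
move=> i; rewrite -fD -gE /partial deriveM; try exact: diff_derivable.
by rewrite addrC [X in X + _]mulrC.
Qed.

Lemma grad_comp (h : R -> R) f x D a :
  is_derive (f x) 1 h a -> grad f x D ->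
  grad (fun y => h (f y)) x (fun i => a * D i).
Proof.
move=> [dh ha] [df fD].
have dh' : differentiable h (f x) by exact/derivable1_diffP.
split; first exact: (differentiable_comp df dh').
move=> i; rewrite -fD /partial.
rewrite (@deriveE _ _ _ (fun y => h (f y))); last exact: (differentiable_comp df dh').
rewrite (diff_comp df dh') /= deriveE //.
by rewrite deriv1E // /= -ha derive1E mulrC.
Qed.

Lemma gradV f x D : f x != 0 -> grad f x D ->
  grad (fun y => (f y)^-1) x (fun i => - (f x) ^- 2 * D i).
Proof.
move=> fx0; apply: grad_comp; apply: is_derive_eq.
  by apply: is_deriveV => //; exact: is_derive_id.
exact: mulr1.
Qed.

Lemma gradX f x D n : grad f x D ->
  grad (fun y => f y ^+ n) x (fun i => n%:R * f x ^+ n.-1 * D i).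
Proof.
apply: (@grad_comp (fun r => r ^+ n)); split; first exact: exprn_derivable.
rewrite exp_derive; exact: mulr1.
Qed.

Lemma grad_sin f x D : grad f x D ->
  grad (fun y => sin (f y)) x (fun i => cos (f x) * D i).
Proof. exact: grad_comp. Qed.

Lemma grad_cos f x D : grad f x D ->
  grad (fun y => cos (f y)) x (fun i => - sin (f x) * D i).
Proof. exact: grad_comp. Qed.

Lemma grad_sqrt f x D : 0 < f x -> grad f x D ->
  grad (fun y => Num.sqrt (f y)) x (fun i => (2 * Num.sqrt (f x))^-1 * D i).
Proof. by move=> fx0; apply: grad_comp; exact: is_derive1_sqrt. Qed.

Lemma grad_sum (I : Type) (r : seq I) (F : I -> V -> R) x (D : I -> 'I_d.+1 -> R) :
  (forall k, grad (F k) x (D k)) ->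
  grad (fun y => \sum_(k <- r) F k y) x (fun i => \sum_(k <- r) D k i).
Proof.
move=> FD; elim: r => [|k r IH].
  apply: (@grad_near (fun=> 0)); first by near=> y; rewrite big_nil.
  by apply: grad_eq (grad_cst _ _) _ => i; rewrite big_nil.
apply: (@grad_near (fun y => F k y + \sum_(k <- r) F k y)).
  by near=> y; rewrite big_cons.
by apply: grad_eq (gradD (FD k) IH) _ => i; rewrite big_cons.
Unshelve. all: by end_near. Qed.

End Gradient.

(** * Smooth functions *)

Section Smooth.
Context {R : realType} {d : nat}.
Local Notation V := 'rV[R]_d.+1.

(** Regularity of order [k], by recursion on [k]: [smooth_on] quantifies over lists of
directions and offers no induction on the order for a product or a composite. *)
Fixpoint cdiff {W : normedModType R} (k : nat) (U : set V) (F : V -> W) : Prop :=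
  if k is l.+1 then
    (forall x, U x -> differentiable F x) /\
    (forall i, cdiff l U (partial i F))
  else True.

Lemma smooth_onP {W : normedModType R} (U : set V) (F : V -> W) :
  smooth_on U F <-> forall k, cdiff k U F.
Proof.
split=> [sF k|cF s].
  elim: k F sF => [//|k IH] F sF; split; first exact: (sF [::]).
  move=> i; apply: IH => s x Ux.
  by have := sF (rcons s i) x Ux; rewrite /iter_partial foldr_rcons.
elim/last_ind: s F cF => [|s i IH] F cF x Ux; first by have [+ _] := cF 1%N; apply.
rewrite /iter_partial foldr_rcons; apply: IH => // k.
by have [_] := cF k.+1; apply.
Qed.

Section ClosureW.
Context {W : normedModType R}.
Implicit Types (U : set V) (F G : V -> W).

Lemma cdiff_eq k U F G : open U -> (forall x, U x -> F x = G x) ->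
  cdiff k U F -> cdiff k U G.
Proof.
move=> oU; elim: k F G => [//|k IH] F G FG [dF pF].
have near_FG x : U x -> {near x, F =1 G}.
  by move=> Ux; apply: filterS (open_nbhs_nbhs (conj oU Ux)).
split=> [x Ux|i]; first exact: near_eq_differentiable (near_FG _ Ux) (dF _ Ux).
apply: IH (pF i) => x Ux; exact: partial_near (near_FG _ Ux).
Qed.

Lemma cdiffW k U F : cdiff k.+1 U F -> cdiff k U F.
Proof.
elim: k F => [//|k IH] F [dF pF]; split=> // i; exact: IH (pF i).
Qed.

Lemma cdiff_partial k U F i : cdiff k.+1 U F -> cdiff k U (partial i F).
Proof. by move=> [_ pF]; exact: pF. Qed.

Lemma smooth_eq U F G : open U -> (forall x, U x -> F x = G x) ->
  smooth_on U F -> smooth_on U G.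
Proof.
by move=> oU FG /smooth_onP sF; apply/smooth_onP => k; exact: cdiff_eq (sF k).
Qed.

Lemma smooth_sub U U' F : U' `<=` U -> smooth_on U F -> smooth_on U' F.
Proof. by move=> sU sF s x /sU; exact: sF. Qed.

Lemma smooth_partial U F i : smooth_on U F -> smooth_on U (partial i F).
Proof.
by move=> /smooth_onP sF; apply/smooth_onP => k; exact: cdiff_partial (sF k.+1).
Qed.

Lemma smooth_diff U F x : smooth_on U F -> U x -> differentiable F x.
Proof. by move=> sF; exact: (sF [::]). Qed.

End ClosureW.

Section ClosureR.
Context {U : set V} (oU : open U).
Implicit Types f g : V -> R.

Lemma cdiff_cst k (a : R) : cdiff k U (fun=> a).
Proof.
elim: k a => [//|k IH] a; split=> [x _|i]; first exact: differentiable_cst.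
by apply: cdiff_eq (IH 0) => // x _; have [_ ->] := grad_cst a x.
Qed.

Lemma cdiff_coord k j : cdiff k U (fun y : V => y 0 j).
Proof.
case: k => [//|k]; split=> [x _|i]; first exact: differentiable_coord.
apply: cdiff_eq (cdiff_cst k (i == j)%:R) => // x _.
by have [_ ->] := grad_coord j x.
Qed.

Lemma cdiffD k f g : cdiff k U f -> cdiff k U g -> cdiff k U (fun y => f y + g y).
Proof.
elim: k f g => [//|k IH] f g [df pf] [dg pg].
split=> [x Ux|i]; first by have [] := gradD (gradE (df _ Ux)) (gradE (dg _ Ux)).
apply: cdiff_eq (IH _ _ (pf i) (pg i)) => // x Ux.
by have [_ ->] := gradD (gradE (df _ Ux)) (gradE (dg _ Ux)).
Qed.

Lemma cdiffM k f g : cdiff k U f -> cdiff k U g -> cdiff k U (fun y => f y * g y).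
Proof.
elim: k f g => [//|k IH] f g cf cg; have [[df pf] [dg pg]] := (cf, cg).
split=> [x Ux|i]; first by have [] := gradM (gradE (df _ Ux)) (gradE (dg _ Ux)).
apply: cdiff_eq (cdiffD (IH _ _ (pf i) (cdiffW cg)) (IH _ _ (cdiffW cf) (pg i))) => //.
by move=> x Ux; have [_ ->] := gradM (gradE (df _ Ux)) (gradE (dg _ Ux)).
Qed.

(** The outer derivative is left to the caller: for the inverse, [sin], [cos] and the
square root it is an expression in the same functions, one order lower. *)
Lemma cdiff_comp k (h h' : R -> R) f :
  (forall x, U x -> is_derive (f x) 1 h (h' (f x))) ->
  (cdiff k U f -> cdiff k U (fun y => h' (f y))) ->
  cdiff k.+1 U f -> cdiff k.+1 U (fun y => h (f y)).
Proof.
move=> dh ch' cf; have [df pf] := cf.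
split=> [x Ux|i]; first by have [] := grad_comp (dh _ Ux) (gradE (df _ Ux)).
apply: cdiff_eq (cdiffM (ch' (cdiffW cf)) (pf i)) => // x Ux.
by have [_ ->] := grad_comp (dh _ Ux) (gradE (df _ Ux)).
Qed.

Lemma cdiffV k f : (forall x, U x -> f x != 0) -> cdiff k U f ->
  cdiff k U (fun y => (f y)^-1).
Proof.
move=> f0; elim: k => [//|k IH].
apply: (@cdiff_comp _ GRing.inv (fun r => - (r^-1 * r^-1))) => [x Ux|cf].
  apply: is_derive_eq; first by apply: is_deriveV (f0 _ Ux) (is_derive_id _ _).
  by rewrite [LHS]mulr1 -exprVn expr2.
apply: cdiff_eq (cdiffM (cdiff_cst k (-1)) (cdiffM (IH cf) (IH cf))) => // x _.
by rewrite mulN1r.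
Qed.

Lemma cdiff_trig k f : cdiff k U f ->
  cdiff k U (fun y => sin (f y)) /\ cdiff k U (fun y => cos (f y)).
Proof.
elim: k => [//|k IH] cf; have [cs cc] := IH (cdiffW cf); split.
  by apply: (cdiff_comp (h' := cos)) cf => // x _; exact: is_derive_sin.
apply: (cdiff_comp (h := cos) (h' := fun r => - sin r)) cf => // _.
by apply: cdiff_eq (cdiffM (cdiff_cst k (-1)) cs) => // x _; rewrite mulN1r.
Qed.

Lemma cdiff_sqrt k f : (forall x, U x -> 0 < f x) -> cdiff k U f ->
  cdiff k U (fun y => Num.sqrt (f y)).
Proof.
move=> f0; elim: k => [//|k IH].
apply: (@cdiff_comp _ Num.sqrt (fun r => (2 * Num.sqrt r)^-1)) => [x Ux|cf].
  exact: is_derive1_sqrt (f0 _ Ux).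
apply: cdiffV => [x Ux|]; last exact: cdiffM (cdiff_cst k 2) (IH cf).
by rewrite mulf_neq0 ?pnatr_eq0 // sqrtr_eq0 -ltNge f0.
Qed.

Lemma smooth_cst (a : R) : smooth_on U (fun=> a).
Proof. by apply/smooth_onP => k; exact: cdiff_cst. Qed.

Lemma smooth_coord j : smooth_on U (fun y : V => y 0 j).
Proof. by apply/smooth_onP => k; exact: cdiff_coord. Qed.

Lemma smoothD f g : smooth_on U f -> smooth_on U g ->
  smooth_on U (fun y => f y + g y).
Proof.
by move=> /smooth_onP sf /smooth_onP sg; apply/smooth_onP => k; exact: cdiffD.
Qed.

Lemma smoothM f g : smooth_on U f -> smooth_on U g ->
  smooth_on U (fun y => f y * g y).
Proof.
by move=> /smooth_onP sf /smooth_onP sg; apply/smooth_onP => k; exact: cdiffM.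
Qed.

Lemma smoothN f : smooth_on U f -> smooth_on U (fun y => - f y).
Proof.
move=> sf; apply: smooth_eq (smoothM (smooth_cst (-1)) sf) => // x _.
by rewrite mulN1r.
Qed.

Lemma smoothB f g : smooth_on U f -> smooth_on U g ->
  smooth_on U (fun y => f y - g y).
Proof. by move=> sf sg; exact: smoothD sf (smoothN sg). Qed.

Lemma smoothX f n : smooth_on U f -> smooth_on U (fun y => f y ^+ n).
Proof.
move=> sf; elim: n => [|n IH]; first exact: smooth_cst.
by apply: smooth_eq (smoothM sf IH) => // x _; rewrite exprS.
Qed.

Lemma smoothV f : (forall x, U x -> f x != 0) -> smooth_on U f ->
  smooth_on U (fun y => (f y)^-1).
Proof.
by move=> f0 /smooth_onP sf; apply/smooth_onP => k; exact: cdiffV.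
Qed.

Lemma smooth_sin f : smooth_on U f -> smooth_on U (fun y => sin (f y)).
Proof.
by move=> /smooth_onP sf; apply/smooth_onP => k; have [] := cdiff_trig (sf k).
Qed.

Lemma smooth_cos f : smooth_on U f -> smooth_on U (fun y => cos (f y)).
Proof.
by move=> /smooth_onP sf; apply/smooth_onP => k; have [] := cdiff_trig (sf k).
Qed.

Lemma smooth_sqrt f : (forall x, U x -> 0 < f x) -> smooth_on U f ->
  smooth_on U (fun y => Num.sqrt (f y)).
Proof.
by move=> f0 /smooth_onP sf; apply/smooth_onP => k; exact: cdiff_sqrt.
Qed.

Lemma smooth_sum (I : Type) (r : seq I) (F : I -> V -> R) :
  (forall k, smooth_on U (F k)) -> smooth_on U (fun y => \sum_(k <- r) F k y).
Proof.
move=> sF; elim: r => [|k r IH].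
  by apply: smooth_eq (smooth_cst 0) => // x _; rewrite big_nil.
by apply: smooth_eq (smoothD (sF k) IH) => // x _; rewrite big_cons.
Qed.

Lemma smooth_prod (I : Type) (r : seq I) (F : I -> V -> R) :
  (forall k, smooth_on U (F k)) -> smooth_on U (fun y => \prod_(k <- r) F k y).
Proof.
move=> sF; elim: r => [|k r IH].
  by apply: smooth_eq (smooth_cst 1) => // x _; rewrite big_nil.
by apply: smooth_eq (smoothM (sF k) IH) => // x _; rewrite big_cons.
Qed.

Lemma smooth_det m (A : V -> 'M[R]_m) :
  (forall i j, smooth_on U (fun y => A y i j)) ->
  smooth_on U (fun y => \det (A y)).
Proof.
move=> sA; apply: smooth_sum => s; apply: smoothM; first exact: smooth_cst.
by apply: smooth_prod => i.
Qed.

(** Cramer's rule. *)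
Lemma smooth_invmx m (A : V -> 'M[R]_m) i j :
  (forall x, U x -> A x \in unitmx) ->
  (forall i j, smooth_on U (fun y => A y i j)) ->
  smooth_on U (fun y => invmx (A y) i j).
Proof.
move=> uA sA.
apply: (@smooth_eq _ _ (fun y => (\det (A y))^-1 * (\adj (A y)) i j)) => //.
  by move=> x Ux; rewrite /invmx uA // [RHS]mxE.
apply: smoothM.
  by apply: smoothV (smooth_det sA) => x /uA; rewrite unitmxE unitfE.
apply: (@smooth_eq _ _ (fun y => (-1) ^+ (j + i) * \det (row' j (col' i (A y))))) => //.
  by move=> x Ux; rewrite mxE.
apply: smoothM; first exact: smooth_cst.
apply: smooth_det => k l.
by apply: smooth_eq (sA (lift j k) (lift i l)) => // x _; rewrite !mxE.
Qed.

End ClosureR.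

Section Matrix.
Context {m n : nat}.
Implicit Types (F : V -> 'M[R]_(m.+1, n.+1)) (U : set V).

Lemma differentiable_mxP F x :
  differentiable F x <-> forall i j, differentiable (fun y => F y i j) x.
Proof.
split=> [dF i j|dF].
  exact: (differentiable_comp dF (differentiable_coord _ i j)).
have -> : F = \sum_(i < m.+1) (\sum_(j < n.+1) (fun y => F y i j *: delta_mx i j)).
  apply/funext => y; rewrite [LHS]matrix_sum_delta fct_sumE.
  by apply: eq_bigr => i _; rewrite fct_sumE.
apply: differentiable_sum => i; apply: differentiable_sum => j.
exact: differentiableZl.
Qed.

Lemma partial_mx F x k i j : differentiable F x ->
  partial k F x i j = partial k (fun y => F y i j) x.
Proof.
by move=> dF; rewrite /partial derive_mx ?mxE //; exact: diff_derivable.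
Qed.

Lemma smooth_mxP U F : open U ->
  smooth_on U F <-> forall i j, smooth_on U (fun y => F y i j).
Proof.
move=> oU; split=> [sF i j|sF].
  apply/smooth_onP => k; have {sF} := (smooth_onP U F).1 sF k.
  elim: k F => [//|k IH] F [dF pF]; split=> [x Ux|l].
    by have := (differentiable_mxP F x).1 (dF _ Ux) i j.
  apply: cdiff_eq (IH _ (pF l)) => // x Ux; exact: partial_mx (dF _ Ux).
apply/smooth_onP => k.
have {sF} : forall i j, cdiff k U (fun y => F y i j).
  by move=> i j; apply/(smooth_onP U _).1.
elim: k F => [//|k IH] F sF.
have dF x : U x -> differentiable F x.
  by move=> Ux; apply/differentiable_mxP => i j; have [+ _] := sF i j; apply.
split=> // l; apply: IH => i j; have [_ /(_ l)] := sF i j.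
by apply: cdiff_eq => // x Ux; rewrite partial_mx //; exact: dF.
Qed.

End Matrix.
End Smooth.

(** * Chain rule and symmetry of second derivatives *)

Section Chain.
Context {R : realType} {d m : nat} {W : normedModType R}.
Local Notation V := 'rV[R]_d.+1.

Lemma diff_partial (F : V -> W) x v : differentiable F x ->
  'd F x v = \sum_i v 0 i *: partial i F x.
Proof.
move=> dF; rewrite {1}[v]row_sum_delta linear_sum.
by apply: eq_bigr => i _; rewrite linearZ /= /partial deriveE.
Qed.

Lemma is_derive_curve (F : V -> W) (c : R -> V) (t : R) (c' : V) :
  is_derive t 1 c c' -> differentiable F (c t) ->
  is_derive t 1 (F \o c) (\sum_i c' 0 i *: partial i F (c t)).
Proof.
move=> [dc <-] dF.
have dc' : differentiable c t by exact/derivable1_diffP.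
have dFc := differentiable_comp dc' dF.
split; first exact: diff_derivable.
by rewrite deriveE // diff_comp //= -diff_partial // deriveE.
Qed.

Lemma is_derive_line (F : V -> W) (x v : V) (t : R) :
  differentiable F (x + t *: v) ->
  is_derive t 1 (fun s => F (x + s *: v)) ('D_v F (x + t *: v)).
Proof.
move=> dF; have dc : is_derive t 1 (fun s : R => x + s *: v) v.
  have : is_diff t (fun s : R => x + s *: v) (fun s => s *: v).
    apply: is_diff_eq; apply/funext => s; exact: add0r.
  move=> [df fE]; split; first exact: diff_derivable.
  by rewrite deriveE // fE scale1r.
by have := is_derive_curve dc dF; rewrite -diff_partial // -deriveE.
Qed.

Lemma jacobianE (F : V -> 'rV[R]_m.+1) x i a : differentiable F x ->
  'J F x i a = partial i F x 0 a.
Proof.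
move=> dF; rewrite /jacobian /lin1_mx mxE /partial deriveE //.
Qed.

End Chain.

Section Schwarz.
Context {R : realType} {d : nat}.
Local Notation V := 'rV[R]_d.+1.

Lemma partial_comp {m : nat} (F : 'rV[R]_m.+1 -> R) (Phi : V -> 'rV[R]_m.+1) x i :
  differentiable Phi x -> differentiable F (Phi x) ->
  partial i (F \o Phi) x = \sum_a partial i Phi x 0 a * partial a F (Phi x).
Proof.
move=> dP dF; have dFP := differentiable_comp dP dF.
by rewrite [LHS]deriveE // diff_comp //= diff_partial // -deriveE.
Qed.

Let line_mvt (F : V -> R) (x v : V) (h : R) : 0 < h ->
  (forall s, 0 <= s <= h -> differentiable F (x + s *: v)) ->
  exists2 s, 0 <= s <= h & F (x + h *: v) - F x = h * 'D_v F (x + s *: v).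
Proof.
move=> h0 dF.
have dl s : s \in `[0, h] -> is_derive s 1 (fun s => F (x + s *: v)) ('D_v F (x + s *: v)).
  by move=> sh; apply: is_derive_line; apply: dF; move: sh; rewrite in_itv.
pose g s := F (x + s *: v); pose dg s := 'D_v F (x + s *: v).
have gd s : s \in `]0, h[ -> is_derive s 1 g (dg s).
  by rewrite in_itv /= => /andP[s0 sh]; apply: dl; rewrite in_itv /= !ltW.
have gc : {within `[0, h], continuous g}.
  by apply: derivable_within_continuous => s sh; case: (dl s sh).
have [s sh] := MVT_segment (ltW h0) gd gc; rewrite /g /dg.
rewrite scale0r addr0 subr0 mulrC => E.
by exists s => //; move: sh; rewrite in_itv.
Qed.

Let corner_ball (x : V) (r : R) : 0 < r -> exists2 r' : R, 0 < r' &
  forall s t : R, 0 <= s <= r' -> 0 <= t <= r' -> forall a b : 'I_d.+1,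
    ball x r (x + s *: (delta_mx 0 a : V) + t *: (delta_mx 0 b : V)).
Proof.
move=> r0; exists (r / 3); first by rewrite divr_gt0.
move=> s t /andP[s0 sr] /andP[t0 tr] a b.
rewrite -ball_normE /= opprD addrA opprD addrA subrr sub0r.
rewrite -opprD normrN (le_lt_trans (ler_normD _ _)) // !normrZ.
have ne k : `|delta_mx 0 k : V| <= 1.
  by apply: rV_norm_le => // j; rewrite mxE; case: (_ && _); rewrite ?normr1 ?normr0.
have H (u : R) k : 0 <= u -> u <= r / 3 -> `|u| * `|delta_mx 0 k : V| <= r / 3.
  by move=> u0 ur; rewrite ger0_norm //; apply: le_trans ur; rewrite ler_piMr.
have := lerD (H s a s0 sr) (H t b t0 tr) => /le_lt_trans; apply.
by move: r0; lra.
Qed.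

(** Two applications of the mean value theorem, in either order, show that both mixed
partial derivatives are limits of the same second difference. *)
Lemma partial_sym (U : set V) (f : V -> R) x i j : open U -> smooth_on U f -> U x ->
  partial i (partial j f) x = partial j (partial i f) x.
Proof.
move=> oU sf Ux.
pose e k : V := delta_mx 0 k.
have [r r0 rU] : exists2 r : R, 0 < r & forall s t : R, 0 <= s <= r -> 0 <= t <= r ->
    forall a b, U (x + s *: e a + t *: e b).
  have /nbhs_ballP[/= r r0 rU] := open_nbhs_nbhs (conj oU Ux).
  by have [r' r'0 H] := corner_ball x r0; exists r' => // s t s0 t0 a b; apply/rU/H.
have key (h : R) a b : 0 < h <= r -> exists s t, [/\ 0 <= s <= h, 0 <= t <= h &
    f (x + h *: e a + h *: e b) - f (x + h *: e a) - f (x + h *: e b) + f x =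
    h ^+ 2 * partial b (partial a f) (x + s *: e a + t *: e b)].
  move=> /andP[h0 hr].
  pose g y := f (y + h *: e b) - f y.
  have Ug s t c c' : 0 <= s <= h -> 0 <= t <= h -> U (x + s *: e c + t *: e c').
    by move=> /andP[? sh] /andP[? th]; apply: rU; rewrite ?(le_trans sh) ?(le_trans th) //;
      apply/andP.
  have hh : 0 <= h <= h by rewrite lexx ltW.
  have zh : 0 <= (0 : R) <= h by rewrite lexx ltW.
  have dsh s : 0 <= s <= h -> is_diff (x + s *: e a) (fun y => f (y + h *: e b))
      ('d f (x + s *: e a + h *: e b)).
    move=> sh; have df := differentiableP (smooth_diff sf (Ug s h a b sh hh)).
    have ds : is_diff (x + s *: e a) (fun y : V => y + h *: e b) id.
      by apply: is_diff_eq; apply/funext => y; exact: addr0.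
    exact: (is_diff_comp ds df).
  have df0 s : 0 <= s <= h -> differentiable f (x + s *: e a).
    move=> sh; apply: (smooth_diff sf).
    by have := Ug s 0 a b sh zh; rewrite scale0r addr0.
  have [s sh gE] : exists2 s, 0 <= s <= h &
      g (x + h *: e a) - g x = h * 'D_(e a) g (x + s *: e a).
    apply: (line_mvt h0) => s sh.
    by have [d1 _] := dsh s sh; exact: (differentiableB d1 (df0 _ sh)).
  have DgE : 'D_(e a) g (x + s *: e a) =
      partial a f (x + s *: e a + h *: e b) - partial a f (x + s *: e a).
    have [d1 d1E] := dsh s sh.
    rewrite /g deriveB; [|exact: diff_derivable|exact: diff_derivable (df0 _ sh)].
    have d2 := smooth_diff sf (Ug s h a b sh hh).
    by rewrite (deriveE _ d1) d1E -(deriveE _ d2).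
  have [t th tE] : exists2 t, 0 <= t <= h &
      partial a f (x + s *: e a + h *: e b) - partial a f (x + s *: e a) =
      h * 'D_(e b) (partial a f) (x + s *: e a + t *: e b).
    apply: (line_mvt h0) => t th.
    exact: smooth_diff (smooth_partial a sf) (Ug s t a b sh th).
  exists s, t; split=> //; rewrite -[RHS]/(h ^+ 2 * 'D_(e b) (partial a f) _).
  rewrite expr2 -mulrA -tE -DgE -gE /g.
  by rewrite opprB addrA [RHS]addrAC.
apply/eqP; rewrite -subr_eq0 -normr_le0; apply/ler_addgt0Pr => eps eps0; rewrite add0r.
have ct a b : {for x, continuous (partial a (partial b f))}.
  exact: differentiable_continuous (smooth_diff (smooth_partial a (smooth_partial b sf)) Ux).
have near_ct a b : exists2 r, 0 < r & forall s t c c', 0 <= s <= r -> 0 <= t <= r ->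
    `|partial a (partial b f) x - partial a (partial b f) (x + s *: e c + t *: e c')|
      < eps / 2.
  have /cvgrPdist_lt/(_ (eps / 2)) := ct a b.
  rewrite divr_gt0 // => /(_ isT) /nbhs_ballP[/= r1 r10 rP].
  by have [r' r'0 H] := corner_ball x r10; exists r' => // s t c c' s0 t0; apply/rP/H.
have [r1 r10 P1] := near_ct i j; have [r2 r20 P2] := near_ct j i.
pose h := Num.min r (Num.min r1 r2).
have h0 : 0 < h by rewrite !lt_min r0 r10.
have hr : 0 < h <= r by rewrite h0 ge_min lexx.
have hr1 : h <= r1 by rewrite /h !ge_min lexx orbT.
have hr2 : h <= r2 by rewrite /h !ge_min lexx !orbT.
have [s [t [/andP[s0 sh] /andP[t0 th] E1]]] := key h i j hr.
have [s' [t' [/andP[s'0 s'h] /andP[t'0 t'h] E2]]] := key h j i hr.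
have h20 : h ^+ 2 != 0 by rewrite expf_neq0 // gt_eqF.
have E3 : f (x + h *: e i + h *: e j) - f (x + h *: e i) - f (x + h *: e j) + f x =
    f (x + h *: e j + h *: e i) - f (x + h *: e j) - f (x + h *: e i) + f x.
  rewrite (addrAC x (h *: e j)).
  move: (f (x + h *: e i + h *: e j)) (f (x + h *: e i)) => p q.
  by move: (f (x + h *: e j)) (f x) => p' q'; rewrite (addrAC p).
have := etrans (esym E1) (etrans E3 E2) => /(mulfI h20) E.
have := P1 s' t' j i; rewrite -E s'0 t'0 (le_trans s'h hr1) (le_trans t'h hr1).
have := P2 s t i j; rewrite s0 t0 (le_trans sh hr2) (le_trans th hr2).
move: (partial j (partial i f) _) (partial j (partial i f) x) => p q.
move: (partial i (partial j f) x) => p' /(_ isT isT) A2 /(_ isT isT) A1.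
apply: le_trans (ler_distD p _ _) _; rewrite [leRHS]splitr.
by apply: lerD; [exact: ltW | rewrite distrC; exact: ltW].
Qed.

End Schwarz.

(** * Transformation law of the scalar curvature *)

Section SmoothComposition.
Context {R : realType} {d m : nat}.
Context (U : set 'rV[R]_d.+1) (U' : set 'rV[R]_m.+1).
Context (Phi : 'rV[R]_d.+1 -> 'rV[R]_m.+1).
Hypothesis oU : open U.
Hypothesis sPhi : smooth_on U Phi.
Hypothesis PhiU : forall x, U x -> U' (Phi x).

Lemma smooth_rV_coord a : smooth_on U (fun y => Phi y 0 a).
Proof. exact: ((smooth_mxP Phi oU).1 sPhi 0 a). Qed.

Lemma partial_rV_comp (h : 'rV[R]_m.+1 -> R) x i : U x -> differentiable h (Phi x) ->
  partial i (h \o Phi) x =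
  \sum_a partial i (fun y => Phi y 0 a) x * partial a h (Phi x).
Proof.
move=> Ux dh; have dP := smooth_diff sPhi Ux.
by rewrite partial_comp //; apply: eq_bigr => a _; rewrite partial_mx.
Qed.

Lemma smooth_comp (h : 'rV[R]_m.+1 -> R) : smooth_on U' h -> smooth_on U (h \o Phi).
Proof.
move=> sh; apply/smooth_onP => k; elim: k h sh => [//|k IH] h sh.
split=> [x Ux|i].
  exact: differentiable_comp (smooth_diff sPhi Ux) (smooth_diff sh (PhiU Ux)).
have S : cdiff k U (fun y => \sum_(a <- index_enum 'I_m.+1)
    partial i (fun y => Phi y 0 a) y * (partial a h \o Phi) y).
  elim: (index_enum _) => [|a r IHr].
    by apply: cdiff_eq (cdiff_cst oU k 0) => // x _; rewrite big_nil.
  have c1 := (smooth_onP _ _).1 (smooth_partial i (smooth_rV_coord a)) k.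
  apply: cdiff_eq (cdiffD oU (cdiffM oU c1 (IH _ (smooth_partial a sh))) IHr) => //.
  by move=> x _; rewrite big_cons.
apply: cdiff_eq S => // x Ux.
by rewrite [RHS]partial_rV_comp //; exact: smooth_diff sh (PhiU Ux).
Qed.

End SmoothComposition.

Section Christoffel.
Context {R : realType} {d : nat}.
Local Notation V := 'rV[R]_d.+1.
Local Notation I := 'I_d.+1.
Implicit Types (G : V -> 'M[R]_d.+1) (x : V).

Definition lowered G (l i j : I) x : R :=
  partial i (fun y => G y j l) x + partial j (fun y => G y i l) x
  - partial l (fun y => G y i j) x.

(** With its upper index lowered a Christoffel symbol no longer involves the inverse
metric, and can be compared with that of a pulled-back metric. *)
Lemma christoffel_lower G l i j x : G x \in unitmx ->
  \sum_k G x l k * christoffel G k i j x = 2^-1 * lowered G l i j x.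
Proof.
move=> uG; pose c : 'cV[R]_d.+1 := \col_l lowered G l i j x.
have cE k : christoffel G k i j x = 2^-1 * (invmx (G x) *m c) k 0.
  by rewrite mxE; congr (_ * _); apply: eq_bigr => l' _; rewrite mxE.
transitivity (2^-1 * (G x *m (invmx (G x) *m c)) l 0).
  rewrite [X in _ * X]mxE mulr_sumr; apply: eq_bigr => k _.
  by rewrite cE mulrCA.
by rewrite mulmxA mulmxV // mul1mx mxE.
Qed.

Lemma smooth_christoffel (U : set V) G k i j : open U ->
  smooth_on U G -> (forall x, U x -> G x \in unitmx) ->
  smooth_on U (christoffel G k i j).
Proof.
move=> oU sG uG; have sGe := (smooth_mxP G oU).1 sG.
apply: smoothM => //; first exact: smooth_cst.
apply: smooth_sum => // l; apply: smoothM => //; first exact: smooth_invmx.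
by apply: smoothB => //; [apply: smoothD => //|]; exact: smooth_partial.
Qed.

End Christoffel.

(** The transformation law of the curvature, as an identity between the values at
one point of the Christoffel symbols [c], [c'] of two metrics, of their
derivatives [dc], [dc'], and of the first three derivatives [p], [h], [dh] of the
map: differentiating the law of the Christoffel symbols and antisymmetrizing
leaves only the tensorial terms. *)
Lemma riemann_transform_algebra (R : comPzRingType) (I : finType) (p : I -> I -> R)
    (h : I -> I -> I -> R) (dh : I -> I -> I -> I -> R)
    (c c' : I -> I -> I -> R) (dc dc' : I -> I -> I -> I -> R) :
  (forall i j a, \sum_k c k i j * p k a =
    h i j a + \sum_a1 \sum_b p i a1 * p j b * c' a a1 b) ->
  (forall i j l a, \sum_k (dc i k j l * p k a + c k j l * h i k a) =
    dh i j l a + \sum_a1 \sum_b ((h i j a1 * p l b + p j a1 * h i l b) * c' a a1 b +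
      p j a1 * p l b * \sum_e p i e * dc' e a a1 b)) ->
  (forall i j a, h i j a = h j i a) ->
  (forall i j l a, dh i j l a = dh j i l a) ->
  forall i j l a,
  \sum_k (dc i k j l - dc j k i l +
    \sum_m (c k i m * c m j l - c k j m * c m i l)) * p k a =
  \sum_a1 \sum_b \sum_e p i a1 * p j b * p l e *
    (dc' a1 a b e - dc' b a a1 e +
     \sum_m (c' a a1 m * c' m b e - c' a b m * c' m a1 e)).
Proof.
move=> law dlaw hC dhC i j l a.
pose bil u v b := \sum_a1 \sum_b1 u a1 * v b1 * c' b a1 b1 : R.
pose D i j := \sum_a1 \sum_b \sum_e p i a1 * p j b * p l e *
  (dc' a1 a b e + \sum_m c' a a1 m * c' m b e).
pose S i j := dh i j l a + bil (h i j) (p l) a +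
  (bil (p j) (h i l) a + bil (p i) (h j l) a).
have half i' j' : \sum_k (dc i' k j' l + \sum_m c k i' m * c m j' l) * p k a =
    S i' j' + D i' j'.
  have e1 : \sum_k dc i' k j' l * p k a = - (\sum_k c k j' l * h i' k a) +
      (dh i' j' l a + (bil (h i' j') (p l) a + bil (p j') (h i' l) a +
      \sum_a1 \sum_b \sum_e p i' a1 * p j' b * p l e * dc' a1 a b e)).
    apply: (addIr (\sum_k c k j' l * h i' k a)).
    rewrite -big_split /= dlaw addrAC addNr add0r.
    congr (_ + _); rewrite /bil -big_split /=.
    have -> : \sum_a1 \sum_b \sum_e p i' a1 * p j' b * p l e * dc' a1 a b e =
        \sum_a1 \sum_b p j' a1 * p l b * \sum_e p i' e * dc' e a a1 b.
      rewrite exchange_big; apply: eq_bigr => b _ /=.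
      rewrite exchange_big; apply: eq_bigr => e _ /=; rewrite mulr_sumr.
      by apply: eq_bigr => a1 _; ring.
    rewrite -big_split; apply: eq_bigr => a1 _ /=.
    rewrite -!big_split; apply: eq_bigr => b _ /=; ring.
  have e2 : \sum_k (\sum_m c k i' m * c m j' l) * p k a =
      \sum_m c m j' l * h i' m a +
      (bil (p i') (h j' l) a + bil (p i') (bil (p j') (p l)) a).
    transitivity (\sum_m c m j' l * \sum_k c k i' m * p k a).
      under eq_bigr do rewrite mulr_suml.
      rewrite exchange_big; apply: eq_bigr => m _ /=; rewrite mulr_sumr.
      by apply: eq_bigr => k _; ring.
    under eq_bigr do rewrite law mulrDr.
    rewrite big_split; congr (_ + _) => /=.
    transitivity (bil (p i') (fun b => \sum_m c m j' l * p m b) a).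
      rewrite /bil; under eq_bigr do rewrite mulr_sumr.
      rewrite exchange_big; apply: eq_bigr => a1 _ /=.
      under eq_bigr do rewrite mulr_sumr.
      rewrite exchange_big; apply: eq_bigr => b _ /=; rewrite mulr_sumr mulr_suml.
      by apply: eq_bigr => m _; ring.
    rewrite /bil -big_split; apply: eq_bigr => a1 _ /=.
    by rewrite -big_split; apply: eq_bigr => b _ /=; rewrite law -/(bil _ _ _); ring.
  under eq_bigr do rewrite mulrDl.
  rewrite big_split /= e1 e2 /S /D.
  have -> : \sum_a1 \sum_b \sum_e p i' a1 * p j' b * p l e *
        (dc' a1 a b e + \sum_m c' a a1 m * c' m b e) =
      \sum_a1 \sum_b \sum_e p i' a1 * p j' b * p l e * dc' a1 a b e +
      bil (p i') (bil (p j') (p l)) a.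
    rewrite /bil -big_split; apply: eq_bigr => a1 _ /=.
    transitivity (\sum_b \sum_e p i' a1 * p j' b * p l e * dc' a1 a b e +
      \sum_b \sum_e \sum_m p i' a1 * p j' b * p l e * (c' a a1 m * c' m b e)).
      rewrite -big_split; apply: eq_bigr => b _ /=.
      rewrite -big_split; apply: eq_bigr => e _ /=.
      by rewrite mulrDr mulr_sumr.
    congr (_ + _).
    transitivity (\sum_m \sum_b \sum_e
        p i' a1 * p j' b * p l e * (c' a a1 m * c' m b e)).
      rewrite [RHS]exchange_big; apply: eq_bigr => b _ /=.
      by rewrite [RHS]exchange_big.
    apply: eq_bigr => m _; rewrite mulr_sumr mulr_suml; apply: eq_bigr => b _.
    by rewrite mulr_sumr mulr_suml; apply: eq_bigr => e _; ring.
  ring.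
have S_sym : S i j = S j i.
  rewrite /S dhC; congr (_ + _); last exact: addrC.
  congr (_ + _); apply: eq_bigr => a1 _; apply: eq_bigr => b _.
  by rewrite hC.
transitivity (\sum_k (dc i k j l + \sum_m c k i m * c m j l) * p k a -
              \sum_k (dc j k i l + \sum_m c k j m * c m i l) * p k a).
  rewrite -sumrB; apply: eq_bigr => k _; rewrite sumrB; ring.
rewrite !half S_sym opprD addrACA subrr add0r /D.
transitivity (\sum_a1 \sum_b \sum_e
  (p i a1 * p j b * p l e * (dc' a1 a b e + \sum_m c' a a1 m * c' m b e) -
   p j b * p i a1 * p l e * (dc' b a a1 e + \sum_m c' a b m * c' m a1 e))).
  rewrite [X in _ - X]exchange_big -sumrB; apply: eq_bigr => a1 _ /=.
  rewrite -sumrB; apply: eq_bigr => b _ /=.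
  by rewrite -sumrB.
apply: eq_bigr => a1 _; apply: eq_bigr => b _; apply: eq_bigr => e _.
rewrite sumrB; ring.
Qed.

Section Transformation.
Context {R : realType} {d : nat}.
Local Notation V := 'rV[R]_d.+1.
Local Notation I := 'I_d.+1.
Context (U U' : set V) (Phi : V -> V) (G G' : V -> 'M[R]_d.+1).
Hypothesis oU : open U.
Hypothesis oU' : open U'.
Hypothesis sPhi : smooth_on U Phi.
Hypothesis PhiU : forall x, U x -> U' (Phi x).
Hypothesis sG' : smooth_on U' G'.
Hypothesis symG' : forall x, U' x -> (G' x)^T = G' x.
Hypothesis uG' : forall x, U' x -> G' x \in unitmx.
Hypothesis uJ : forall x, U x -> 'J Phi x \in unitmx.
Hypothesis GE : forall x, U x -> G x = pullback Phi G' x.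

Let P (i a : I) (x : V) : R := partial i (fun y => Phi y 0 a) x.
Let H (i j a : I) (x : V) : R := partial i (P j a) x.
Let T (a b c : I) (y : V) : R := partial a (fun y => G' y b c) y.

Let sP i a : smooth_on U (P i a).
Proof. exact/smooth_partial/smooth_rV_coord. Qed.

Let sG'e b c : smooth_on U' (fun y => G' y b c).
Proof. exact: ((smooth_mxP G' oU').1 sG'). Qed.

Let JE x i a : U x -> 'J Phi x i a = P i a x.
Proof.
move=> Ux; have dP := smooth_diff sPhi Ux.
by rewrite jacobianE // partial_mx.
Qed.

Let H_sym i j a x : U x -> H i j a x = H j i a x.
Proof. move=> Ux; exact: partial_sym oU (smooth_rV_coord oU sPhi a) Ux. Qed.

Let uG x : U x -> G x \in unitmx.
Proof.
move=> Ux; rewrite GE // /pullback !unitmx_mul unitmx_tr uJ // uG' //.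
exact: PhiU.
Qed.

Let symG x : U x -> (G x)^T = G x.
Proof.
move=> Ux; rewrite GE // /pullback !trmx_mul trmxK mulmxA symG' //.
exact: PhiU.
Qed.

Let GeE x j l : U x ->
  G x j l = \sum_c (\sum_e P j e x * G' (Phi x) e c) * P l c x.
Proof.
move=> Ux; rewrite GE // /pullback mxE; apply: eq_bigr => c _.
rewrite [X in _ * X]mxE [X in X * _]mxE JE //.
by congr (_ * _); apply: eq_bigr => e _; rewrite JE.
Qed.

Lemma smooth_pullback_metric : smooth_on U G.
Proof.
apply/(smooth_mxP G oU) => j l.
have S : smooth_on U (fun x => \sum_c (\sum_e P j e x * G' (Phi x) e c) * P l c x).
  apply: smooth_sum => // c; apply: smoothM => //; apply: smooth_sum => // e.
  by apply: smoothM => //; exact: smooth_comp (sG'e e c).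
by apply: smooth_eq S => // x Ux; rewrite GeE.
Qed.

(** The inner product [G'] at [Phi x], and the trilinear form of its derivatives. *)
Let A x (u v : I -> R) : R := \sum_c (\sum_e u e * G' (Phi x) e c) * v c.
Let tri x (u v w : I -> R) : R :=
  \sum_a \sum_b \sum_c u a * v b * w c * T a b c (Phi x).

Let A_sym x u v : U x -> A x u v = A x v u.
Proof.
move=> Ux; rewrite /A.
under eq_bigr do rewrite mulr_suml.
rewrite exchange_big; apply: eq_bigr => e _; rewrite mulr_suml.
apply: eq_bigr => c _; rewrite -[in LHS](symG' (PhiU Ux)) mxE.
by rewrite mulrAC [u e * _]mulrC [RHS]mulrAC -!mulrA; congr (_ * _); rewrite mulrC.
Qed.

Let AD x u u' v : A x (fun a => u a + u' a) v = A x u v + A x u' v.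
Proof.
rewrite /A -big_split; apply: eq_bigr => c _ /=; rewrite -mulrDl -big_split /=.
by congr (_ * _); apply: eq_bigr => e _; rewrite mulrDl.
Qed.

Let Asum x (J : finType) (k : J -> R) (u : J -> I -> R) v :
  A x (fun a => \sum_n k n * u n a) v = \sum_n k n * A x (u n) v.
Proof.
rewrite /A.
under [RHS]eq_bigr do rewrite mulr_sumr.
rewrite exchange_big; apply: eq_bigr => c _ /=.
under eq_bigr do rewrite mulr_suml.
rewrite exchange_big /= mulr_suml; apply: eq_bigr => n _.
rewrite mulrA mulr_sumr; congr (_ * _); apply: eq_bigr => e _.
by rewrite mulrA.
Qed.

Let partial_metric i j l x : U x -> partial i (fun y => G y j l) x =
  A x (fun a => H i j a x) (fun a => P l a x) +
  A x (fun a => P j a x) (fun a => H i l a x) +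
  tri x (fun a => P i a x) (fun a => P j a x) (fun a => P l a x).
Proof.
move=> Ux.
have dP j' a : grad (P j' a) x (fun i' => H i' j' a x).
  exact: gradE (smooth_diff (sP j' a) Ux).
have dGP e c : grad (fun y => G' (Phi y) e c) x
    (fun i' => \sum_a P i' a x * T a e c (Phi x)).
  have dg := smooth_diff (sG'e e c) (PhiU Ux).
  split; first exact: differentiable_comp (smooth_diff sPhi Ux) dg.
  by move=> i'; have := partial_rV_comp sPhi i' Ux dg.
transitivity (partial i
    (fun y => \sum_c (\sum_e P j e y * G' (Phi y) e c) * P l c y) x).
  apply: partial_near; apply: filterS (open_nbhs_nbhs (conj oU Ux)) => y.
  exact: GeE.
have [_ ->] := grad_sum (index_enum I)
  (fun c => gradM (grad_sum (index_enum I) (fun e => gradM (dP j e) (dGP e c))) (dP l c)).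
rewrite big_split /= -/(A x _ _) [RHS]addrAC; congr (_ + _).
have -> : tri x (fun a => P i a x) (fun a => P j a x) (fun a => P l a x) =
    \sum_c \sum_e \sum_a P i a x * P j e x * P l c x * T a e c (Phi x).
  rewrite /tri; under eq_bigr do rewrite exchange_big /=.
  rewrite exchange_big; apply: eq_bigr => c _ /=.
  by rewrite exchange_big.
rewrite /A -big_split; apply: eq_bigr => c _ /=.
rewrite big_split /= mulrDl; congr (_ + _).
rewrite mulr_suml; apply: eq_bigr => e _; rewrite mulr_sumr mulr_suml.
by apply: eq_bigr => a _; ring.
Qed.

Let triE1 x u v w : tri x u v w =
  \sum_a \sum_b u a * v b * \sum_c w c * T a b c (Phi x).
Proof.
apply: eq_bigr => a _; apply: eq_bigr => b _; rewrite mulr_sumr.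
by apply: eq_bigr => c _; rewrite !mulrA.
Qed.

Let triE2 x u v w : tri x u v w =
  \sum_a \sum_b v a * u b * \sum_c w c * T b a c (Phi x).
Proof.
rewrite triE1 exchange_big; apply: eq_bigr => a _; apply: eq_bigr => b _.
by rewrite [u b * _]mulrC.
Qed.

Let triE3 x u v w : tri x w u v =
  \sum_a \sum_b u a * v b * \sum_c w c * T c a b (Phi x).
Proof.
rewrite /tri exchange_big; apply: eq_bigr => a _ /=.
rewrite exchange_big; apply: eq_bigr => b _ /=; rewrite mulr_sumr.
by apply: eq_bigr => c _; ring.
Qed.

Let A_inj x (u v : I -> R) : U x ->
  (forall l, A x u (fun a => P l a x) = A x v (fun a => P l a x)) -> u =1 v.
Proof.
move=> Ux uv; pose N := G' (Phi x) *m ('J Phi x)^T.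
have uN : N \in unitmx by rewrite unitmx_mul unitmx_tr uJ // uG' //; exact: PhiU.
have AE w l : A x w (fun a => P l a x) = ((\row_a w a) *m N) 0 l.
  rewrite /N mulmxA mxE; apply: eq_bigr => c _; rewrite [X in _ = _ * X]mxE JE //.
  by rewrite [X in _ = X * _]mxE; congr (_ * _); apply: eq_bigr => e _; rewrite mxE.
have : \row_a u a = \row_a v a.
  apply: (can_inj (mulmxK uN)); apply/rowP => l; by rewrite -!AE.
by move=> /rowP E a; have := E a; rewrite !mxE.
Qed.

(** Both sides are determined by their inner products with the columns of the Jacobian.
For these the law is the Koszul formula of the pulled-back metric, in which the second
derivatives of [Phi] survive exactly once. *)
Lemma christoffel_transform x i j c : U x ->
  \sum_k christoffel G k i j x * P k c x =
  H i j c x + \sum_a \sum_b P i a x * P j b x * christoffel G' c a b (Phi x).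
Proof.
move=> Ux; move: c; apply: (A_inj Ux) => l.
rewrite Asum AD.
have -> : \sum_n christoffel G n i j x * A x (fun a => P n a x) (fun a => P l a x) =
    \sum_k G x l k * christoffel G k i j x.
  apply: eq_bigr => k _; rewrite -[X in _ * X](GeE k l Ux) mulrC; congr (_ * _).
  by rewrite -[in LHS](symG Ux) mxE.
rewrite christoffel_lower ?uG // /lowered !partial_metric //.
have -> : A x (fun c => \sum_a \sum_b P i a x * P j b x * christoffel G' c a b (Phi x))
    (fun a => P l a x) =
    \sum_a \sum_b P i a x * P j b x *
      \sum_c P l c x * (2^-1 * lowered G' c a b (Phi x)).
  under [in LHS]eq_fun do rewrite pair_big /=.
  rewrite Asum [RHS]pair_big; apply: eq_bigr => -[a b] _ /=; congr (_ * _).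
  rewrite /A; apply: eq_bigr => f _; rewrite mulrC; congr (_ * _).
  rewrite -christoffel_lower ?uG' //; last exact: PhiU.
  apply: eq_bigr => e _; rewrite mulrC; congr (_ * _).
  by rewrite -[in LHS](symG' (PhiU Ux)) mxE.
have -> : \sum_a \sum_b P i a x * P j b x *
      \sum_c P l c x * (2^-1 * lowered G' c a b (Phi x)) =
    2^-1 * (tri x (fun a => P i a x) (fun a => P j a x) (fun a => P l a x) +
      tri x (fun a => P j a x) (fun a => P i a x) (fun a => P l a x) -
      tri x (fun a => P l a x) (fun a => P i a x) (fun a => P j a x)).
  rewrite [X in _ * (X + _ - _)]triE1 [X in _ * (_ + X - _)]triE2.
  rewrite [X in _ * (_ - X)]triE3 -big_split -sumrB mulr_sumr; apply: eq_bigr => a _ /=.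
  rewrite -big_split -sumrB mulr_sumr; apply: eq_bigr => b _ /=.
  rewrite -mulrDr -mulrBr -big_split -sumrB mulrCA; congr (_ * _).
  rewrite mulr_sumr; apply: eq_bigr => c _ /=.
  rewrite /lowered /T; ring.
have Hf i' j' : (fun a => H i' j' a x) = (fun a => H j' i' a x).
  by apply/funext => a; exact: H_sym.
have E1 := congr1 (fun u => A x u (fun a => P l a x)) (Hf j i).
have E2 := etrans (A_sym (fun a => H l i a x) (fun a => P j a x) Ux)
  (congr1 (A x (fun a => P j a x)) (Hf l i)).
have E3 := congr1 (A x (fun a => P i a x)) (Hf l j).
cbv beta in E1.
have half (p q r p' q' r' t1 t2 t3 : R) : p' = p -> q' = q -> r' = r ->
    2^-1 * (p + q + t1 + (p' + r + t2) - (q' + r' + t3)) =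
    p + 2^-1 * (t1 + t2 - t3) by move=> -> -> ->; field.
exact: half E1 E2 E3.
Qed.

Let sC k i j : smooth_on U (christoffel G k i j).
Proof. exact: smooth_christoffel oU smooth_pullback_metric uG. Qed.

Let sC' k i j : smooth_on U' (christoffel G' k i j).
Proof. exact: smooth_christoffel oU' sG' uG'. Qed.

Let christoffel_transform_partial x i j l a : U x ->
  \sum_k (partial i (christoffel G k j l) x * P k a x +
          christoffel G k j l x * H i k a x) =
  partial i (H j l a) x + \sum_a1 \sum_b
    ((H i j a1 x * P l b x + P j a1 x * H i l b x) * christoffel G' a a1 b (Phi x) +
     P j a1 x * P l b x *
       \sum_e P i e x * partial e (christoffel G' a a1 b) (Phi x)).
Proof.
move=> Ux.
have dP j' b : grad (P j' b) x (fun i' => H i' j' b x).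
  exact: gradE (smooth_diff (sP j' b) Ux).
have dC k : grad (christoffel G k j l) x (fun i' => partial i' (christoffel G k j l) x).
  exact: gradE (smooth_diff (sC k j l) Ux).
have dH : grad (H j l a) x (fun i' => partial i' (H j l a) x).
  exact: gradE (smooth_diff (smooth_partial j (sP l a)) Ux).
have dC' a1 b : grad (fun y => christoffel G' a a1 b (Phi y)) x
    (fun i' => \sum_e P i' e x * partial e (christoffel G' a a1 b) (Phi x)).
  have dc := smooth_diff (sC' a a1 b) (PhiU Ux).
  split; first exact: differentiable_comp (smooth_diff sPhi Ux) dc.
  by move=> i'; have := partial_rV_comp sPhi i' Ux dc.
have [_ E1] := grad_sum (index_enum I) (fun k => gradM (dC k) (dP k a)).
have [_ E2] := gradD dH (grad_sum (index_enum I) (fun a1 =>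
  grad_sum (index_enum I) (fun b => gradM (gradM (dP j a1) (dP l b)) (dC' a1 b)))).
rewrite -E1 -E2; apply: partial_near.
apply: filterS (open_nbhs_nbhs (conj oU Ux)) => y; exact: christoffel_transform.
Qed.

Lemma riemann_transform x i j l a : U x ->
  \sum_k riemann G k l i j x * P k a x =
  \sum_a1 \sum_b \sum_e P i a1 x * P j b x * P l e x * riemann G' a e a1 b (Phi x).
Proof.
move=> Ux.
apply: (@riemann_transform_algebra _ _ (fun i a => P i a x) (fun i j a => H i j a x)
  (fun i j l a => partial i (H j l a) x) (fun k i j => christoffel G k i j x)
  (fun k i j => christoffel G' k i j (Phi x))
  (fun i k j l => partial i (christoffel G k j l) x)
  (fun i k j l => partial i (christoffel G' k j l) (Phi x))).
- by move=> i' j' a'; exact: christoffel_transform.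
- by move=> i' j' l' a'; exact: christoffel_transform_partial.
- by move=> i' j' a'; exact: H_sym.
- by move=> i' j' l' a'; exact: partial_sym oU (sP l' a') Ux.
Qed.

(** The Ricci tensor, a trace of the curvature, is covariant; in its trace with the
inverse metric the Jacobians cancel. *)
Lemma scalar_curvature_transform x : U x ->
  scalar_curvature_in G x = scalar_curvature_in G' (Phi x).
Proof.
move=> Ux; pose J := 'J Phi x; have uJx : J \in unitmx := uJ Ux.
pose Ric := \matrix_(l, j) ricci G l j x.
pose Ric' := \matrix_(l, j) ricci G' l j (Phi x).
have scalE (F : V -> 'M[R]_d.+1) z : scalar_curvature_in F z =
    \tr (invmx (F z) *m (\matrix_(l, j) ricci F l j z)^T).
  rewrite /scalar_curvature_in /mxtrace; apply: eq_bigr => i _.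
  by rewrite mxE; apply: eq_bigr => j _; rewrite !mxE.
have RicE : Ric = J *m Ric' *m J^T.
  apply/matrixP => l j; rewrite mxE.
  pose rhs i a := \sum_a1 \sum_b \sum_e
    P i a1 x * P j b x * P l e x * riemann G' a e a1 b (Phi x).
  have rE i k : riemann G k l i j x = \sum_a rhs i a * invmx J a k.
    have : (\row_k' riemann G k' l i j x) *m J = \row_a rhs i a.
      apply/rowP => a; rewrite mxE [RHS]mxE /rhs -(riemann_transform i j l a Ux).
      by apply: eq_bigr => k' _; rewrite mxE JE.
    move=> /(congr1 (fun v => (v *m invmx J) 0 k)).
    rewrite mulmxK // mxE => ->; rewrite mxE.
    by apply: eq_bigr => a _; rewrite mxE.
  have QP a a1 : \sum_i invmx J a i * P i a1 x = (a == a1)%:R.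
    have := congr1 (fun M : 'M[R]_d.+1 => M a a1) (mulVmx uJx).
    rewrite !mxE => <-; apply: eq_bigr => i _.
    by rewrite -(JE _ _ Ux).
  rewrite /ricci; under eq_bigr do rewrite rE.
  transitivity (\sum_a \sum_b \sum_e P j b x * P l e x * riemann G' a e a b (Phi x)).
    rewrite exchange_big; apply: eq_bigr => a _ /=.
    transitivity (\sum_i \sum_a1 invmx J a i * P i a1 x *
        \sum_b \sum_e P j b x * P l e x * riemann G' a e a1 b (Phi x)).
      apply: eq_bigr => i _; rewrite /rhs mulr_suml; apply: eq_bigr => a1 _.
      rewrite mulr_suml mulr_sumr; apply: eq_bigr => b _.
      rewrite mulr_suml mulr_sumr; apply: eq_bigr => e _.
      by move: (riemann _ _ _ _ _ _) (invmx J a i) => r q; ring.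
    rewrite exchange_big (bigD1 a) //= -mulr_suml QP eqxx mul1r.
    rewrite [X in _ + X]big1 ?addr0 // => a1 na; rewrite -mulr_suml QP eq_sym (negbTE na).
    exact: mul0r.
  rewrite mxE; transitivity (\sum_b \sum_e P j b x * P l e x * ricci G' e b (Phi x)).
    rewrite exchange_big; apply: eq_bigr => b _ /=.
    rewrite exchange_big; apply: eq_bigr => e _ /=.
    by rewrite -mulr_sumr.
  apply: eq_bigr => b _; rewrite [X in _ * X]mxE [X in X * _]mxE JE // mulr_suml.
  apply: eq_bigr => e _; rewrite JE // [X in _ = _ * X * _]mxE.
  by move: (ricci _ _ _ _) => r; ring.
rewrite (scalE G') (scalE G) -/Ric -/Ric' RicE.
have -> : invmx (G x) = invmx (J^T) *m invmx (G' (Phi x)) *m invmx J.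
  have uJt : J^T \in unitmx by rewrite unitmx_tr.
  have uGx := uG Ux; have uG'x := uG' (PhiU Ux).
  apply: (can_inj (mulKmx uGx)); rewrite mulmxV // GE // /pullback -/J.
  rewrite -!mulmxA (mulmxA J^T) mulmxV // mul1mx (mulmxA (G' _)) mulmxV //.
  by rewrite mul1mx mulmxV.
have uJt : J^T \in unitmx by rewrite unitmx_tr.
rewrite !trmx_mul trmxK -!mulmxA (mulmxA (invmx J)) mulVmx // mul1mx.
by rewrite mxtrace_mulC -!mulmxA mulmxV // mulmx1.
Qed.

End Transformation.

(** * The geodesic equation along a curve *)

Section CurveCalculus.
Context {R : realType}.
Implicit Types (f g : R -> R) (t : R).

Lemma is_derive_sumr (J : Type) (r : seq J) (f : J -> R -> R) t (df : J -> R) :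
  (forall i, is_derive t 1 (f i) (df i)) ->
  is_derive t 1 (fun s => \sum_(i <- r) f i s) (\sum_(i <- r) df i).
Proof.
move=> fP; elim: r => [|i r IH].
  rewrite big_nil (_ : (fun s => _) = cst 0); first exact: is_derive_cst.
  by apply/funext => s; rewrite big_nil.
rewrite big_cons (_ : (fun s => _) = f i \+ (fun s => \sum_(i <- r) f i s)).
  exact: is_deriveD (fP i) IH.
by apply/funext => s; rewrite big_cons.
Qed.

Lemma is_derive_mulr f g t (df dg : R) :
  is_derive t 1 f df -> is_derive t 1 g dg ->
  is_derive t 1 (fun s => f s * g s) (df * g t + f t * dg).
Proof.
move=> hf hg; have -> : df * g t + f t * dg = f t *: dg + g t *: df.
  by rewrite addrC; congr (_ + _); rewrite mulrC.
exact: (is_deriveM hf hg).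
Qed.

Context {m n : nat}.
Implicit Type c : R -> 'M[R]_(m, n).

Lemma derive1_mx c t i j : derivable c t 1 ->
  derive1 c t i j = derive1 (fun s => c s i j) t.
Proof. by move=> dc; rewrite !derive1E derive_mx // mxE. Qed.

Lemma is_derive_coord c t i j : derivable c t 1 ->
  is_derive t 1 (fun s => c s i j) (derive1 c t i j).
Proof.
move=> dc; split; first exact: ((derivable_mxP c t 1).1 dc).
by rewrite derive1_mx // derive1E.
Qed.

Lemma is_derive_mx c t (D : 'M[R]_(m, n)) :
  (forall i j, is_derive t 1 (fun s => c s i j) (D i j)) -> is_derive t 1 c D.
Proof.
move=> H; have dc : derivable c t 1.
  by apply/derivable_mxP => i j; have [] := H i j.
split=> //; rewrite derive_mx //; apply/matrixP => i j; rewrite mxE.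
by have [_ ->] := H i j.
Qed.

End CurveCalculus.

Lemma is_derive_derive1 {R : realType} {W : normedModType R} (c : R -> W) (t : R) D :
  is_derive t 1 c D -> derive1 c t = D.
Proof. by move=> [_ <-]; rewrite derive1E. Qed.

(** The second derivatives of the map produced by the acceleration cancel the
inhomogeneous term in the law of the Christoffel symbols. *)
Lemma geodesic_transform_algebra (R : comPzRingType) (I : finType)
    (p : I -> I -> R) (h c c' : I -> I -> I -> R) (v a : I -> R) :
  (forall i j b, \sum_k c k i j * p k b =
    h i j b + \sum_a1 \sum_e p i a1 * p j e * c' b a1 e) ->
  forall b,
  \sum_i (a i * p i b + v i * \sum_j v j * h j i b) +
  \sum_a1 \sum_e c' b a1 e * (\sum_i v i * p i a1) * (\sum_j v j * p j e) =
  \sum_k (a k + \sum_i \sum_j c k i j * v i * v j) * p k b.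
Proof.
move=> law b.
rewrite big_split /= -addrA; under [RHS]eq_bigr do rewrite mulrDl.
rewrite [RHS]big_split /=; congr (_ + _).
transitivity (\sum_i \sum_j v i * v j * (\sum_k c k j i * p k b)); last first.
  rewrite [RHS](_ : _ = \sum_k \sum_j \sum_i v i * v j * (c k j i * p k b)); last first.
    apply: eq_bigr => k _; rewrite mulr_suml; apply: eq_bigr => i _.
    by rewrite mulr_suml; apply: eq_bigr => j _; ring.
  rewrite exchange_big [RHS]exchange_big; apply: eq_bigr => j _ /=.
  rewrite [RHS]exchange_big; apply: eq_bigr => i _ /=; rewrite mulr_sumr.
  by apply: eq_bigr => k _.
rewrite [RHS](_ : _ = \sum_i \sum_j v i * v j * h j i b +
    \sum_i \sum_j v i * v j * \sum_a1 \sum_e p j a1 * p i e * c' b a1 e); last first.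
  rewrite -big_split; apply: eq_bigr => i _ /=.
  by rewrite -big_split; apply: eq_bigr => j _ /=; rewrite law mulrDr.
congr (_ + _).
  by apply: eq_bigr => i _; rewrite mulr_sumr; apply: eq_bigr => j _; rewrite mulrA.
rewrite [RHS](_ : _ = \sum_i \sum_j \sum_a1 \sum_e
    v i * v j * (p j a1 * p i e * c' b a1 e)); last first.
  apply: eq_bigr => i _; apply: eq_bigr => j _; rewrite mulr_sumr.
  by apply: eq_bigr => a1 _; rewrite mulr_sumr.
rewrite [RHS](_ : _ = \sum_a1 \sum_e \sum_j \sum_i
    v i * v j * (p j a1 * p i e * c' b a1 e)); last first.
  rewrite exchange_big /=.
  under eq_bigr do rewrite exchange_big /=.
  rewrite exchange_big; apply: eq_bigr => a1 _ /=.
  under eq_bigr do rewrite exchange_big /=.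
  by rewrite exchange_big; apply: eq_bigr => e _ /=.
apply: eq_bigr => a1 _; apply: eq_bigr => e _.
rewrite [RHS]exchange_big mulr_sumr; apply: eq_bigr => j _ /=.
by rewrite mulrAC mulr_sumr; apply: eq_bigr => i _; ring.
Qed.

Section GeodesicEquation.
Context {R : realType} {d : nat}.
Local Notation V := 'rV[R]_d.+1.
Implicit Types (G : V -> 'M[R]_d.+1) (c : R -> V) (t : R).

Definition geodesic_eq_at G c t :=
  [/\ \forall s \near t, derivable c s 1,
      derivable (derive1 c) t 1 &
      forall k, derive1 (derive1 c) t 0 k +
        \sum_a \sum_b christoffel G k a b (c t) *
          derive1 c t 0 a * derive1 c t 0 b = 0].

Lemma geodesic_eq_continuous G c t : geodesic_eq_at G c t -> {for t, continuous c}.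
Proof.
move=> [dc _ _]; apply: differentiable_continuous; apply/derivable1_diffP.
exact: nbhs_singleton dc.
Qed.

Lemma near_derive1 {W : normedModType R} (f g : R -> W) t :
  {near t, f =1 g} -> {near t, derive1 f =1 derive1 g}.
Proof.
move=> /near_join; apply: filterS => s fg.
by rewrite !derive1E; apply: near_eq_derive.
Qed.

Lemma geodesic_eq_near G c c2 t : {near t, c =1 c2} ->
  geodesic_eq_at G c t -> geodesic_eq_at G c2 t.
Proof.
move=> cc [dc ddc eqc].
have c1 := near_derive1 cc; have c2' := near_derive1 c1.
split.
- apply: filterS2 (near_join cc) dc => s cs; exact: near_eq_derivable cs.
- exact: near_eq_derivable c1 ddc.
- move=> k; rewrite -(nbhs_singleton c2') -(nbhs_singleton c1) -(nbhs_singleton cc).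
  exact: eqc.
Qed.

(** Isometries preserve geodesics. The domain [U] need only contain the point [c t], so
that the statement applies to the overlap of two charts. *)
Lemma geodesic_eq_transform (U U' : set V) (Phi : V -> V) G G' c t :
  open U -> open U' -> smooth_on U Phi -> (forall x, U x -> U' (Phi x)) ->
  smooth_on U' G' -> (forall x, U' x -> (G' x)^T = G' x) ->
  (forall x, U' x -> G' x \in unitmx) -> (forall x, U x -> 'J Phi x \in unitmx) ->
  (forall x, U x -> G x = pullback Phi G' x) ->
  U (c t) -> geodesic_eq_at G c t -> geodesic_eq_at G' (Phi \o c) t.
Proof.
move=> oU oU' sP PU sG' symG' uG' uJ GE Uct geo; have [dc ddc eqc] := geo.
pose P i a x := partial i (fun y => Phi y 0 a) x.
have sPe a : smooth_on U (fun y => Phi y 0 a) := smooth_rV_coord oU sP a.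
have near_U : \forall s \near t, U (c s).
  have := geodesic_eq_continuous geo; apply.
  exact: (open_nbhs_nbhs (conj oU Uct)).
have dPc s : U (c s) -> derivable c s 1 ->
    is_derive s 1 (Phi \o c) (\row_a \sum_i derive1 c s 0 i * P i a (c s)).
  move=> Us ds; apply: is_derive_mx => z a; rewrite mxE (ord1 z).
  have := is_derive_curve (F := fun y => Phi y 0 a) (c := c) (t := s)
    (c' := derive1 c s) _ (smooth_diff (sPe a) Us).
  by apply; split=> //; rewrite derive1E.
have dP1 : \forall s \near t, derive1 (Phi \o c) s =
    \row_a \sum_i derive1 c s 0 i * P i a (c s).
  by near=> s; apply: is_derive_derive1; apply: dPc; near: s.
have ddP : is_derive t 1 (derive1 (Phi \o c))
    (\row_a \sum_i (derive1 (derive1 c) t 0 i * P i a (c t) +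
      derive1 c t 0 i * \sum_j derive1 c t 0 j * partial j (P i a) (c t))).
  apply: (@near_eq_is_derive _ _ _ (fun s => \row_a \sum_i derive1 c s 0 i * P i a (c s))).
    by near=> s; symmetry; near: s.
  apply: is_derive_mx => z a; rewrite mxE (ord1 z).
  have -> : (fun s => (\row_a \sum_i derive1 c s 0 i * P i a (c s)) 0 a) =
      fun s => \sum_i derive1 c s 0 i * P i a (c s).
    by apply/funext => s; rewrite mxE.
  apply: is_derive_sumr => i; apply: is_derive_mulr; first exact: is_derive_coord.
  apply: (is_derive_curve (F := P i a) (c' := derive1 c t)).
    by split; [exact: nbhs_singleton dc | rewrite derive1E].
  exact: smooth_diff (smooth_partial i (sPe a)) Uct.
split.
- near=> s; have [] // := dPc s _ _; by near: s.
- by have [] := ddP.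
- move=> k; rewrite (is_derive_derive1 ddP) mxE (nbhs_singleton dP1).
  under [X in _ + X]eq_bigr do under eq_bigr do rewrite !mxE.
  rewrite [LHS](@geodesic_transform_algebra _ _ (fun i a => P i a (c t))
    (fun i j a => partial i (P j a) (c t)) (fun k i j => christoffel G k i j (c t))
    (fun k i j => christoffel G' k i j (Phi (c t)))
    (fun i => derive1 c t 0 i) (fun i => derive1 (derive1 c) t 0 i)).
    by rewrite big1 // => i _; rewrite eqc mul0r.
  move=> i j b.
  exact: (christoffel_transform oU oU' sP PU sG' symG' uG' uJ GE i j b Uct).
Unshelve. all: by end_near. Qed.

Lemma energy_algebra (I : finType) (g : I -> I -> R) (T : I -> I -> I -> R)
    (c : I -> I -> I -> R) (v a : I -> R) :
  (forall l i j, \sum_k g l k * c k i j = 2^-1 * (T i j l + T j i l - T l i j)) ->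
  (forall i j, g i j = g j i) ->
  (forall k, a k + \sum_i \sum_j c k i j * v i * v j = 0) ->
  \sum_j ((\sum_i (a i * g i j + v i * \sum_k v k * T k i j)) * v j +
           (\sum_i v i * g i j) * a j) = 0.
Proof.
move=> law gC geo.
pose S := \sum_j \sum_i a i * g i j * v j.
pose K := \sum_i \sum_j \sum_k v i * v j * v k * T k i j.
have -> : \sum_j ((\sum_i (a i * g i j + v i * \sum_k v k * T k i j)) * v j +
           (\sum_i v i * g i j) * a j) = S + K + S.
  have S2 : S = \sum_j \sum_i v i * g i j * a j.
    rewrite /S exchange_big; apply: eq_bigr => j _; apply: eq_bigr => i _ /=.
    by rewrite (gC j i); ring.
  have K2 : K = \sum_j \sum_i v i * (\sum_k v k * T k i j) * v j.
    rewrite /K exchange_big; apply: eq_bigr => j _ /=; apply: eq_bigr => i _.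
    by rewrite mulr_sumr mulr_suml; apply: eq_bigr => k _; ring.
  rewrite {2}S2 K2 /S -!big_split; apply: eq_bigr => j _ /=.
  rewrite !mulr_suml -!big_split; apply: eq_bigr => i _ /=.
  by rewrite mulrDl.
have SE : S = - (2^-1 * K).
  have aE k : a k = - \sum_i \sum_j c k i j * v i * v j.
    by apply/eqP; rewrite -addr_eq0 geo.
  rewrite /S; transitivity (- \sum_l \sum_i \sum_j v l * v i * v j * (\sum_k g l k * c k i j)).
    rewrite -sumrN; apply: eq_bigr => l _.
    transitivity (- \sum_k \sum_i \sum_j v l * v i * v j * (g l k * c k i j)).
      rewrite -sumrN; apply: eq_bigr => k _; rewrite aE mulNr mulNr; congr (- _).
      rewrite !mulr_suml; apply: eq_bigr => i _; rewrite !mulr_suml.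
      by apply: eq_bigr => j _; rewrite (gC k l); ring.
    congr (- _); rewrite exchange_big; apply: eq_bigr => i _ /=.
    rewrite exchange_big; apply: eq_bigr => j _ /=; by rewrite mulr_sumr.
  congr (- _).
  transitivity (2^-1 * (\sum_l \sum_i \sum_j v l * v i * v j * T i j l +
    \sum_l \sum_i \sum_j v l * v i * v j * T j i l -
    \sum_l \sum_i \sum_j v l * v i * v j * T l i j)).
    rewrite -big_split -sumrB mulr_sumr; apply: eq_bigr => l _ /=.
    rewrite -big_split -sumrB mulr_sumr; apply: eq_bigr => i _ /=.
    rewrite -big_split -sumrB mulr_sumr; apply: eq_bigr => j _ /=.
    rewrite law; ring.
  have E1 : \sum_l \sum_i \sum_j v l * v i * v j * T i j l = K.
    rewrite /K exchange_big /=; rewrite [RHS](_ : _ = \sum_k \sum_i \sum_j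
       v i * v j * v k * T k i j); last first.
      rewrite [RHS]exchange_big; apply: eq_bigr => i _; exact: exchange_big.
    apply: eq_bigr => k _; rewrite exchange_big; apply: eq_bigr => j _.
    by apply: eq_bigr => l _; ring.
  have E2 : \sum_l \sum_i \sum_j v l * v i * v j * T j i l = K.
    rewrite /K exchange_big /=; apply: eq_bigr => i _.
    by apply: eq_bigr => j _; apply: eq_bigr => k _; ring.
  have E3 : \sum_l \sum_i \sum_j v l * v i * v j * T l i j = K.
    rewrite /K exchange_big /=; apply: eq_bigr => i _; rewrite exchange_big /=.
    by apply: eq_bigr => j _; apply: eq_bigr => k _; ring.
  by rewrite E1 E2 E3 addrK.
by rewrite SE; field.
Qed.

Lemma quadratic_formE (v : V) (M : 'M[R]_d.+1) :
  (v *m M *m v^T) 0 0 = \sum_j (\sum_i v 0 i * M i j) * v 0 j.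
Proof.
rewrite mxE; apply: eq_bigr => j _; rewrite [X in _ * X]mxE; congr (_ * _).
by rewrite mxE.
Qed.

(** Conservation of energy: along a geodesic the variation of the metric is compensated
by the acceleration, through the Koszul formula. *)
Lemma geodesic_energy (U : set V) G c t :
  open U -> smooth_on U G -> (forall x, U x -> (G x)^T = G x) ->
  (forall x, U x -> G x \in unitmx) -> U (c t) -> geodesic_eq_at G c t ->
  is_derive t 1 (fun s => (derive1 c s *m G (c s) *m (derive1 c s)^T) 0 0) 0.
Proof.
move=> oU sG symG uG Uct [dc ddc eqc].
have sGe i j : smooth_on U (fun y => G y i j) := (smooth_mxP G oU).1 sG i j.
have -> : (fun s => (derive1 c s *m G (c s) *m (derive1 c s)^T) 0 0) =
    fun s => \sum_j (\sum_i derive1 c s 0 i * G (c s) i j) * derive1 c s 0 j.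
  by apply/funext => s; exact: quadratic_formE.
have dv i : is_derive t 1 (fun s => derive1 c s 0 i) (derive1 (derive1 c) t 0 i).
  exact: is_derive_coord.
have dG i j : is_derive t 1 (fun s => G (c s) i j)
    (\sum_k derive1 c t 0 k * partial k (fun y => G y i j) (c t)).
  apply: (is_derive_curve (F := fun y => G y i j) (c' := derive1 c t)).
    by split; [exact: nbhs_singleton dc | rewrite derive1E].
  exact: smooth_diff (sGe i j) Uct.
have D := is_derive_sumr (index_enum 'I_d.+1) (fun j => is_derive_mulr
  (is_derive_sumr (index_enum 'I_d.+1) (fun i => is_derive_mulr (dv i) (dG i j))) (dv j)).
apply: (is_derive_eq D); apply: (@energy_algebra _ (fun i j => G (c t) i j)
  (fun k i j => partial k (fun y => G y i j) (c t))
  (fun k i j => christoffel G k i j (c t))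
  (fun i => derive1 c t 0 i) (fun i => derive1 (derive1 c) t 0 i)) => //.
- by move=> l i j; exact: christoffel_lower (uG _ Uct).
- by move=> i j; rewrite -[in LHS](symG _ Uct) mxE.
Qed.

End GeodesicEquation.

(** * Ordinary differential equations *)

Lemma lipschitz_continuous {R : realType} {V W : normedModType R} (f : V -> W) (L : R) :
  0 <= L -> (forall x y, `|f x - f y| <= L * `|x - y|) -> continuous f.
Proof.
move=> L0 fL x; apply/cvgrPdist_le => e e0.
have L1 : 0 < L + 1 by rewrite ltr_wpDl.
apply/nbhs_ballP; exists (e / (L + 1)); first by rewrite /= divr_gt0.
move=> z; rewrite -ball_normE /= ltr_pdivlMr // => /ltW; apply: le_trans.
by apply: le_trans (fL x z) _; rewrite mulrDr mulr1 mulrC lerDl.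
Qed.

Section Clamp.
Context {R : realType}.
Implicit Types h s t : R.

Definition clamp h t := Num.max (- h) (Num.min h t).

Lemma clamp_le h t : 0 <= h -> `|clamp h t| <= h.
Proof.
move=> h0; rewrite ler_norml /clamp le_max lexx /= ge_max ge_min lexx /= andbT.
by rewrite ge0_cp.
Qed.

Lemma clamp_id h t : `|t| <= h -> clamp h t = t.
Proof. by rewrite ler_norml => /andP[t1 t2]; rewrite /clamp min_r // max_r. Qed.

Lemma clamp_lip h s t : `|clamp h t - clamp h s| <= `|t - s|.
Proof.
have maxL (a x y : R) : `|Num.max a x - Num.max a y| <= `|x - y|.
  have := ler_norm (x - y); have := lerNnormlW (lexx `|x - y|).
  by case: (leP a x); case: (leP a y) => ay ax n1 n2; rewrite ?subrr ?normr0 // ler_norml; lra.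
have minL (a x y : R) : `|Num.min a x - Num.min a y| <= `|x - y|.
  have := ler_norm (x - y); have := lerNnormlW (lexx `|x - y|).
  by case: (leP a x); case: (leP a y) => ay ax n1 n2; rewrite ?subrr ?normr0 // ler_norml; lra.
exact: le_trans (maxL _ _ _) (minL _ _ _).
Qed.

End Clamp.

Section ODE.
Context {R : realType} {m : nat}.
Local Notation E := 'rV[R]_m.

Lemma antiderivative (f : R -> R) (b : R) : 0 < b -> continuous f ->
  exists F : R -> R, F 0 = 0 /\ forall t : R, - b < t < b -> is_derive t 1 F (f t).
Proof.
move=> b0 cf; pose mu := @lebesgue_measure R.
have [F FP] : exists F : R -> R, forall t, - b < t < b ->
    derivable F t 1 /\ F^`()%classic t = f t.
  exists (fun x => \int[mu]_(s in `[- b, x]) f s)%R => t /andP[bt tb].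
  apply: (@continuous_FTC1_closed _ f (- b) t b tb _ bt); last exact: cf.
  apply: continuous_compact_integrable; first exact: segment_compact.
  exact: continuous_subspaceT.
exists (fun x => F x - F 0); split; first exact: subrr.
move=> t /FP[dF FE]; rewrite -[f t]subr0.
have dF' : is_derive t 1 F (f t) by split; [exact: dF | rewrite -derive1E].
exact: (is_deriveB dF' (is_derive_cst _ _ _)).
Qed.

Lemma antiderivative_rV (g : R -> E) (b : R) : 0 < b -> continuous g ->
  exists F : R -> E, F 0 = 0 /\ forall t : R, - b < t < b -> is_derive t 1 F (g t).
Proof.
move=> b0 cg.
have H j : exists F : R -> R, F 0 = 0 /\
    forall t : R, - b < t < b -> is_derive t 1 F (g t 0 j).
  apply: antiderivative => // t.
  exact: (continuous_comp (cg t) (@coord_continuous _ _ _ 0 j (g t))).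
pose F j := sval (cid (H j)).
have FP j := svalP (cid (H j)).
exists (fun t => \row_j F j t); split.
  by apply/rowP => j; rewrite !mxE; have [] := FP j.
move=> t tb; apply: is_derive_mx => i j; rewrite (ord1 i).
rewrite (_ : (fun s => _) = F j); last by apply/funext => s; rewrite mxE.
by have [_] := FP j; apply.
Qed.

Lemma mean_value_bound (D : R -> E) (D' : R -> E) (a b M : R) : a <= b -> 0 <= M ->
  (forall t : R, a <= t <= b -> is_derive t 1 D (D' t)) ->
  (forall t : R, a <= t <= b -> `|D' t| <= M) ->
  `|D b - D a| <= M * (b - a).
Proof.
move=> ab M0 dD bD; apply: rV_norm_le; first by rewrite mulr_ge0 // subr_ge0.
move=> j; pose f s := D s 0 j; pose df s := D' s 0 j.
have fP s : a <= s <= b -> is_derive s 1 f (df s).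
  move=> sab; have [dDs DE] := dD s sab.
  by rewrite /df -DE -derive1E; exact: is_derive_coord.
have [s sab E] : exists2 c, c \in `[a, b] & f b - f a = df c * (b - a).
  apply: MVT_segment => // [s|].
    by rewrite in_itv /= => /andP[sa sb]; apply: fP; rewrite !ltW.
  by apply: derivable_within_continuous => s; rewrite in_itv => /fP[].
rewrite !mxE -/(f b) -/(f a) E normrM (ger0_norm (x := b - a)) ?subr_ge0 //.
apply: ler_wpM2r; first by rewrite subr_ge0.
by apply: le_trans (rV_coord_le _ _) _; apply: bD; move: sab; rewrite in_itv.
Qed.

Lemma mean_value_bound_abs (D : R -> E) (D' : R -> E) (h M : R) : 0 <= M ->
  (forall t : R, `|t| <= h -> is_derive t 1 D (D' t)) ->
  (forall t : R, `|t| <= h -> `|D' t| <= M) ->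
  forall s t, `|s| <= h -> `|t| <= h -> `|D t - D s| <= M * `|t - s|.
Proof.
move=> M0 dD bD s t; wlog st : s t / s <= t.
  move=> H; have [/H//|ts] := leP s t; move=> sh th.
  by rewrite distrC [`|t - s|]distrC; apply: H => //; exact: ltW.
move=> sh th; rewrite [`|t - s|]ger0_norm ?subr_ge0 //.
have sub r : s <= r <= t -> `|r| <= h.
  move: sh th; rewrite !ler_norml => /andP[hs _] /andP[_ th] /andP[sr rt].
  by rewrite (le_trans hs sr) (le_trans rt th).
by apply: mean_value_bound => // r /sub; [exact: dD | exact: bD].
Qed.

Lemma le0_geometric (x c : R) : (forall n, x <= c * 2^-1 ^+ n) -> x <= 0.
Proof.
move=> xc; have cv : (fun n => c * 2^-1 ^+ n) @ \oo --> (0 : R).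
  rewrite -[0 : R](mulr0 c); apply: cvgMr; apply: cvg_expr.
  by rewrite ger0_norm ?invr_ge0 // invf_lt1 // ltr1n.
rewrite -(cvg_lim (@Rhausdorff R) cv); apply: limr_ge; first by apply/cvg_ex; exists 0.
by apply: nearW => n; exact: xc.
Qed.

Lemma geometric_small (c e : R) : 0 < e -> exists n, c * 2^-1 ^+ n < e.
Proof.
move=> e0; apply: contrapT => nE; have : e <= 0.
  apply: (@le0_geometric _ c) => n; rewrite leNgt; apply/negP => ce.
  by apply: nE; exists n.
by rewrite leNgt e0.
Qed.

(** Picard iteration. The time is clamped to [[- h, h]] so that every iterate is a
continuous function on the whole line, and [L * h <= 1 / 2] makes the iteration contract. *)
Lemma picard (f : E -> E) (K L h : R) (y0 : E) :
  0 <= K -> 0 <= L -> 0 < h -> L * h <= 2^-1 ->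
  (forall x, `|f x| <= K) -> (forall x y, `|f x - f y| <= L * `|x - y|) ->
  exists y : R -> E, y 0 = y0 /\ forall t : R, - h < t < h -> is_derive t 1 y (f (y t)).
Proof.
move=> K0 L0 h0 Lh fK fL.
have h1 : 0 < h + 1 by rewrite addr_gt0.
have fc : continuous f := lipschitz_continuous L0 fL.
have [anti antiP] : exists anti : (R -> E) -> R -> E, forall g, continuous g ->
    anti g 0 = 0 /\ forall t : R, `|t| <= h -> is_derive t 1 (anti g) (g t).
  have ex g : exists F : R -> E, continuous g ->
      F 0 = 0 /\ forall t : R, `|t| <= h -> is_derive t 1 F (g t).
    have [cg|ncg] := pselect (continuous g); last by exists g.
    have [F [F0 dF]] := antiderivative_rV h1 cg; exists F => _; split=> // t.
    rewrite ler_norml => /andP[t1 t2]; apply: dF.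
    by rewrite (lt_le_trans _ t1) ?ltrN2 ?ltrDl // (le_lt_trans t2) // ltrDl.
  by exists (fun g => sval (cid (ex g))) => g; exact: (svalP (cid (ex g))).
pose cl : R -> R := clamp h.
have cl_le t : `|cl t| <= h := clamp_le t (ltW h0).
have cl_id t : `|t| <= h -> cl t = t := @clamp_id _ h t.
have cl_lip s t : `|cl t - cl s| <= `|t - s| := clamp_lip h s t.
pose step (w : R -> E) : R -> E := fun t => y0 + anti (f \o w) (cl t).
have cw_f (w : R -> E) : continuous w -> continuous (f \o w).
  by move=> cw t; exact: continuous_comp (cw t) (fc _).
have lip_cont (w : R -> E) : (forall s t, `|w t - w s| <= K * `|t - s|) -> continuous w.
  by move=> wL; apply: (lipschitz_continuous K0) => t s; exact: wL.
have step_lip (w : R -> E) : continuous w -> forall s t, `|step w t - step w s| <= K * `|t - s|.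
  move=> cw s t; rewrite /step opprD addrACA subrr add0r.
  have [_ dA] := antiP _ (cw_f _ cw).
  apply: le_trans (mean_value_bound_abs K0 dA (fun t _ => fK _) (cl_le s) (cl_le t)) _.
  exact: ler_wpM2l (cl_lip s t).
pose w n := iter n step (fun=> y0).
have wc n : continuous (w n).
  case: n => [|n]; first by move=> t; exact: cvg_cst.
  rewrite /w iterS -/(w n).
  elim: n => [|n IH]; apply: lip_cont => s t; apply: step_lip; last exact: IH.
  by move=> r; exact: cvg_cst.
have step_contr (u v : R -> E) M : 0 <= M -> continuous u -> continuous v ->
    (forall t : R, `|t| <= h -> `|u t - v t| <= M) ->
    forall t, `|step u t - step v t| <= M / 2.
  move=> M0 cu cv uv t; rewrite /step opprD addrACA subrr add0r.
  have [u0 dU] := antiP _ (cw_f _ cu); have [v0 dV] := antiP _ (cw_f _ cv).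
  have := @mean_value_bound_abs (fun s => anti (f \o u) s - anti (f \o v) s)
    (fun s => f (u s) - f (v s)) h (L * M) (mulr_ge0 L0 M0) _ _ 0 (cl t).
  rewrite u0 v0 !subr0 => H; apply: le_trans (H _ _ _ (cl_le t)) _.
  - by move=> s sh; apply: is_deriveB; [exact: dU | exact: dV].
  - move=> s sh; apply: le_trans (fL _ _) _; apply: ler_wpM2l => //; exact: uv.
  - by rewrite normr0 ltW.
  rewrite mulrAC mulrC ler_wpM2l //; apply: le_trans Lh.
  by rewrite ler_wpM2l.
have w_succ n t : `|w n.+1 t - w n t| <= K * h * 2^-1 ^+ n.
  elim: n t => [|n IH] t.
    rewrite expr0 mulr1 /w /= /step addrC addKr.
    have [a0 dA] := antiP _ (cw_f _ (wc 0%N)).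
    have := mean_value_bound_abs (h := h) K0 dA (fun t _ => fK _) (s := 0) (t := cl t).
    rewrite a0 !subr0 normr0 => H; apply: le_trans (H (ltW h0) (cl_le t)) _.
    exact: ler_wpM2l.
  rewrite exprSr mulrA.
  apply: (step_contr (w n.+1) (w n) _ _ (wc n.+1) (wc n)) => [|s _]; last exact: IH.
  by rewrite !mulr_ge0 ?exprn_ge0 ?invr_ge0 // ltW.
have w_far : forall n k t, `|w (n + k)%N t - w n t| <= 2 * (K * h) * 2^-1 ^+ n * (1 - 2^-1 ^+ k).
  move=> n k t; elim: k => [|k IH]; first by rewrite addn0 subrr normr0 expr0 subrr mulr0.
  rewrite addnS; apply: le_trans (ler_distD (w (n + k)%N t) _ _) _.
  apply: le_trans (lerD (w_succ _ _) IH) _; rewrite exprD exprSr.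
  by rewrite le_eqVlt; apply/orP; left; apply/eqP; field.
have Kh : 0 <= 2 * (K * h) by rewrite !mulr_ge0 // ltW.
have w_tail : forall n k t, `|w (n + k)%N t - w n t| <= 2 * (K * h) * 2^-1 ^+ n.
  move=> n k t; apply: le_trans (w_far n k t) _; apply: ler_piMr.
    by rewrite mulr_ge0 // exprn_ge0 // invr_ge0.
  by rewrite gerBl exprn_ge0 // invr_ge0.
have wlim t : exists l, forall n, `|l - w n t| <= 2 * (K * h) * 2^-1 ^+ n.
  have : cvg ((fun n => w n t) @ \oo).
    apply/cauchy_cvgP; apply: cauchy_exP => e e0.
    have [n ne] := geometric_small (2 * (K * h)) e0.
    exists (w n t); exists n => //= k nk; rewrite -ball_normE /= distrC.
    by apply: le_lt_trans ne; rewrite -(subnKC nk).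
  move=> /cvg_ex[l wl]; exists l => n; apply/ler_addgt0Pr => e e0.
  have /cvgrPdist_le/(_ e e0)[k _ kP] := wl.
  apply: le_trans (ler_distD (w (n + k)%N t) _ _) _; rewrite addrC.
  by apply: lerD => //; apply: kP; rewrite /= leq_addl.
pose y t := sval (cid (wlim t)).
have yP t n : `|y t - w n t| <= 2 * (K * h) * 2^-1 ^+ n := svalP (cid (wlim t)) n.
have yc : continuous y.
  apply: lip_cont => s t; rewrite -subr_le0; apply: (@le0_geometric _ (4 * (K * h))) => n.
  rewrite lerBlDr; apply: le_trans (ler_distD (w n t) _ _) _.
  have A1 := yP t n; have A2 := yP s n.
  have A3 : `|w n t - y s| <= K * `|t - s| + 2 * (K * h) * 2^-1 ^+ n.
    apply: le_trans (ler_distD (w n s) _ _) _; apply: lerD; last by rewrite distrC.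
    case: (n) => [|k]; first by rewrite /w /= subrr normr0 mulr_ge0.
    by apply: step_lip; exact: wc.
  by apply: le_trans (lerD A1 A3) _; lra.
have yE t : y t = step y t.
  apply/eqP; rewrite -subr_eq0 -normr_le0.
  apply: (@le0_geometric _ (2 * (K * h))) => n.
  apply: le_trans (ler_distD (w n.+1 t) _ _) _.
  have A2 := step_contr (w n) y (2 * (K * h) * 2^-1 ^+ n) _ (wc n) yc _ t.
  apply: le_trans (lerD (yP t n.+1) (A2 _ _)) _.
  - by rewrite mulr_ge0 // exprn_ge0 // invr_ge0.
  - by move=> s _; rewrite distrC.
  - by rewrite exprS le_eqVlt; apply/orP; left; apply/eqP; field.
have [A0 dA] := antiP _ (cw_f _ yc).
exists (fun t => y0 + anti (f \o y) t); split; first by rewrite A0 addr0.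
move=> t /andP[t1 t2]; have th : `|t| <= h by rewrite ler_norml !ltW.
have -> : f (y0 + anti (f \o y) t) = 0 + (f \o y) t.
  by rewrite add0r /= [y t in RHS]yE /step cl_id.
exact: is_deriveD (is_derive_cst _ _ _) (dA t th).
Qed.

End ODE.

Section LocalODE.
Context {R : realType} {m : nat}.
Local Notation E := 'rV[R]_m.

(** The bound and the Lipschitz constant are kept together because a product is
Lipschitz only on a set where its factors are bounded. *)
Definition lipschitz_ball {V W : normedModType R} (M : R) (f : V -> W) :=
  exists K L : R, [/\ 0 <= K, 0 <= L & forall x y, `|x| <= M -> `|y| <= M ->
    `|f x| <= K /\ `|f x - f y| <= L * `|x - y|].

Definition clamp_row (M : R) (x : E) : E := \row_j clamp M (x 0 j).

Lemma clamp_row_le M x : 0 <= M -> `|clamp_row M x| <= M.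
Proof. by move=> M0; apply: rV_norm_le => // j; rewrite mxE clamp_le. Qed.

Lemma clamp_row_id M x : `|x| <= M -> clamp_row M x = x.
Proof.
move=> xM; apply/rowP => j; rewrite mxE clamp_id //.
exact: le_trans (rV_coord_le _ _) xM.
Qed.

Lemma clamp_row_lip M x y : `|clamp_row M x - clamp_row M y| <= `|x - y|.
Proof.
apply: rV_norm_le => // j; rewrite !mxE; apply: le_trans (clamp_lip _ _ _) _.
by have := rV_coord_le (x - y) j; rewrite !mxE.
Qed.

(** The existence time is uniform over the initial values in a ball: the field is
truncated outside a larger ball, which the solutions do not leave during that time. *)
Lemma ode_local_existence (f : E -> E) (M : R) : 0 <= M ->
  lipschitz_ball (M + 1) f ->
  exists2 h : R, 0 < h & forall y0, `|y0| <= M -> exists y : R -> E, y 0 = y0 /\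
    forall t : R, - h < t < h -> is_derive t 1 y (f (y t)).
Proof.
move=> M0 [K [L [K0 L0 fP]]].
have M1 : 0 <= M + 1 by rewrite addr_ge0.
have K1 : 0 < K + 1 by rewrite ltr_wpDl.
have L1 : 0 < 2 * (L + 1) by rewrite mulr_gt0 // ltr_wpDl.
pose h := Num.min (2 * (L + 1))^-1 (K + 1)^-1.
have h0 : 0 < h by rewrite lt_min !invr_gt0 L1.
have hL : L * h <= 2^-1.
  apply: (@le_trans _ _ (L * (2 * (L + 1))^-1)).
    by apply: ler_wpM2l => //; rewrite ge_min lexx.
  rewrite invfM mulrCA ler_piMr ?invr_ge0 // ler_pdivrMr ?mul1r ?lerDl //.
  by rewrite ltr_wpDl.
have hK : K * h <= 1.
  apply: (@le_trans _ _ (K * (K + 1)^-1)).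
    by apply: ler_wpM2l => //; rewrite ge_min lexx orbT.
  by rewrite ler_pdivrMr // mul1r lerDl.
exists h => // y0 y0M.
pose f1 := f \o clamp_row (M + 1).
have f1K x : `|f1 x| <= K.
  by have [] := fP _ _ (clamp_row_le x M1) (clamp_row_le x M1).
have f1L x y : `|f1 x - f1 y| <= L * `|x - y|.
  have [_ H] := fP _ _ (clamp_row_le x M1) (clamp_row_le y M1).
  apply: le_trans H _; exact: ler_wpM2l (clamp_row_lip _ _ _).
have [y [yy0 dy]] := picard y0 K0 L0 h0 hL f1K f1L.
exists y; split=> // t tP; have -> : f (y t) = f1 (y t); last exact: dy.
rewrite /f1 /= clamp_row_id //.
have := mean_value_bound_abs (h := `|t|) K0 _ (fun s _ => f1K (y s)) (s := 0) (t := t).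
move=> /(_ y) H; rewrite -[y t](subrK (y 0)); apply: le_trans (ler_normD _ _) _.
rewrite addrC yy0 lerD // -yy0; apply: le_trans (H _ _ _) _.
- move=> s st; apply: dy; move: tP st; rewrite -ltr_norml => tP st.
  by rewrite -ltr_norml (le_lt_trans st).
- by rewrite normr0.
- by [].
rewrite subr0; apply: le_trans hK; apply: ler_wpM2l => //; apply: ltW.
by rewrite ltr_norml.
Qed.

(** On a short interval a bound [M] on the difference of two solutions improves to
[M / 2], and so on. *)
Lemma ode_local_uniqueness (f : E -> E) (y z : R -> E) (t0 r L M : R) :
  0 <= L -> 0 <= M -> L * r <= 2^-1 -> y t0 = z t0 ->
  (forall t : R, `|t - t0| < r ->
    [/\ is_derive t 1 y (f (y t)), is_derive t 1 z (f (z t)),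
        `|f (y t) - f (z t)| <= L * `|y t - z t| & `|y t - z t| <= M]) ->
  forall t, `|t - t0| < r -> y t = z t.
Proof.
move=> L0 M0 Lr yz0 yzP t tr.
have bound n : forall s, `|s - t0| < r -> `|y s - z s| <= M * 2^-1 ^+ n.
  elim: n => [|n IH] s sr; first by rewrite mulr1; have [] := yzP s sr.
  pose B := L * (M * 2^-1 ^+ n).
  have B0 : 0 <= B by rewrite !mulr_ge0 // exprn_ge0 // invr_ge0.
  have sub u : `|u - t0| <= `|s - t0| -> `|u - t0| < r.
    by move=> us; exact: le_lt_trans us sr.
  have dD u : `|u - t0| < r -> is_derive u 1 (fun v => y v - z v) (f (y u) - f (z u)).
    by move=> /yzP[dy dz _ _]; exact: is_deriveB.
  have bD u : `|u - t0| < r -> `|f (y u) - f (z u)| <= B.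
    move=> ur; have [_ _ H _] := yzP u ur; apply: le_trans H _.
    by apply: ler_wpM2l => //; exact: IH.
  have key : `|y s - z s| <= B * `|s - t0|.
    have [ts|st] := leP t0 s.
      have H := @mean_value_bound _ _ (fun v => y v - z v)
        (fun u => f (y u) - f (z u)) t0 s B ts B0.
      rewrite (ger0_norm (x := s - t0)) ?subr_ge0 //.
      have := H _ _; rewrite yz0 subrr subr0; apply=> u /andP[tu us].
        by apply/dD/sub; rewrite !ger0_norm ?subr_ge0 // lerD2r.
      by apply/bD/sub; rewrite !ger0_norm ?subr_ge0 // lerD2r.
    have H := @mean_value_bound _ _ (fun v => y v - z v)
      (fun u => f (y u) - f (z u)) s t0 B (ltW st) B0.
    rewrite [`|s - t0|]distrC (ger0_norm (x := t0 - s)) ?subr_ge0 ?(ltW st) //.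
    rewrite -normrN; have := H _ _; rewrite yz0 subrr sub0r; apply=> u /andP[su ut].
      apply/dD/sub; rewrite distrC [`|s - _|]distrC !ger0_norm ?subr_ge0 ?(ltW st) //.
      by rewrite lerD2l lerN2.
    apply/bD/sub; rewrite distrC [`|s - _|]distrC !ger0_norm ?subr_ge0 ?(ltW st) //.
    by rewrite lerD2l lerN2.
  apply: le_trans key _; rewrite /B exprSr [leRHS]mulrA.
  have -> : L * (M * 2^-1 ^+ n) * `|s - t0| = M * 2^-1 ^+ n * (L * `|s - t0|).
    by move: (2^-1 ^+ n) `|_| => p q; ring.
  apply: ler_wpM2l; first by rewrite mulr_ge0 // exprn_ge0 // invr_ge0.
  by apply: le_trans Lr; apply: ler_wpM2l => //; exact: ltW.
apply/eqP; rewrite -subr_eq0 -normr_le0; apply: (@le0_geometric _ _ M) => n.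
exact: bound.
Qed.

End LocalODE.

Section LipschitzBall.
Context {R : realType}.

Section Closure.
Context {V : normedModType R} (M : R).
Implicit Types f g : V -> R.

Lemma lipschitz_ball_cst (a : R) : lipschitz_ball M (fun _ : V => a).
Proof.
exists `|a|, 0; split=> // x y _ _; split=> //.
by rewrite subrr normr0 mul0r.
Qed.

Lemma lipschitz_ballD f g : lipschitz_ball M f -> lipschitz_ball M g ->
  lipschitz_ball M (fun x => f x + g x).
Proof.
move=> [K [L [K0 L0 fP]]] [K' [L' [K'0 L'0 gP]]]; exists (K + K'), (L + L').
split; rewrite ?addr_ge0 // => x y xM yM.
have [f1 f2] := fP x y xM yM; have [g1 g2] := gP x y xM yM.
split; first by apply: le_trans (ler_normD _ _) _; exact: lerD.
by rewrite opprD addrACA mulrDl; apply: le_trans (ler_normD _ _) _; exact: lerD.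
Qed.

Lemma lipschitz_ballM f g : lipschitz_ball M f -> lipschitz_ball M g ->
  lipschitz_ball M (fun x => f x * g x).
Proof.
move=> [K [L [K0 L0 fP]]] [K' [L' [K'0 L'0 gP]]]; exists (K * K'), (L * K' + K * L').
split; rewrite ?addr_ge0 ?mulr_ge0 // => x y xM yM.
have [f1 f2] := fP x y xM yM; have [g1 g2] := gP x y xM yM.
have [f3 _] := fP y x yM xM.
split; first by rewrite normrM ler_pM.
have -> : f x * g x - f y * g y = (f x - f y) * g x + f y * (g x - g y) by ring.
apply: le_trans (ler_normD _ _) _; rewrite !normrM mulrDl; apply: lerD.
  by rewrite mulrAC ler_pM.
by rewrite -mulrA ler_pM.
Qed.

Lemma lipschitz_ballN f : lipschitz_ball M f -> lipschitz_ball M (fun x => - f x).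
Proof.
move=> [K [L [K0 L0 fP]]]; exists K, L; split=> // x y xM yM.
by rewrite normrN -opprD normrN; exact: fP.
Qed.

Lemma lipschitz_ball_sum (I : Type) (r : seq I) (F : I -> V -> R) :
  (forall i, lipschitz_ball M (F i)) ->
  lipschitz_ball M (fun x => \sum_(i <- r) F i x).
Proof.
move=> FP; elim: r => [|i r IH].
  rewrite (_ : (fun x => _) = fun=> 0); first exact: lipschitz_ball_cst.
  by apply/funext => x; rewrite big_nil.
rewrite (_ : (fun x => _) = fun x => F i x + \sum_(i <- r) F i x).
  exact: lipschitz_ballD.
by apply/funext => x; rewrite big_cons.
Qed.

End Closure.

Lemma lipschitz_ball_row {V : normedModType R} {m : nat} (M : R) (F : V -> 'rV[R]_m) :
  (forall j, lipschitz_ball M (fun x => F x 0 j)) -> lipschitz_ball M F.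
Proof.
move=> FP; pose K j := sval (cid (FP j)); pose L j := sval (cid (svalP (cid (FP j)))).
have P j := svalP (cid (svalP (cid (FP j)))).
have K0 j : 0 <= K j by have [] := P j.
have L0 j : 0 <= L j by have [] := P j.
have sum_le (k : 'I_m -> R) j : (forall j, 0 <= k j) -> k j <= \sum_j k j.
  by move=> k0; rewrite (bigD1 j) //= lerDl sumr_ge0.
exists (\sum_j K j), (\sum_j L j); split; rewrite ?sumr_ge0 // => x y xM yM; split.
  apply: rV_norm_le => [|j]; first exact: sumr_ge0.
  by have [_ _ /(_ x y xM yM) [H _]] := P j; apply: le_trans H (sum_le K j K0).
apply: rV_norm_le => [|j]; first by rewrite mulr_ge0 // sumr_ge0.
have [_ _ /(_ x y xM yM) [_ H]] := P j; rewrite !mxE; apply: le_trans H _.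
by apply: ler_wpM2r => //; exact: sum_le L j L0.
Qed.

Lemma continuous_bounded_ball {d : nat} (M : R) (g : 'rV[R]_d -> R) : 0 <= M ->
  continuous g -> exists2 K, 0 <= K & forall x, `|x| <= M -> `|g x| <= K.
Proof.
move=> M0 cg; pose B := [set v : 'rV[R]_d | forall i, `[- M, M]%classic (v 0 i)].
have cB : compact B.
  by apply: (@rV_compact _ _ (fun=> `[- M, M]%classic)) => i; exact: segment_compact.
have B0 : B !=set0 by exists 0 => i; rewrite /= mxE in_itv /= oppr_le0 M0.
have cng : continuous (fun x => `|g x|).
  by move=> x; apply: (continuous_comp (cg x)); exact: norm_continuous.
have [c _ cP] := EVT_max_rV B0 cB (continuous_subspaceT cng).
exists `|g c| => // x xM; apply: cP; rewrite inE => i /=; rewrite in_itv /= -ler_norml.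
exact: le_trans (rV_coord_le _ _) xM.
Qed.

(** The gradient is bounded on the ball by compactness, and a ball contains the segments
between its points. *)
Lemma smooth_lipschitz_ball {d : nat} (M : R) (g : 'rV[R]_d.+1 -> R) : 0 <= M ->
  smooth_on setT g -> lipschitz_ball M g.
Proof.
move=> M0 sg.
have cg (h : 'rV[R]_d.+1 -> R) : smooth_on setT h -> continuous h.
  move=> sh x; apply: differentiable_continuous; exact: smooth_diff sh _.
have [K K0 KP] := continuous_bounded_ball M0 (cg _ sg).
have H i := continuous_bounded_ball M0 (cg _ (smooth_partial i sg)).
pose L i := sval (cid2 (H i)).
have L0 i : 0 <= L i := s2valP (cid2 (H i)).
have LP i x : `|x| <= M -> `|partial i g x| <= L i := s2valP' (cid2 (H i)) x.
exists K, (\sum_i L i); split=> //; first exact: sumr_ge0.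
move=> x y xM yM; split; first exact: KP.
pose f s := g (y + s *: (x - y)); pose df s := 'D_(x - y) g (y + s *: (x - y)).
have dfP (s : R) : is_derive s 1 f (df s).
  exact: is_derive_line (smooth_diff sg I).
have [s s01 E] : exists2 c, c \in `[0 : R, 1] & f 1 - f 0 = df c * (1 - 0).
  apply: (MVT_segment ler01 (fun s _ => dfP s)).
  by apply: derivable_within_continuous => s _; have [] := dfP s.
move: E; rewrite /f scale1r scale0r addr0 (addrC y (x - y)) subrK subr0 mulr1 => ->.
have ds := smooth_diff sg (I : setT (y + s *: (x - y))).
rewrite /df (deriveE _ ds) (diff_partial _ ds); apply: le_trans (ler_norm_sum _ _ _) _.
rewrite mulr_suml; apply: ler_sum => i _; rewrite normrM mulrC ler_pM //; last first.
  exact: rV_coord_le.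
apply: LP; move: s01; rewrite in_itv /= => /andP[s0 s1].
have -> : y + s *: (x - y) = s *: x + (1 - s) *: y.
  by rewrite scalerBr scalerBl scale1r addrCA.
apply: le_trans (ler_normD _ _) _; rewrite !normrZ !ger0_norm ?subr_ge0 //.
rewrite -[leRHS](_ : s * M + (1 - s) * M = _); last by ring.
by apply: lerD; apply: ler_wpM2l; rewrite ?subr_ge0.
Qed.

End LipschitzBall.

(** * Local existence and uniqueness of geodesics *)

Section GeodesicODE.
Context {R : realType} {d : nat}.
Local Notation V := 'rV[R]_d.+1.
Local Notation E := 'rV[R]_(d.+1 + d.+1).
Context (G : V -> 'M[R]_d.+1).
Hypothesis sG : smooth_on setT G.
Hypothesis uG : forall x, G x \in unitmx.

Definition geodesic_field (z : E) : E :=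
  row_mx (rsubmx z) (\row_k - \sum_a \sum_b christoffel G k a b (lsubmx z) *
                                 rsubmx z 0 a * rsubmx z 0 b).

Let coord_lipschitz M (j : 'I_(d.+1 + d.+1)) : 0 <= M ->
  lipschitz_ball M (fun z : E => z 0 j).
Proof.
move=> M0; exists M, 1; split=> // x y xM yM; rewrite mul1r.
split; first exact: le_trans (rV_coord_le _ _) xM.
by have := rV_coord_le (x - y) j; rewrite !mxE.
Qed.

Let lsub_lipschitz M (g : V -> R) : lipschitz_ball M g ->
  lipschitz_ball M (fun z : E => g (lsubmx z)).
Proof.
have lsub_le (z : E) : `|lsubmx z| <= `|z|.
  by apply: rV_norm_le => // j; rewrite mxE; exact: rV_coord_le.
move=> [K [L [K0 L0 gP]]]; exists K, L; split=> // x y xM yM.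
have [H1 H2] := gP _ _ (le_trans (lsub_le x) xM) (le_trans (lsub_le y) yM).
split=> //; apply: le_trans H2 _; apply: ler_wpM2l => //.
by rewrite -linearB; exact: lsub_le.
Qed.

Lemma geodesic_field_lipschitz M : 0 <= M -> lipschitz_ball M geodesic_field.
Proof.
move=> M0; apply: lipschitz_ball_row => j; rewrite /geodesic_field.
case: (split_ordP j) => k ->.
  rewrite (_ : (fun z => _) = fun z : E => z 0 (rshift d.+1 k)).
    exact: coord_lipschitz.
  by apply/funext => z; rewrite row_mxEl mxE.
rewrite (_ : (fun z => _) = fun z : E => - \sum_a \sum_b
    christoffel G k a b (lsubmx z) * z 0 (rshift d.+1 a) * z 0 (rshift d.+1 b)).
  apply: lipschitz_ballN; apply: lipschitz_ball_sum => a; apply: lipschitz_ball_sum => b.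
  apply: lipschitz_ballM; last exact: coord_lipschitz.
  apply: lipschitz_ballM; last exact: coord_lipschitz.
  apply: (lsub_lipschitz (g := christoffel G k a b)).
  by apply: smooth_lipschitz_ball => //; apply: smooth_christoffel => //; exact: openT.
apply/funext => z; rewrite row_mxEr mxE; congr (- _).
by apply: eq_bigr => a _; apply: eq_bigr => b _; rewrite !mxE.
Qed.

Lemma geodesic_local_existence M : 0 <= M ->
  exists2 h : R, 0 < h & forall x0 v0 : V, `|x0| <= M -> `|v0| <= M ->
    exists c : R -> V, [/\ c 0 = x0, derive1 c 0 = v0 &
      forall t : R, - h < t < h -> geodesic_eq_at G c t].
Proof.
move=> M0; have M1 : 0 <= M + 1 by rewrite addr_ge0.
have [h h0 H] := ode_local_existence M0 (geodesic_field_lipschitz M1).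
exists h => // x0 v0 x0M v0M.
have yM : `|row_mx x0 v0| <= M.
  apply: rV_norm_le => // j; case: (split_ordP j) => k ->.
    by rewrite row_mxEl; exact: le_trans (rV_coord_le _ _) x0M.
  by rewrite row_mxEr; exact: le_trans (rV_coord_le _ _) v0M.
have [y [y0 dy]] := H _ yM.
have dyc t j : - h < t < h -> is_derive t 1 (fun s => y s 0 j) (geodesic_field (y t) 0 j).
  move=> th; have [dyt E] := dy t th.
  by rewrite -E -derive1E; exact: is_derive_coord.
pose c s : V := lsubmx (y s).
have dc t : - h < t < h -> is_derive t 1 c (rsubmx (y t)).
  move=> th; apply: is_derive_mx => i j; rewrite (ord1 i).
  have := dyc t (lshift d.+1 j) th; rewrite /geodesic_field row_mxEl.
  rewrite (_ : (fun s => c s 0 j) = fun s => y s 0 (lshift d.+1 j)) //.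
  by apply/funext => s; rewrite mxE.
have nh t : - h < t < h -> \forall s \near t, - h < s < h.
  by move=> th; have := near_in_itvoo (a := - h) (b := h); move=> /(_ t); rewrite in_itv;
    move=> /(_ th); apply: filterS => s; rewrite in_itv.
have dcE t : - h < t < h -> {near t, (fun s => rsubmx (y s)) =1 derive1 c}.
  move=> th; apply: filterS (nh t th) => s sh.
  by rewrite (is_derive_derive1 (dc s sh)).
have ddc t : - h < t < h -> is_derive t 1 (derive1 c) (rsubmx (geodesic_field (y t))).
  move=> th; apply: near_eq_is_derive (dcE t th) _.
  apply: is_derive_mx => i j; rewrite (ord1 i).
  have := dyc t (rshift d.+1 j) th; rewrite [rsubmx _ 0 j]mxE.
  rewrite (_ : (fun s => rsubmx (y s) 0 j) = fun s => y s 0 (rshift d.+1 j)) //.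
  by apply/funext => s; rewrite mxE.
have z0 : - h < 0 < h by rewrite oppr_lt0 h0.
exists c; split; first by rewrite /c y0 row_mxKl.
  by rewrite (is_derive_derive1 (dc 0 z0)) y0 row_mxKr.
move=> t th; split.
- by apply: filterS (nh t th) => s /dc[].
- by have [] := ddc t th.
- move=> k; rewrite (is_derive_derive1 (ddc t th)) (is_derive_derive1 (dc t th)).
  by rewrite /geodesic_field row_mxKr mxE addNr.
Qed.

Lemma geodesic_eq_near_unique (c1 c2 : R -> V) (t0 : R) :
  (\forall t \near t0, geodesic_eq_at G c1 t) ->
  (\forall t \near t0, geodesic_eq_at G c2 t) ->
  c1 t0 = c2 t0 -> derive1 c1 t0 = derive1 c2 t0 ->
  {near t0, c1 =1 c2}.
Proof.
move=> g1 g2 c12 dc12.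
have [y yE] : exists y : (R -> V) -> R -> E, forall c,
    y c = fun t => row_mx (c t) (derive1 c t) by exists (fun c t => row_mx (c t) (derive1 c t)).
have yP c : (\forall t \near t0, geodesic_eq_at G c t) ->
    \forall t \near t0, is_derive (t : R) (1 : R) (y c) (geodesic_field (y c t)).
  apply: filterS => t [dc ddc eqc].
  apply: is_derive_mx => i j; rewrite (ord1 i) yE /geodesic_field.
  case: (split_ordP j) => k ->.
    rewrite row_mxEl row_mxKr.
    rewrite (_ : (fun s => _) = fun s => c s 0 k).
      by apply: is_derive_coord; exact: nbhs_singleton dc.
    by apply/funext => s; rewrite row_mxEl.
  rewrite row_mxEr mxE row_mxKr row_mxKl.
  rewrite (_ : (fun s => _) = fun s => derive1 c s 0 k); last first.
    by apply/funext => s; rewrite row_mxEr.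
  have := is_derive_coord 0 k ddc; move=> H; apply: (is_derive_eq H).
  by apply/eqP; rewrite -addr_eq0 eqc.
have yM c : (\forall t \near t0, geodesic_eq_at G c t) ->
    \forall t \near t0, `|y c t| <= `|y c t0| + 1.
  move=> gc; have [dy _] := nbhs_singleton (yP c gc).
  have cy : {for t0, continuous (y c)}.
    by apply: differentiable_continuous; exact/derivable1_diffP.
  have /cvgrPdist_le/(_ 1 ltr01) := cy; apply: filterS => t H.
  rewrite -[y c t](subrK (y c t0)); apply: le_trans (ler_normD _ _) _.
  by rewrite [leRHS]addrC; apply: lerD; [rewrite distrC; exact: H | exact: lexx].
have [M [M0 M1 M2]] : exists M, [/\ 0 <= M, \forall t \near t0, `|y c1 t| <= M &
    \forall t \near t0, `|y c2 t| <= M].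
  move: (yM c1 g1) (yM c2 g2) (normr_ge0 (y c1 t0)) (normr_ge0 (y c2 t0)).
  move: `|y c1 t0| `|y c2 t0| => m1 m2 H1 H2 m10 m20; exists (m1 + m2 + 1).
  split; first lra.
    by apply: filterS H1 => t /le_trans; apply; lra.
  by apply: filterS H2 => t /le_trans; apply; lra.
have [K [L [K0 L0 fP]]] := geodesic_field_lipschitz M0.
have : \forall t \near t0, [/\ is_derive (t : R) (1 : R) (y c1) (geodesic_field (y c1 t)),
    is_derive (t : R) (1 : R) (y c2) (geodesic_field (y c2 t)),
    `|geodesic_field (y c1 t) - geodesic_field (y c2 t)| <= L * `|y c1 t - y c2 t| &
    `|y c1 t - y c2 t| <= M + M].
  near=> t.
  have h3 : `|y c1 t| <= M by near: t; exact: M1.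
  have h4 : `|y c2 t| <= M by near: t; exact: M2.
  have [_ h5] := fP _ _ h3 h4; split.
  - by near: t; exact: (yP c1 g1).
  - by near: t; exact: (yP c2 g2).
  - exact: h5.
  - exact: le_trans (ler_normB _ _) (lerD h3 h4).
move=> /nbhs_ballP[/= r r0 rP].
have L1 : 0 < 2 * (L + 1) by rewrite mulr_gt0 // ltr_wpDl.
pose r' := Num.min r (2 * (L + 1))^-1.
have r'0 : 0 < r' by rewrite lt_min r0 invr_gt0.
have Lr : L * r' <= 2^-1.
  apply: (@le_trans _ _ (L * (2 * (L + 1))^-1)).
    by apply: ler_wpM2l => //; rewrite ge_min lexx orbT.
  rewrite invfM mulrCA ler_piMr ?invr_ge0 // ler_pdivrMr ?mul1r ?lerDl //.
  by rewrite ltr_wpDl.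
have y12 : y c1 t0 = y c2 t0 by rewrite !yE c12 dc12.
have MM : 0 <= M + M by rewrite addr_ge0.
have U := ode_local_uniqueness L0 MM Lr y12.
apply/nbhs_ballP; exists r' => //= t tr.
have tr' : `|t - t0| < r' by move: tr; rewrite -ball_normE /= distrC.
have : y c1 t = y c2 t.
  apply: U tr' => s sr; apply: rP; rewrite -ball_normE /= distrC.
  by apply: lt_le_trans sr _; rewrite ge_min lexx.
by rewrite !yE => /eq_row_mx[].
Unshelve. all: by end_near. Qed.

End GeodesicODE.

Lemma posdef_unitmx {R : realFieldType} {d : nat} (M : 'M[R]_d) :
  (forall v : 'rV[R]_d, v != 0 -> 0 < (v *m M *m v^T) 0 0) -> M \in unitmx.
Proof.
move=> pM; rewrite -row_free_unit -kermx_eq0; apply/negPn/negP => nz.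
have v0 : nz_row (kermx M) != 0 by rewrite nz_row_eq0.
have := pM _ v0; have /sub_kermxP -> := nz_row_sub (kermx M).
by rewrite mul0mx mxE ltxx.
Qed.

Lemma jacobian_comp {R : realType} {d : nat} (f g : 'rV[R]_d.+1 -> 'rV[R]_d.+1) x :
  differentiable f x -> differentiable g (f x) -> 'J (g \o f) x = 'J f x *m 'J g (f x).
Proof.
move=> df dg; apply/matrixP => a b.
have dgf := differentiable_comp df dg; rewrite (jacobianE _ _ dgf) mxE.
have dgb : differentiable (fun y => g y 0 b) (f x) by exact: ((differentiable_mxP g (f x)).1 dg).
rewrite (partial_mx _ _ _ dgf).
have := partial_comp (F := fun y => g y 0 b) a df dgb => ->.
apply: eq_bigr => c _; congr (_ * _); first exact/esym/jacobianE.
apply/esym; by rewrite (jacobianE _ _ dg); exact: partial_mx.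
Qed.

Lemma jacobian_unit {R : realType} {d : nat} (f g : 'rV[R]_d.+1 -> 'rV[R]_d.+1) x :
  differentiable f x -> differentiable g (f x) ->
  (\forall y \near x, (g \o f) y = id y) -> 'J f x \in unitmx.
Proof.
move=> df dg gf.
suff H : 'J f x *m 'J g (f x) = 1%:M by have [uf _] := mulmx1_unit H; exact: uf.
rewrite -jacobian_comp //; apply/matrixP => a b.
rewrite (jacobianE _ _ (differentiable_comp df dg)) (partial_near a gf) /partial derive_id !mxE.
by rewrite eqxx /= eq_sym.
Qed.

Section Charts.
Context {R : realType} {d : nat} (N : riemannian_manifold R d).
(* Every solution of the geodesic equation in coordinates is then a curve of [M]. *)
Hypothesis codT : forall i : mindex N, chart_cod (atlas i) = setT.
Local Notation V := 'rV[R]_d.+1.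
Local Notation M := (mspace N).
Local Notation dom i := (chart_dom (atlas i)).
Local Notation crd i := (chart_map (atlas i)).
Local Notation inv i := (chart_inv (atlas i)).
Implicit Types (i j : mindex N) (gamma : R -> M) (t : R).

Lemma metric_smoothT i : smooth_on setT (@metric _ _ N i).
Proof. by rewrite -(codT i); exact: metric_smooth. Qed.

Lemma metric_symT i x : (@metric _ _ N i x)^T = metric i x.
Proof. by apply: Defs.metric_sym; rewrite codT. Qed.

Lemma metric_unitT i x : @metric _ _ N i x \in unitmx.
Proof. by apply: posdef_unitmx => v; apply: metric_pos; rewrite codT. Qed.

Lemma dom_open i : open (dom i).
Proof. exact: chart_dom_open (atlas_chart i). Qed.

Lemma chart_invP i (x : V) : dom i (inv i x) /\ crd i (inv i x) = x.
Proof.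
have : chart_cod (atlas i) x by rewrite codT.
by move=> [p ip <-]; rewrite (chart_mapK (atlas_chart i)).
Qed.

Lemma chart_inv_crd i p : dom i p -> inv i (crd i p) = p.
Proof. exact: chart_mapK (atlas_chart i) p. Qed.

Lemma inv_continuous i : continuous (inv i).
Proof.
have := chart_inv_cts (atlas_chart i); rewrite codT => H.
by apply/continuous_subspace_setT.
Qed.

Definition overlap i j : set V := crd i @` (dom i `&` dom j).

Lemma overlapE i j : overlap i j = inv i @^-1` dom j.
Proof.
apply/seteqP; split=> x /=.
  by move=> [p [ip jp] <-]; rewrite chart_inv_crd.
move=> jx; have [ix xE] := chart_invP i x; by exists (inv i x).
Qed.

Lemma overlap_open i j : open (overlap i j).
Proof.
rewrite overlapE; apply: open_comp; last exact: dom_open.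
by move=> x _; exact: inv_continuous.
Qed.

Lemma overlap_smooth i j : smooth_on (overlap i j) (transition (atlas i) (atlas j)).
Proof. exact: atlas_smooth. Qed.

Lemma transition_unit i j x : overlap i j x ->
  'J (transition (atlas i) (atlas j)) x \in unitmx.
Proof.
set f := transition (atlas i) (atlas j); set g := transition (atlas j) (atlas i).
move=> ijx; have fx : overlap j i (f x).
  move: ijx; rewrite !overlapE /f /transition /= => jx.
  by rewrite chart_inv_crd //; have [] := chart_invP i x.
have df : differentiable f x := smooth_diff (@overlap_smooth i j) ijx.
have dg : differentiable g (f x) := smooth_diff (@overlap_smooth j i) fx.
apply: (jacobian_unit df dg).
have := open_nbhs_nbhs (conj (@overlap_open i j) ijx); apply: filterS => y.
rewrite overlapE /= => jy; rewrite /g /f /transition /=.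
by rewrite (chart_inv_crd jy); have [] := chart_invP i y.
Qed.

Definition geodesic_at gamma t := {for t, continuous gamma} /\
  forall i, dom i (gamma t) -> geodesic_eq_at (metric i) (crd i \o gamma) t.

Lemma near_dom i gamma t : {for t, continuous gamma} -> dom i (gamma t) ->
  \forall s \near t, dom i (gamma s).
Proof. by move=> cg ig; apply: cg; exact: open_nbhs_nbhs (conj (@dom_open i) ig). Qed.

(** By the transformation law, the geodesic equation may be checked in one chart. *)
Lemma geodesic_at_chart i gamma t : {for t, continuous gamma} -> dom i (gamma t) ->
  geodesic_eq_at (metric i) (crd i \o gamma) t -> geodesic_at gamma t.
Proof.
move=> cg ig geo; split; first exact: cg.
move=> j jg.
have ij : overlap i j ((crd i \o gamma) t) by rewrite overlapE /= chart_inv_crd.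
have := geodesic_eq_transform (@overlap_open i j) openT (@overlap_smooth i j)
  (fun _ _ => I) (metric_smoothT j) (fun x _ => metric_symT j x)
  (fun x _ => metric_unitT j x) (@transition_unit i j) _ ij geo.
move=> H; have {}H := H ltac:(move=> x; rewrite overlapE /= => jx;
  have [ix xE] := chart_invP i x; have := metric_compat ix jx; rewrite xE; exact).
apply: geodesic_eq_near H; apply: filterS (near_dom cg ig) => s is_.
by rewrite /transition /= chart_inv_crd.
Qed.

Lemma geodesic_at_near gamma gamma' t : {near t, gamma =1 gamma'} ->
  geodesic_at gamma t -> geodesic_at gamma' t.
Proof.
move=> gg [cg geo]; have E := nbhs_singleton gg; split.
  rewrite /prop_for /continuous_at -E; apply: cvg_trans cg.
  by apply: near_eq_cvg; apply: filterS gg => s ->.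
move=> i; rewrite -E => /geo; apply: geodesic_eq_near.
by apply: filterS gg => s; rewrite /= => ->.
Qed.

Lemma geodesic_at_agree gamma gamma' t i :
  (\forall s \near t, geodesic_at gamma s) -> (\forall s \near t, geodesic_at gamma' s) ->
  gamma t = gamma' t -> dom i (gamma t) ->
  derive1 (crd i \o gamma) t = derive1 (crd i \o gamma') t ->
  {near t, gamma =1 gamma'}.
Proof.
move=> g1 g2 E ig dE.
have nd1 := near_dom (nbhs_singleton g1).1 ig.
have nd2 : \forall s \near t, dom i (gamma' s).
  by apply: near_dom (nbhs_singleton g2).1 _; rewrite -E.
have h1 : \forall s \near t, geodesic_eq_at (metric i) (crd i \o gamma) s.
  by apply: filterS2 nd1 g1 => s ? [_]; apply.
have h2 : \forall s \near t, geodesic_eq_at (metric i) (crd i \o gamma') s.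
  by apply: filterS2 nd2 g2 => s ? [_]; apply.
have := geodesic_eq_near_unique (metric_smoothT i) (metric_unitT i) h1 h2.
rewrite /= E => /(_ erefl dE) /= H.
apply: filterS2 (filterI nd1 nd2) H => s [s1 s2] sE.
by rewrite -(chart_inv_crd s1) sE chart_inv_crd.
Qed.

(** The set of times near which the two curves agree is open. It is closed because at a
limit time positions and velocities agree, which determines a geodesic locally. *)
Lemma geodesic_unique (I : set R) gamma gamma' t0 : open I -> is_interval I ->
  geodesic_on I gamma -> geodesic_on I gamma' -> I t0 ->
  {near t0, gamma =1 gamma'} -> forall t, I t -> gamma t = gamma' t.
Proof.
move=> oI iI g1 g2 I0 n0.
pose S := [set t : R | \forall s \near t, gamma s = gamma' s].
have oS : open S.
  by rewrite openE => t /= /near_join.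
have nI t : I t -> \forall s \near t, I s.
  by move=> It; exact: open_nbhs_nbhs (conj oI It).
suff SI : I `&` S = I.
  by move=> t; rewrite -SI => -[_ /nbhs_singleton].
have /connected_intervalP cI := iI; apply: cI; first by exists t0.
  by exists S.
exists (closure S); first exact: closed_closure.
apply/seteqP; split=> t [It St]; split=> //; first exact: subset_closure.
have gt : gamma t = gamma' t.
  have := @mspace_hausdorff _ _ N; apply=> A B nA nB.
  have nA' : \forall s \near t, A (gamma s) := (g1 t It).1 _ nA.
  have nB' : \forall s \near t, B (gamma' s) := (g2 t It).1 _ nB.
  have [s [Ss [As Bs]]] := St _ (filterI nA' nB').
  exists (gamma s); split; first exact: As.
  by rewrite (nbhs_singleton Ss).
have [i ig] := atlas_cover (gamma t).
have near1 : \forall s \near t, geodesic_at gamma s.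
  by apply: filterS (nI t It) => s /g1.
have near2 : \forall s \near t, geodesic_at gamma' s.
  by apply: filterS (nI t It) => s /g2.
apply: (geodesic_at_agree near1 near2 gt ig).
have [_ d1 _] := (g1 t It).2 i ig.
have [|_ d2 _] := (g2 t It).2 i; first by rewrite -gt.
pose D s := derive1 (crd i \o gamma) s - derive1 (crd i \o gamma') s.
have cD : {for t, continuous D}.
  apply: differentiable_continuous; apply: differentiableB;
    by apply/derivable1_diffP.
apply/eqP; rewrite -subr_eq0 -normr_le0 -/(D t); apply/ler_addgt0Pr => e e0.
rewrite add0r; have /cvgrPdist_le/(_ e e0) nD := cD.
have [s [Ss Ds]] := St _ nD.
have Ds0 : D s = 0.
  rewrite /D; have := @near_derive1 R V (crd i \o gamma) (crd i \o gamma') s.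
  move=> H; have {}H : {near s, (crd i \o gamma)^`()%classic =1 (crd i \o gamma')^`()%classic}.
    by apply: H; apply: filterS Ss => r /= ->.
  by rewrite (nbhs_singleton H) subrr.
by move: Ds; rewrite /= Ds0 subr0.
Qed.

End Charts.

(** * A criterion for geodesic completeness *)

Lemma near_between {R : realType} (a b t : R) : a < t < b -> \forall u \near t, a < u < b.
Proof.
move=> tab; have := near_in_itvoo (a := a) (b := b) => /(_ t).
by rewrite in_itv => /(_ tab); apply: filterS => s; rewrite in_itv.
Qed.

Section Shift.
Context {R : realType} {d : nat}.
Local Notation V := 'rV[R]_d.+1.

Lemma derive1_shift {W : normedModType R} (c : R -> W) (a : R) :
  derive1 (fun s => c (s - a)) = fun s => derive1 c (s - a).
Proof.
apply/funext => s; rewrite /derive1; congr (lim _).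
rewrite (_ : (fun h => _) = fun h => h^-1 *: (c (h + (s - a)) - c (s - a))) //.
by apply/funext => h; rewrite addrA.
Qed.

Lemma derivable_shift {W : normedModType R} (c : R -> W) (a t : R) :
  derivable c (t - a) 1 -> derivable (fun s => c (s - a)) t 1.
Proof.
rewrite /derivable.
rewrite (_ : (fun h => h^-1 *: (c (h *: 1 + (t - a)) - c (t - a))) =
  fun h => h^-1 *: (c (h *: 1 + t - a) - c (t - a))) //.
by apply/funext => h; rewrite addrA.
Qed.

Lemma geodesic_eq_shift (G : V -> 'M[R]_d.+1) (c : R -> V) (a t : R) :
  geodesic_eq_at G c (t - a) -> geodesic_eq_at G (fun s => c (s - a)) t.
Proof.
move=> [dc ddc eqc]; split.
- have : \forall s \near t, derivable c (s - a) 1.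
    have := dc; rewrite (near_shift t (t - a)); apply: filterS => s /=.
    by rewrite [t - a - t]addrAC subrr add0r.
  by apply: filterS => s; exact: derivable_shift.
- by rewrite derive1_shift; exact: derivable_shift.
- by move=> k; rewrite !derive1_shift; exact: eqc.
Qed.

End Shift.

Section Completeness.
Context {R : realType} {d : nat} (N : riemannian_manifold R d).
Hypothesis codT : forall i : mindex N, chart_cod (atlas i) = setT.
Local Notation V := 'rV[R]_d.+1.
Implicit Types (i : mindex N) (gamma delta : R -> mspace N) (t : R).

Lemma geodesic_exists i (K : R) : 0 <= K ->
  exists2 h : R, 0 < h & forall (x0 v0 : V) t0, `|x0| <= K -> `|v0| <= K ->
    exists gamma : R -> mspace N, [/\ gamma t0 = chart_inv (atlas i) x0,
      derive1 (chart_map (atlas i) \o gamma) t0 = v0 &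
      forall t, t0 - h < t < t0 + h -> geodesic_at gamma t].
Proof.
move=> K0.
have [h h0 H] := geodesic_local_existence (metric_smoothT codT i) (metric_unitT codT i) K0.
exists h => // x0 v0 t0 x0K v0K; have [c [c0 dc0 geo]] := H x0 v0 x0K v0K.
have E : chart_map (atlas i) \o (fun s => chart_inv (atlas i) (c (s - t0))) =
    fun s => c (s - t0).
  by apply/funext => s /=; have [] := chart_invP codT i (c (s - t0)).
exists (fun s => chart_inv (atlas i) (c (s - t0))); split.
- by rewrite subrr c0.
- by rewrite E derive1_shift subrr.
move=> t /andP[t1 t2].
have geo' : geodesic_eq_at (metric i) (fun s => c (s - t0)) t.
  by apply/geodesic_eq_shift/geo; rewrite ltrBrDl t1 ltrBlDl t2.
apply: (geodesic_at_chart codT (i := i)).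
- apply: (continuous_comp (geodesic_eq_continuous geo')); exact: inv_continuous codT i _.
- by have [] := chart_invP codT i (c (t - t0)).
- by rewrite E.
Qed.

(** What matters is that [h] depends neither on the restarting time nor on how far the
geodesic has been prolonged: near an end of its interval a restart leads beyond it. *)
Definition uniformly_restartable := forall (t0 T : R) gamma, 0 < T ->
  exists2 h : R, 0 < h & forall s gamma', 0 < s <= T -> {near t0, gamma' =1 gamma} ->
    (forall t, t0 - s < t < t0 + s -> geodesic_at gamma' t) ->
    forall t, t0 - s < t < t0 + s -> exists delta, {near t, delta =1 gamma'} /\
      forall u, t - h < u < t + h -> geodesic_at delta u.

Let interval_unique (a b t1 : R) gamma gamma' :
  (forall t, a < t < b -> geodesic_at gamma t) ->
  (forall t, a < t < b -> geodesic_at gamma' t) ->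
  a < t1 < b -> {near t1, gamma =1 gamma'} ->
  forall t, a < t < b -> gamma t = gamma' t.
Proof.
move=> g1 g2 t1ab n; apply: (@geodesic_unique _ _ N codT [set t | a < t < b] _ _ t1) => //.
- by rewrite openE => t /near_between.
- move=> x y /= /andP[ax _] /andP[_ yb] z /andP[xz zy].
  by rewrite (lt_le_trans ax xz) (le_lt_trans zy yb).
Qed.

Let extend_step (t0 s k h : R) gamma :
  0 < k -> k + k <= s -> k + k <= h ->
  (forall t, t0 - s < t < t0 + s -> geodesic_at gamma t) ->
  (forall t, t0 - s < t < t0 + s -> exists delta, {near t, delta =1 gamma} /\
      forall u, t - h < u < t + h -> geodesic_at delta u) ->
  exists gamma', {near t0, gamma' =1 gamma} /\
    forall t, t0 - (s + k) < t < t0 + (s + k) -> geodesic_at gamma' t.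
Proof.
move=> k0 ks kh geo H.
pose tp := t0 + s - k; pose tm := t0 - s + k.
have [|dp [dpE dpg]] := H tp; first by apply/andP; split; rewrite /tp; lra.
have [|dm [dmE dmg]] := H tm; first by apply/andP; split; rewrite /tm; lra.
have pE t : tp - k < t < t0 + s -> dp t = gamma t.
  apply: (@interval_unique _ _ tp _ _ _ _ _ dpE); rewrite /tp.
  - by move=> u /andP[u1 u2]; apply: dpg; rewrite /tp; apply/andP; split; lra.
  - by move=> u /andP[u1 u2]; apply: geo; apply/andP; split; lra.
  - by apply/andP; split; lra.
have mE t : t0 - s < t < tm + k -> dm t = gamma t.
  apply: (@interval_unique _ _ tm _ _ _ _ _ dmE); rewrite /tm.
  - by move=> u /andP[u1 u2]; apply: dmg; rewrite /tm; apply/andP; split; lra.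
  - by move=> u /andP[u1 u2]; apply: geo; apply/andP; split; lra.
  - by apply/andP; split; lra.
pose g t := if t <= tm then dm t else if t < tp then gamma t else dp t.
have gE t : t0 - s < t < t0 + s -> g t = gamma t.
  move=> /andP[t1 t2]; rewrite /g; have [tm1|_] := leP t tm.
    by apply: mE; apply/andP; split=> //; rewrite /tm in tm1 *; lra.
  have [//|tp1] := ltP t tp.
  by apply: pE; apply/andP; split=> //; rewrite /tp in tp1 *; lra.
exists g; split.
  apply: filterS (near_between (a := t0 - s) (b := t0 + s) _) => [t /gE //|].
  by apply/andP; split; lra.
move=> t /andP[t1 t2]; have [ts|st] := ltP t (t0 + s); last first.
  apply: (@geodesic_at_near _ _ N dp); last by apply: dpg; rewrite /tp; apply/andP; split; lra.
  apply: filterS (near_between (a := tp) (b := t + 1) _) => [u /andP[u1 _]|].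
    by rewrite /g !ifF //; apply/negbTE; rewrite -?ltNge -?leNgt; rewrite /tp /tm in u1 *; lra.
  by rewrite /tp; apply/andP; split; lra.
have [ts'|st'] := ltP (t0 - s) t.
  apply: (@geodesic_at_near _ _ N gamma); last by apply: geo; rewrite ts ts'.
  apply: filterS (near_between (a := t0 - s) (b := t0 + s) _) => [u /gE ->//|].
  by rewrite ts ts'.
apply: (@geodesic_at_near _ _ N dm); last by apply: dmg; rewrite /tm; apply/andP; split; lra.
apply: filterS (near_between (a := t - 1) (b := tm) _) => [u /andP[_ u1]|].
  by rewrite /g ifT // ltW.
by rewrite /tm; apply/andP; split; lra.
Qed.

Let extend_all (t0 s0 T : R) gamma : uniformly_restartable -> 0 < s0 -> 0 < T ->
  (forall t, t0 - s0 < t < t0 + s0 -> geodesic_at gamma t) ->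
  exists gamma', {near t0, gamma' =1 gamma} /\
    forall t, t0 - T < t < t0 + T -> geodesic_at gamma' t.
Proof.
move=> UR s00 T0 geo0; have [h h0 hP] := UR t0 T gamma T0.
pose k := Num.min h s0 / 2.
have k0 : 0 < k by rewrite divr_gt0 // lt_min h0.
have kh : k + k <= h by rewrite -splitr ge_min lexx.
have ks : k + k <= s0 by rewrite -splitr ge_min lexx orbT.
have grow n : exists s gamma', [/\ s0 <= s, T <= s \/ s0 + k *+ n <= s,
    {near t0, gamma' =1 gamma} & forall t, t0 - s < t < t0 + s -> geodesic_at gamma' t].
  elim: n => [|n [s [g [ss Ts gE gP]]]].
    by exists s0, gamma; split=> //; [right; rewrite addr0 | apply: filterE].
  have [Ts'|sT] := leP T s; first by exists s, g; split=> //; left.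
  have s_gt0 : 0 < s <= T by rewrite (lt_le_trans s00 ss) ltW.
  have [g' [g'E g'P]] := extend_step k0 (le_trans ks ss) kh gP (hP s g s_gt0 gE gP).
  exists (s + k), g'; split=> //.
  - by rewrite (le_trans ss) // lerDl ltW.
  - right; rewrite mulrSr addrA lerD2r; case: Ts => // Ts.
    by move: sT; rewrite ltNge Ts.
  - by apply: filterS2 g'E gE => t -> ->.
have [n nT] : exists n, T <= s0 + k *+ n.
  have := archi_boundP (ltW (divr_gt0 T0 k0)); rewrite ltr_pdivrMr // => /ltW nT.
  exists (Num.bound (T / k)); apply: le_trans nT _.
  by rewrite mulr_natl lerDr ltW.
have [s [g [ss Ts gE gP]]] := grow n; exists g; split=> // t /andP[t1 t2]; apply: gP.
have Ts' : T <= s by case: Ts => // /(le_trans nT).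
by apply/andP; split; lra.
Qed.

(** Each restart prolongs a geodesic by a fixed amount, so that finitely many of them reach
any given time; by uniqueness the prolongations to larger and larger intervals agree. *)
Lemma restartable_complete (p0 : mspace N) : uniformly_restartable ->
  geodesically_complete N.
Proof.
move=> UR I gamma oI iI geo.
have [[t0 It0]|I0] := pselect (I !=set0); last first.
  exists (fun=> p0); split=> [t _|t It]; last by exfalso; apply: I0; exists t.
  split; first exact: cvg_cst.
  move=> i ip /=; have E : chart_map (atlas i) \o (fun=> p0) = cst (chart_map (atlas i) p0) :> (R -> V).
    by apply/funext.
  rewrite E.
  have E1 : derive1 (cst (chart_map (atlas i) p0) : R -> V) = cst 0.
    by apply/funext => s; exact: derive1_cst.
  split; first by apply: filterE => s; exact: derivable_cst.
    by rewrite E1; exact: derivable_cst.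
  move=> k; rewrite E1 derive1_cst mxE add0r big1 // => a _.
  by rewrite big1 // => b _; rewrite mxE mulr0 mul0r.
have [s0 s00 s0P] : exists2 s0 : R, 0 < s0 & forall t, t0 - s0 < t < t0 + s0 -> I t.
  have /nbhs_ballP[/= r r0 rP] := open_nbhs_nbhs (conj oI It0).
  exists r => // t tr; apply: rP; rewrite -ball_normE /= distrC ltr_norml.
  by move: tr => /andP[a b]; apply/andP; split; lra.
have geo0 t : t0 - s0 < t < t0 + s0 -> geodesic_at gamma t by move=> /s0P; exact: geo.
have ex (T : R) : exists g, 0 < T -> {near t0, g =1 gamma} /\
    forall t, t0 - T < t < t0 + T -> geodesic_at g t.
  have [T0|T0] := ltP 0 T; last by exists gamma.
  by have [g gP] := extend_all UR s00 T0 geo0; exists g.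
pose G (T : R) := sval (cid (ex T)).
have GP (T : R) : 0 < T -> {near t0, G T =1 gamma} /\
    forall t, t0 - T < t < t0 + T -> geodesic_at (G T) t := svalP (cid (ex T)).
have G_agree (S T t : R) : 0 < S -> S <= T -> t0 - S < t < t0 + S -> G S t = G T t.
  move=> S0 ST; have T0 := lt_le_trans S0 ST.
  have [nS gS] := GP S S0; have [nT gT] := GP T T0.
  apply: (@interval_unique _ _ t0) => //.
  - by move=> u /andP[u1 u2]; apply: gT; apply/andP; split; lra.
  - by apply/andP; split; lra.
  - by apply: filterS2 nS nT => u -> ->.
have bnd t : t0 - (`|t - t0| + 1) < t < t0 + (`|t - t0| + 1).
  have := ler_norm (t - t0); have := ler_norm (t0 - t); rewrite distrC => n1 n2.
  by apply/andP; split; lra.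
have pos t : 0 < `|t - t0| + 1 by rewrite ltr_wpDl.
exists (fun t => G (`|t - t0| + 1) t); split=> [t _|t It].
  pose T : R := `|t - t0| + 2.
  have T0 : 0 < T by rewrite /T ltr_wpDl.
  apply: (@geodesic_at_near _ _ N (G T)); last first.
    have [_] := GP T T0; apply.
    by have /andP[b1 b2] := bnd t; rewrite /T; apply/andP; split; lra.
  apply: filterS (near_between (a := t - 1) (b := t + 1) _) => [u /andP[u1 u2]|].
    symmetry; apply: G_agree => //; rewrite /T.
    have : `|u - t0| <= `|u - t| + `|t - t0| by exact: ler_distD.
    have : `|u - t| <= 1 by rewrite ler_norml; apply/andP; split; lra.
    by lra.
  by apply/andP; split; lra.
have [nT gT] := GP _ (pos t).
pose J := [set u | I u /\ t0 - (`|t - t0| + 1) < u < t0 + (`|t - t0| + 1)].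
apply: (@geodesic_unique _ _ N codT J _ _ t0) => //.
- rewrite openE => u [Iu ub]; apply: filterI; last exact: near_between.
  exact: open_nbhs_nbhs (conj oI Iu).
- move=> x y [Ix /andP[ax _]] [Iy /andP[_ yb]] z xzy; split; first exact: iI xzy.
  by move/andP: xzy => [xz zy]; rewrite (lt_le_trans ax xz) (le_lt_trans zy yb).
- by move=> u [_ /gT].
- by move=> u [/geo].
- by split=> //; have := pos t; move=> p; apply/andP; split; lra.
Qed.

End Completeness.

Section UniformPositivity.
Context {R : realType} {d : nat}.
Local Notation V := 'rV[R]_d.+1.

Lemma quadratic_formZ (r : R) (v : V) (M : 'M[R]_d.+1) :
  ((r *: v) *m M *m (r *: v)^T) 0 0 = r ^+ 2 * (v *m M *m v^T) 0 0.
Proof.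
rewrite !quadratic_formE mulr_sumr; apply: eq_bigr => j _.
rewrite (eq_bigr (fun i => r * (v 0 i * M i j))) => [|i _]; last by rewrite mxE mulrA.
by rewrite -mulr_sumr mxE; move: (\sum_i _) => q; ring.
Qed.

(** A continuous positive definite form is uniformly positive over a ball, by
compactness of the product of the ball with the unit sphere. *)
Lemma uniformly_positive (G : V -> 'M[R]_d.+1) (K : R) : 0 <= K ->
  smooth_on setT G -> (forall x (v : V), v != 0 -> 0 < (v *m G x *m v^T) 0 0) ->
  exists2 l : R, 0 < l & forall x (v : V), `|x| <= K -> l * `|v| ^+ 2 <= (v *m G x *m v^T) 0 0.
Proof.
move=> K0 sG pG.
have sGe i j : smooth_on setT (fun y => G y i j) := (smooth_mxP G openT).1 sG i j.
pose f (z : 'rV[R]_(d.+1 + d.+1)) := (rsubmx z *m G (lsubmx z) *m (rsubmx z)^T) 0 0.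
have fE z : f z = \sum_j (\sum_i z 0 (rshift d.+1 i) * G (lsubmx z) i j) * z 0 (rshift d.+1 j).
  rewrite /f quadratic_formE; apply: eq_bigr => j _; rewrite [X in _ * X]mxE; congr (_ * _).
  by apply: eq_bigr => i _; rewrite mxE.
have cf : continuous f.
  have sl : smooth_on setT (@lsubmx R 1 d.+1 d.+1 : 'rV[R]_(d + d.+1).+1 -> V).
    apply/(smooth_mxP _ openT) => i j; rewrite (ord1 i).
    apply: smooth_eq (smooth_coord openT (lshift d.+1 j)) => [|x _]; first exact: openT.
    by rewrite mxE.
  have sf : smooth_on setT (f : 'rV[R]_(d + d.+1).+1 -> R).
    rewrite (funext fE); apply: (smooth_sum openT) => j.
    apply: (smoothM openT); last exact: smooth_coord openT _.
    apply: (smooth_sum openT) => i; apply: (smoothM openT); first exact: smooth_coord openT _.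
    exact: (smooth_comp openT sl (fun _ _ => I) (sGe i j)).
  by move=> z; apply: differentiable_continuous; exact: smooth_diff sf _.
pose Sph := [set z : 'rV[R]_(d.+1 + d.+1) |
  (forall k, `[- Num.max K 1, Num.max K 1]%classic (z 0 k))] `&`
  [set z | `|lsubmx z| <= K /\ `|rsubmx z| = 1].
have cS : compact Sph.
  apply: compact_closedI.
    apply: (@rV_compact _ _ (fun=> `[- Num.max K 1, Num.max K 1]%classic)) => i.
    exact: segment_compact.
  apply: closedI.
    apply: (@preimage_closed _ _ (fun z : 'rV[R]_(d.+1 + d.+1) => `|lsubmx z|) [set r | r <= K]).
      move=> z _; apply: continuous_comp; first exact: continuous_lsubmx.
      exact: norm_continuous.
    exact: closed_le.
  apply: (@preimage_closed _ _ (fun z : 'rV[R]_(d.+1 + d.+1) => `|rsubmx z|) [set r | r = 1]).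
    move=> z _; apply: continuous_comp; first exact: continuous_rsubmx.
    exact: norm_continuous.
  exact: closed_eq.
have inS (x v : V) : `|x| <= K -> `|v| = 1 -> Sph (row_mx x v).
  move=> xK v1; split; last by rewrite /= row_mxKl row_mxKr.
  move=> k /=; rewrite in_itv /= -ler_norml le_max.
  case: (split_ordP k) => j ->; rewrite ?row_mxEl ?row_mxEr; apply/orP.
    by left; exact: le_trans (rV_coord_le _ _) xK.
  by right; rewrite -v1; exact: rV_coord_le.
have [u u1] : exists u : V, `|u| = 1.
  exists (const_mx 1); apply/eqP; rewrite eq_le; apply/andP; split.
    by apply: rV_norm_le => // j; rewrite mxE normr1.
  by have := rV_coord_le (const_mx 1 : V) 0; rewrite mxE normr1.
have S0 : Sph !=set0 by exists (row_mx 0 u); apply: inS => //; rewrite normr0.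
have [c] := EVT_min_rV S0 cS (continuous_subspaceT cf).
rewrite inE => -[_ [cK c1]] cmin.
have fc : 0 < f c by apply: pG; rewrite -normr_eq0 c1 oner_eq0.
exists (f c) => // x v xK; have [->|v0] := eqVneq v 0.
  by rewrite normr0 expr0n mulr0 mul0mx mul0mx mxE.
have nv : `|v| != 0 by rewrite normr_eq0.
pose w := `|v|^-1 *: v.
have w1 : `|w| = 1 by rewrite /w normrZ normfV normr_id mulVf.
have -> : v = `|v| *: w by rewrite /w scalerA divff // scale1r.
have := cmin (row_mx x w); rewrite inE => /(_ (inS _ _ xK w1)).
rewrite {2}/f row_mxKl row_mxKr => H.
rewrite normrZ normr_id w1 mulr1 quadratic_formZ mulrC.
by apply: ler_wpM2l H; exact: sqr_ge0.
Qed.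

End UniformPositivity.

Section ProperFunction.
Context {R : realType} {d : nat} (N : riemannian_manifold R d).
Hypothesis codT : forall i : mindex N, chart_cod (atlas i) = setT.
Local Notation V := 'rV[R]_d.+1.
Local Notation dom i := (chart_dom (atlas i)).
Local Notation crd i := (chart_map (atlas i)).
Local Notation inv i := (chart_inv (atlas i)).
Implicit Types (i j : mindex N) (gamma : R -> mspace N) (t : R).

Definition speed2 i gamma t : R :=
  let v := derive1 (crd i \o gamma) t in
  (v *m metric i (crd i (gamma t)) *m v^T) 0 0.

Lemma speed2_chart i j gamma t : geodesic_at gamma t ->
  dom i (gamma t) -> dom j (gamma t) -> speed2 i gamma t = speed2 j gamma t.
Proof.
move=> [cg geo] ig jg; have [dx _ _] := geo i ig.
have ijx : overlap i j (crd i (gamma t)) by rewrite overlapE //= chart_inv_crd.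
have dP := smooth_diff (@overlap_smooth _ _ N i j) ijx.
have dx' : is_derive t 1 (crd i \o gamma) (derive1 (crd i \o gamma) t).
  by split; [exact: nbhs_singleton dx | rewrite derive1E].
have E : derive1 (crd j \o gamma) t =
    derive1 (crd i \o gamma) t *m 'J (transition (atlas i) (atlas j)) (crd i (gamma t)).
  have H := is_derive_derive1 (is_derive_curve dx' dP).
  have <- : derive1 (transition (atlas i) (atlas j) \o (crd i \o gamma)) t =
      derive1 (crd j \o gamma) t.
    rewrite !derive1E; apply: near_eq_derive.
    apply: filterS (near_dom cg ig) => s is_.
    by rewrite /transition /= chart_inv_crd.
  rewrite H; apply/rowP => b; rewrite summxE mxE; apply: eq_bigr => k _.
  by rewrite mxE (jacobianE _ _ dP).
rewrite /speed2 E (metric_compat ig jg) /pullback /transition /= chart_inv_crd //.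
by rewrite trmx_mul !mulmxA.
Qed.

(** The squared speed, read in an arbitrary chart. *)
Definition speed gamma t : R := speed2 (sval (cid (atlas_cover (gamma t)))) gamma t.

Lemma speedE i gamma t : geodesic_at gamma t -> dom i (gamma t) ->
  speed gamma t = speed2 i gamma t.
Proof.
move=> geo ig; apply: speed2_chart => //.
exact: (svalP (cid (atlas_cover (gamma t)))).
Qed.

Lemma speed_near gamma gamma' t : {near t, gamma =1 gamma'} ->
  speed gamma t = speed gamma' t.
Proof.
move=> gg; rewrite /speed (nbhs_singleton gg) /speed2.
set i := sval _; have -> : derive1 (crd i \o gamma) t = derive1 (crd i \o gamma') t.
  by rewrite !derive1E; apply: near_eq_derive; apply: filterS gg => s /= ->.
by rewrite (nbhs_singleton gg).
Qed.

Lemma speed_derive gamma t : (\forall s \near t, geodesic_at gamma s) ->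
  is_derive t 1 (speed gamma) 0.
Proof.
move=> ng; have [cg geo] := nbhs_singleton ng.
have [i ig] := atlas_cover (gamma t).
apply: (@near_eq_is_derive _ _ _ (speed2 i gamma)).
  apply: filterS2 ng (near_dom cg ig) => s gs is_.
  by rewrite (speedE gs is_).
apply: (geodesic_energy openT (metric_smoothT codT i)) (geo i ig) => //.
- by move=> x _; exact: metric_symT codT i x.
- by move=> x _; exact: metric_unitT codT i x.
Qed.

Lemma mean_value_scalar (f df : R -> R) (a b K : R) : a < b -> 0 <= K ->
  (forall t, a < t < b -> is_derive t 1 f (df t)) ->
  (forall t, a < t < b -> `|df t| <= K) ->
  forall s t, a < s < b -> a < t < b -> `|f t - f s| <= K * `|t - s|.
Proof.
move=> ab K0 dP dK s t; wlog st : s t / s <= t.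
  move=> H; have [/H//|ts] := leP s t; move=> sh th.
  by rewrite distrC [`|t - s|]distrC; apply: H => //; exact: ltW.
move=> /andP[as_ sb] /andP[at_ tb].
have sub r : r \in `[s, t] -> a < r < b.
  by rewrite in_itv /= => /andP[r1 r2]; rewrite (lt_le_trans as_ r1) (le_lt_trans r2 tb).
have dP' r : r \in `]s, t[ -> is_derive r 1 f (df r).
  by move=> rst; apply/dP/sub; exact: subset_itv_oo_cc rst.
have [|r rst ->] := MVT_segment st dP'.
  by apply: derivable_within_continuous => r /sub/dP[].
by rewrite normrM; apply: ler_wpM2r => //; exact/dK/sub.
Qed.

(** A function [L] with bounded gradient and sublevel sets covered by balls of
two charts prevents geodesics from escaping in finite time: the energy bounds
the growth of [L] along a geodesic, and over a sublevel set it bounds the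
velocity, hence the time of existence from below. *)
Lemma complete_of_proper_function (ix : bool -> mindex N) (L : mspace N -> R) (k : R)
    (p0 : mspace N) :
  (forall r, exists2 K, 0 <= K & forall p, L p <= r ->
     exists b, dom (ix b) p /\ `|crd (ix b) p| <= K) ->
  0 <= k ->
  (forall i x v, differentiable (L \o inv i) x /\
     ('D_v (L \o inv i) x) ^+ 2 <= k * (v *m metric i x *m v^T) 0 0) ->
  geodesically_complete N.
Proof.
move=> H1 k0 H2; apply: (restartable_complete codT p0) => t0 T gamma T0.
pose e := speed gamma t0.
pose m := Num.sqrt (k * e); have m0 : 0 <= m by exact: sqrtr_ge0.
have [K K0 KP] := H1 (L (gamma t0) + m * T).
have pos b := uniformly_positive K0 (metric_smoothT codT (ix b))
  (fun x v => @metric_pos _ _ N (ix b) x v ltac:(by rewrite codT)).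
pose l b := s2val (cid2 (pos b)).
have l0 b : 0 < l b := s2valP (cid2 (pos b)).
have lP b x v : `|x| <= K -> l b * `|v| ^+ 2 <= (v *m metric (ix b) x *m v^T) 0 0 :=
  s2valP' (cid2 (pos b)) x v.
pose K' := K + Num.sqrt (e / l true) + Num.sqrt (e / l false).
have K'0 : 0 <= K' by rewrite !addr_ge0 // sqrtr_ge0.
have ex b := geodesic_exists codT (ix b) K'0.
pose h b := s2val (cid2 (ex b)).
have h0 b : 0 < h b := s2valP (cid2 (ex b)).
have hP b := s2valP' (cid2 (ex b)).
exists (Num.min (h true) (h false)); first by rewrite lt_min !h0.
move=> s gamma' /andP[s0 sT] gE geo t tb.
have ab : t0 - s < t0 + s by lra.
have t0b : t0 - s < t0 < t0 + s by apply/andP; split; lra.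
have ngeo u : t0 - s < u < t0 + s -> \forall v \near u, geodesic_at gamma' v.
  by move=> /near_between; apply: filterS => v /geo.
have eE u : t0 - s < u < t0 + s -> speed gamma' u = e.
  move=> ub; rewrite /e -(speed_near gE); apply/eqP; rewrite -subr_eq0 -normr_le0.
  rewrite -(mul0r `|u - t0|).
  apply: (mean_value_scalar ab (lexx 0) (df := fun=> 0)) t0b ub.
    by move=> v /ngeo/speed_derive.
  by move=> v _; rewrite normr0.
have dL u : t0 - s < u < t0 + s -> exists2 D, is_derive u 1 (L \o gamma') D & `|D| <= m.
  move=> ub; have [cg gu] := geo u ub; have [i ig] := atlas_cover (gamma' u).
  have [dLi bound] := H2 i (crd i (gamma' u)) (derive1 (crd i \o gamma') u).
  exists ('D_(derive1 (crd i \o gamma') u) (L \o inv i) (crd i (gamma' u))).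
    apply: (@near_eq_is_derive _ _ _ ((L \o inv i) \o (crd i \o gamma'))).
      by apply: filterS (near_dom cg ig) => v iv; rewrite /= chart_inv_crd.
    rewrite (deriveE _ dLi) (diff_partial _ dLi).
    apply: (is_derive_curve (F := L \o inv i)); last exact: dLi.
    by have [dx _ _] := gu i ig; split; [exact: nbhs_singleton dx | rewrite derive1E].
  rewrite -sqrtr_sqr ler_wsqrtr //; apply: le_trans bound _.
  by rewrite -(eE u ub) (speedE (geo u ub) ig).
pose D u : R := if pselect (t0 - s < u < t0 + s) is left ub then s2val (cid2 (dL u ub)) else 0.
have Lt : L (gamma' t) <= L (gamma t0) + m * T.
  have -> : gamma t0 = gamma' t0 by rewrite (nbhs_singleton gE).
  have := mean_value_scalar (f := L \o gamma') (df := D) ab m0 _ _ t0b tb => H.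
  have {}H : `|L (gamma' t) - L (gamma' t0)| <= m * `|t - t0|.
    apply: H => u ub; rewrite /D; case: pselect => // ub'.
      exact: s2valP (cid2 (dL u ub')).
    exact: s2valP' (cid2 (dL u ub')).
  have tT : `|t - t0| <= T.
    by rewrite ler_norml; move: tb => /andP[t1 t2]; apply/andP; split; lra.
  have := le_trans (ler_norm _) H; rewrite lerBlDl => /le_trans; apply.
  by rewrite lerD2l; apply: ler_wpM2l.
have [b [bg xK]] := KP _ Lt.
have vK : `|derive1 (crd (ix b) \o gamma') t| <= K'.
  have := lP b _ (derive1 (crd (ix b) \o gamma') t) xK.
  rewrite -/(speed2 (ix b) gamma' t) -(speedE (geo t tb) bg) eE //.
  rewrite mulrC -ler_pdivlMr // => H.
  have : `|derive1 (crd (ix b) \o gamma') t| <= Num.sqrt (e / l b).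
    by rewrite -[leLHS]ger0_norm // -sqrtr_sqr ler_wsqrtr.
  move=> /le_trans; apply; rewrite /K'; case: (b); last by rewrite lerDr addr_ge0 // sqrtr_ge0.
  by rewrite addrAC lerDr addr_ge0 // sqrtr_ge0.
have xK' : `|crd (ix b) (gamma' t)| <= K'.
  by apply: le_trans xK _; rewrite /K' -addrA lerDl addr_ge0 // sqrtr_ge0.
have [delta [d1 d2 d3]] := hP b _ _ t xK' vK.
have hb : Num.min (h true) (h false) <= h b by case: (b); rewrite ge_min lexx ?orbT.
rewrite chart_inv_crd // in d1.
exists delta; split; last first.
  move=> u /andP[u1 u2]; apply: d3.
  by rewrite (le_lt_trans (lerB (lexx t) hb) u1) (lt_le_trans u2 (lerD (lexx t) hb)).
apply: (geodesic_at_agree codT (i := ix b)) => //.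
- have hb0 := h0 b; apply: filterS (near_between (a := t - h b) (b := t + h b) _) => [u /d3//|].
  by apply/andP; split; lra.
- exact: ngeo.
- by rewrite d1.
Qed.

End ProperFunction.

(** * The metric near the bolt *)

Section Covectors.
Context {R : realType}.
Implicit Types (w v : 'rV[R]_4).

Definition pairing w v : R := \sum_i w 0 i * v 0 i.

Lemma sqformE w i j : sqform w i j = w 0 i * w 0 j.
Proof. by rewrite /sqform mxE big_ord1 mxE. Qed.

Lemma sqform_quadratic w v : (v *m sqform w *m v^T) 0 0 = pairing w v ^+ 2.
Proof.
rewrite quadratic_formE expr2 {2}/pairing mulr_sumr; apply: eq_bigr => j _.
rewrite mulrA; congr (_ * _); rewrite /pairing mulr_suml; apply: eq_bigr => i _.
by rewrite sqformE; ring.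
Qed.

Lemma quadraticD v (M M' : 'M[R]_4) :
  (v *m (M + M') *m v^T) 0 0 = (v *m M *m v^T) 0 0 + (v *m M' *m v^T) 0 0.
Proof. by rewrite mulmxDr mulmxDl mxE. Qed.

Lemma quadraticZ v (a : R) (M : 'M[R]_4) :
  (v *m (a *: M) *m v^T) 0 0 = a * (v *m M *m v^T) 0 0.
Proof. by rewrite -scalemxAr -scalemxAl mxE. Qed.

Lemma pullback_sqform w (J : 'M[R]_4) : J *m sqform w *m J^T = sqform (w *m J^T).
Proof. by rewrite /sqform trmx_mul trmxK !mulmxA. Qed.

Lemma row4E (a b c e : R) i : row4 a b c e 0 i = [:: a; b; c; e]`_i.
Proof. by rewrite mxE. Qed.

Lemma sum4 (F : 'I_4 -> R) : \sum_i F i = F 0 + F 1 + F 2 + F 3.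
Proof.
rewrite !big_ord_recl big_ord0 addr0 !addrA.
by congr (F _ + F _ + F _ + F _); apply/val_inj.
Qed.

Lemma pairing_row4 a b c e v :
  pairing (row4 a b c e) v = a * v 0 0 + b * v 0 1 + c * v 0 2 + e * v 0 3.
Proof. by rewrite /pairing sum4 !row4E. Qed.

Lemma ord4P (P : 'I_4 -> Prop) : P 0 -> P 1 -> P 2 -> P 3 -> forall i, P i.
Proof.
move=> P0 P1 P2 P3 i; have [|[|[|]]] : i = 0 \/ i = 1 \/ i = 2 \/ i = 3.
  by case: i => [[|[|[|[|//]]]] hi]; [left | right; left | right; right; left |
    right; right; right]; apply/val_inj.
all: by move=> ->.
Qed.

Lemma smooth_row4 (U : set 'rV[R]_4) (f0 f1 f2 f3 : 'rV[R]_4 -> R) :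
  open U -> smooth_on U f0 -> smooth_on U f1 -> smooth_on U f2 -> smooth_on U f3 ->
  smooth_on U (fun y => row4 (f0 y) (f1 y) (f2 y) (f3 y)).
Proof.
move=> oU s0 s1 s2 s3; apply/(smooth_mxP _ oU) => i j; rewrite (ord1 i).
by elim/ord4P: j; [apply: smooth_eq s0 | apply: smooth_eq s1 | apply: smooth_eq s2 |
  apply: smooth_eq s3] => // x _; rewrite row4E.
Qed.

Lemma smooth_sqform (U : set 'rV[R]_4) (f : 'rV[R]_4 -> 'rV[R]_4) : open U ->
  smooth_on U f -> smooth_on U (fun y => sqform (f y)).
Proof.
move=> oU /(smooth_mxP _ oU) sf; apply/(smooth_mxP _ oU) => i j.
apply: smooth_eq (smoothM oU (sf 0 i) (sf 0 j)) => // x _.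
by rewrite sqformE.
Qed.

End Covectors.

Section ModelMetric.
Context {R : realType} (n : nat) (B x0 : R).
Hypothesis n0 : (0 < n)%N.
Hypothesis B0 : 0 < B.
Hypothesis x00 : 0 < x0.
Implicit Types (y v : 'rV[R]_4) (t : R).

(** The coordinates are [(w, zeta)]: a complex coordinate [w] of the sphere and a complex
coordinate [zeta] in the fibre of a line bundle over it. *)
Definition base2 y : R := 1 + (y 0 0 ^+ 2 + y 0 1 ^+ 2).
Definition fibre2 y : R := y 0 2 ^+ 2 + y 0 3 ^+ 2.

(** In terms of [t = r ^ 2 - r0 ^ 2], [t * radial t] is [f ^ 2 * r ^ 4]. *)
Definition radial t : R := n%:R * x0 + t * (B * (3 * x0 + t) + 1).

Definition coef_fibre t : R := (x0 + t) / radial t.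
(** Chosen so that by [coef_sum] the angular direction has the weight
[r ^ 2 * f ^ 2 / (n ^ 2 * t)]. No division by [t] remains because this weight and
[coef_fibre] agree at the bolt [t = 0], where [radial] is [n * x0]. *)
Definition coef_angle t : R :=
  (B * (3 * x0 + t) + 1 - n%:R) * (radial t + n%:R * (x0 + t)) /
  (n%:R ^+ 2 * (x0 + t) * radial t).

(** The real and imaginary parts of the covariant differential
[D zeta = d zeta + i n zeta beta] with [beta = (w1 dw2 - w2 dw1) / (1 + |w| ^ 2)]. *)
Definition fibre_covector1 y : 'rV[R]_4 :=
  row4 (n%:R * y 0 3 * y 0 1 / base2 y) (- (n%:R * y 0 3 * y 0 0 / base2 y)) 1 0.
Definition fibre_covector2 y : 'rV[R]_4 :=
  row4 (- (n%:R * y 0 2 * y 0 1 / base2 y)) (n%:R * y 0 2 * y 0 0 / base2 y) 0 1.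
(** The imaginary part of [conj zeta * D zeta], which is [n t sigma3]. *)
Definition angle_covector y : 'rV[R]_4 :=
  y 0 2 *: fibre_covector2 y - y 0 3 *: fibre_covector1 y.

Definition model_metric y : 'M[R]_4 :=
  coef_fibre (fibre2 y) *: (sqform (fibre_covector1 y) + sqform (fibre_covector2 y))
  + coef_angle (fibre2 y) *: sqform (angle_covector y)
  + ((x0 + fibre2 y) / base2 y ^+ 2) *: (sqform (row4 1 0 0 0) + sqform (row4 0 1 0 0)).

Lemma n_gt0 : 0 < n%:R :> R. Proof. by rewrite ltr0n. Qed.

Lemma base2_gt0 y : 0 < base2 y.
Proof. by rewrite ltr_wpDr // addr_ge0 // sqr_ge0. Qed.

Lemma fibre2_ge0 y : 0 <= fibre2 y.
Proof. by rewrite addr_ge0 // sqr_ge0. Qed.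

Lemma radial_gt0 t : 0 <= t -> 0 < radial t.
Proof.
move=> t0; rewrite ltr_wpDr ?mulr_gt0 ?n_gt0 // mulr_ge0 // addr_ge0 //.
by rewrite mulr_ge0 ?(ltW B0) // addr_ge0 // mulr_ge0 // ltW.
Qed.

Lemma radius2_gt0 t : 0 <= t -> 0 < x0 + t. Proof. by move=> t0; rewrite ltr_wpDr. Qed.

Lemma coef_sum t : 0 <= t ->
  coef_fibre t + coef_angle t * t = radial t / (n%:R ^+ 2 * (x0 + t)).
Proof.
move=> t0; have r0 := radial_gt0 t0; have x0' := radius2_gt0 t0; have n0' := n_gt0.
rewrite /coef_fibre /coef_angle; apply/eqP; rewrite -subr_eq0; apply/eqP.
have rE : radial t = n%:R * (x0 + t) + t * (B * (3 * x0 + t) + 1 - n%:R).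
  by rewrite /radial; ring.
move: (radial t) rE r0 => Q rE r0.
move: (B * (3 * x0 + t) + 1 - n%:R) rE => q rE.
have tq : t * q = Q - n%:R * (x0 + t) by rewrite rE; ring.
have -> : (x0 + t) / Q + q * (Q + n%:R * (x0 + t)) / (n%:R ^+ 2 * (x0 + t) * Q) * t =
    (x0 + t) / Q + (t * q) * (Q + n%:R * (x0 + t)) / (n%:R ^+ 2 * (x0 + t) * Q) by ring.
rewrite tq; field.
by rewrite !gt_eqF.
Qed.

Lemma coef_sum_gt0 t : 0 <= t -> 0 < coef_fibre t + coef_angle t * t.
Proof.
move=> t0; rewrite coef_sum // divr_gt0 ?radial_gt0 //.
by rewrite mulr_gt0 ?radius2_gt0 // exprn_gt0 // n_gt0.
Qed.

Lemma model_metric_quadratic y v :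
  let p1 := pairing (fibre_covector1 y) v in
  let p2 := pairing (fibre_covector2 y) v in
  (v *m model_metric y *m v^T) 0 0 =
  coef_fibre (fibre2 y) * (p1 ^+ 2 + p2 ^+ 2)
  + coef_angle (fibre2 y) * (y 0 2 * p2 - y 0 3 * p1) ^+ 2
  + (x0 + fibre2 y) / base2 y ^+ 2 * (v 0 0 ^+ 2 + v 0 1 ^+ 2).
Proof.
rewrite /= /model_metric !(quadraticD, quadraticZ, sqform_quadratic).
have -> : pairing (angle_covector y) v = y 0 2 * pairing (fibre_covector2 y) v -
    y 0 3 * pairing (fibre_covector1 y) v.
  rewrite /pairing !mulr_sumr -sumrB; apply: eq_bigr => i _.
  by rewrite /angle_covector !mxE; ring.
by rewrite !pairing_row4 !mul0r !mul1r !addr0 !add0r.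
Qed.

Lemma model_metric_sym y : (model_metric y)^T = model_metric y.
Proof.
apply/matrixP => i j; rewrite mxE /model_metric !mxE !big_ord1 !mxE.
by congr (_ * (_ + _) + _ * _ + _ * (_ + _)); rewrite mulrC.
Qed.

Lemma model_metric_smooth : smooth_on setT model_metric.
Proof.
have oT := @openT 'rV[R]_4.
have sc j : smooth_on setT (fun y => y 0 j) := smooth_coord oT j.
have sb : smooth_on setT base2.
  by apply: (smoothD oT); [exact: smooth_cst | apply: (smoothD oT); exact: smoothX].
have sbV : smooth_on setT (fun y => (base2 y)^-1).
  by apply: smoothV => // x _; rewrite gt_eqF // base2_gt0.
have st : smooth_on setT fibre2 by apply: (smoothD oT); exact: smoothX.
have sx : smooth_on setT (fun y => x0 + fibre2 y).
  by apply: (smoothD oT) => //; exact: smooth_cst.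
have sl : smooth_on setT (fun y => B * (3 * x0 + fibre2 y) + 1).
  apply: (smoothD oT); last exact: smooth_cst.
  apply: (smoothM oT); first exact: smooth_cst.
  by apply: (smoothD oT) => //; exact: smooth_cst.
have sr : smooth_on setT (fun y => radial (fibre2 y)).
  by apply: (smoothD oT); [exact: smooth_cst | exact: smoothM].
have srV : smooth_on setT (fun y => (radial (fibre2 y))^-1).
  by apply: smoothV => // x _; rewrite gt_eqF // radial_gt0 // fibre2_ge0.
have s1 : smooth_on setT fibre_covector1.
  apply: (smooth_row4 oT); try exact: smooth_cst.
    by do ?[apply: (smoothM oT) => //]; exact: smooth_cst.
  by apply: (smoothN oT); do ?[apply: (smoothM oT) => //]; exact: smooth_cst.
have s2 : smooth_on setT fibre_covector2.
  apply: (smooth_row4 oT); try exact: smooth_cst.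
    by apply: (smoothN oT); do ?[apply: (smoothM oT) => //]; exact: smooth_cst.
  by do ?[apply: (smoothM oT) => //]; exact: smooth_cst.
have s3 : smooth_on setT angle_covector.
  apply/(smooth_mxP _ oT) => i j.
  have h1 := (smooth_mxP _ oT).1 s1 i j; have h2 := (smooth_mxP _ oT).1 s2 i j.
  apply: smooth_eq (smoothB oT (smoothM oT (sc 2) h2) (smoothM oT (sc 3) h1)) => //.
  by move=> x _; rewrite (ord1 i) !mxE.
have q1 := smooth_sqform oT s1; have q2 := smooth_sqform oT s2.
have q3 := smooth_sqform oT s3.
have ca : smooth_on setT (fun y => coef_fibre (fibre2 y)) by exact: smoothM.
have cb : smooth_on setT (fun y => coef_angle (fibre2 y)).
  apply: (smoothM oT).
    apply: (smoothM oT); first by apply: (smoothB oT) => //; exact: smooth_cst.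
    apply: (smoothD oT) => //; apply: (smoothM oT) => //; exact: smooth_cst.
  apply: smoothV => [//|x _|].
    by rewrite !mulf_neq0 ?expf_neq0 // gt_eqF ?n_gt0 ?radius2_gt0 ?radial_gt0 ?fibre2_ge0.
  by do ?[apply: (smoothM oT) => //]; exact: smooth_cst.
have cc : smooth_on setT (fun y => (x0 + fibre2 y) / base2 y ^+ 2).
  apply: (smoothM oT) => //; apply: smoothV => [//|x _|]; last exact: smoothX.
  by rewrite expf_neq0 // gt_eqF // base2_gt0.
apply/(smooth_mxP _ oT) => i j.
have h1 := (smooth_mxP _ oT).1 q1 i j; have h2 := (smooth_mxP _ oT).1 q2 i j.
have h3 := (smooth_mxP _ oT).1 q3 i j.
pose k := (sqform (row4 1 0 0 0 : 'rV[R]_4) + sqform (row4 0 1 0 0)) i j.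
apply: smooth_eq (smoothD oT (smoothD oT (smoothM oT ca (smoothD oT h1 h2))
  (smoothM oT cb h3)) (smoothM oT cc (smooth_cst oT k))) => //.
by move=> x _; rewrite /model_metric /k ![in RHS]mxE !mxE.
Qed.

(** On the vectors with components [p] along the fibre the metric is
[coef_fibre |p| ^ 2 + coef_angle (zeta x p) ^ 2]; decomposing [p] along [zeta]
and its normal replaces [coef_angle] by the positive [coef_fibre + coef_angle t]. *)
Lemma fibre_form_bound t (z1 z2 p1 p2 : R) : t = z1 ^+ 2 + z2 ^+ 2 -> 0 <= t ->
  coef_fibre t * (z1 * p1 + z2 * p2) ^+ 2 <=
  t * (coef_fibre t * (p1 ^+ 2 + p2 ^+ 2) + coef_angle t * (z1 * p2 - z2 * p1) ^+ 2).
Proof.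
move=> tE t0; have := ltW (coef_sum_gt0 t0).
move: (coef_fibre t) (coef_angle t) => a b ab; rewrite -subr_ge0.
have -> : t * (a * (p1 ^+ 2 + p2 ^+ 2) + b * (z1 * p2 - z2 * p1) ^+ 2) -
    a * (z1 * p1 + z2 * p2) ^+ 2 = (a + b * t) * (z1 * p2 - z2 * p1) ^+ 2.
  by rewrite tE; ring.
by rewrite mulr_ge0 // sqr_ge0.
Qed.

Lemma coef_fibre_gt0 t : 0 <= t -> 0 < coef_fibre t.
Proof. by move=> t0; rewrite divr_gt0 ?radius2_gt0 ?radial_gt0. Qed.

Lemma fibre_form_gt0 t (z1 z2 p1 p2 : R) : t = z1 ^+ 2 + z2 ^+ 2 -> 0 <= t ->
  0 < p1 ^+ 2 + p2 ^+ 2 ->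
  0 < coef_fibre t * (p1 ^+ 2 + p2 ^+ 2) + coef_angle t * (z1 * p2 - z2 * p1) ^+ 2.
Proof.
move=> tE t0 p0; have a0 := coef_fibre_gt0 t0.
have ab := coef_sum_gt0 t0.
have [b0|b0] := leP 0 (coef_angle t).
  by apply: ltr_pwDl; [exact: mulr_gt0 | apply: mulr_ge0 => //; exact: sqr_ge0].
apply: lt_le_trans (mulr_gt0 ab p0) _; rewrite mulrDl lerD2l -mulrA.
rewrite ler_nM2l // tE -subr_ge0.
have -> : (z1 ^+ 2 + z2 ^+ 2) * (p1 ^+ 2 + p2 ^+ 2) - (z1 * p2 - z2 * p1) ^+ 2 =
  (z1 * p1 + z2 * p2) ^+ 2 by ring.
exact: sqr_ge0.
Qed.

Lemma fibre_form_ge0 t (z1 z2 p1 p2 : R) : t = z1 ^+ 2 + z2 ^+ 2 -> 0 <= t ->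
  0 <= coef_fibre t * (p1 ^+ 2 + p2 ^+ 2) + coef_angle t * (z1 * p2 - z2 * p1) ^+ 2.
Proof.
move=> tE t0; have : 0 <= p1 ^+ 2 + p2 ^+ 2 by rewrite addr_ge0 // sqr_ge0.
rewrite le_eqVlt => /predU1P[E|/(fibre_form_gt0 tE t0)/ltW//].
have p1E : p1 = 0.
  by apply/eqP; rewrite -sqrf_eq0 eq_le sqr_ge0 andbT E lerDl sqr_ge0.
have p2E : p2 = 0.
  by apply/eqP; rewrite -sqrf_eq0 eq_le sqr_ge0 andbT E lerDr sqr_ge0.
by rewrite p1E p2E !mulr0 subr0 expr0n /= addr0 !mulr0 addr0.
Qed.

Lemma model_metric_pos y v : v != 0 -> 0 < (v *m model_metric y *m v^T) 0 0.
Proof.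
move=> v0; rewrite model_metric_quadratic.
have t0 := fibre2_ge0 y; have x1 := radius2_gt0 t0.
have c0 : 0 < (x0 + fibre2 y) / base2 y ^+ 2 by rewrite divr_gt0 // exprn_gt0 // base2_gt0.
have [w0|w0] := ltP 0 (v 0 0 ^+ 2 + v 0 1 ^+ 2).
  by apply: ltr_wpDl; [exact: fibre_form_ge0 | rewrite mulr_gt0].
have v00 : v 0 0 = 0.
  apply/eqP; rewrite -sqrf_eq0 eq_le sqr_ge0 andbT; apply: le_trans w0.
  by rewrite lerDl sqr_ge0.
have v01 : v 0 1 = 0.
  apply/eqP; rewrite -sqrf_eq0 eq_le sqr_ge0 andbT; apply: le_trans w0.
  by rewrite lerDr sqr_ge0.
apply: ltr_wpDr; first by rewrite mulr_ge0 ?(ltW c0) // addr_ge0 // sqr_ge0.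
apply: fibre_form_gt0 => //.
rewrite !pairing_row4 v00 v01 !mulr0 !mul0r !mul1r !addr0 !add0r.
rewrite lt_neqAle addr_ge0 ?sqr_ge0 // andbT eq_sym; apply: contra v0 => /eqP E.
have v02 : v 0 2 = 0.
  by apply/eqP; rewrite -sqrf_eq0 eq_le sqr_ge0 andbT -E lerDl sqr_ge0.
have v03 : v 0 3 = 0.
  by apply/eqP; rewrite -sqrf_eq0 eq_le sqr_ge0 andbT -E lerDr sqr_ge0.
by apply/eqP/rowP => j; rewrite mxE; elim/ord4P: j.
Qed.

(** As [f] grows only linearly in [r], the function [t] grows at most exponentially with
the distance from the bolt. This is the reason why the metric is complete. *)
Lemma log_fibre2_gradient : exists2 k : R, 0 <= k & forall y v,
  differentiable (fun z => ln (1 + fibre2 z)) y /\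
  ('D_v (fun z => ln (1 + fibre2 z)) y) ^+ 2 <= k * (v *m model_metric y *m v^T) 0 0.
Proof.
pose k := n%:R + 1 + 3 * B * x0 + B.
have k0 : 0 <= k by rewrite !addr_ge0 ?mulr_ge0 ?ltW ?n_gt0.
exists (4 * k); first by rewrite mulr_ge0.
move=> y v; have t0 := fibre2_ge0 y; have t1 : 0 < 1 + fibre2 y by rewrite ltr_wpDr.
have g2 := gradX 2 (grad_coord (R := R) (d := 3) 2 y).
have g3 := gradX 2 (grad_coord (R := R) (d := 3) 3 y).
have g := gradD (grad_cst (1 : R) y) (gradD g2 g3).
have [dln lnE] := grad_comp (is_derive1_ln t1) g.
split; first exact: dln.
rewrite (deriveE _ dln) (diff_partial _ dln).
have -> : \sum_i v 0 i *: partial i (fun z => ln (1 + fibre2 z)) y =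
    2 / (1 + fibre2 y) * (y 0 2 * v 0 2 + y 0 3 * v 0 3).
  rewrite (eq_bigr _ (fun i _ => congr1 _ (lnE i))) sum4 /= /GRing.scale /=.
  rewrite -/(fibre2 y); move: (fibre2 y) => t; ring.
have -> : y 0 2 * v 0 2 + y 0 3 * v 0 3 =
    y 0 2 * pairing (fibre_covector1 y) v + y 0 3 * pairing (fibre_covector2 y) v.
  rewrite !pairing_row4; move: (base2 y)^-1 => s; ring.
rewrite model_metric_quadratic.
set p1 := pairing _ v; set p2 := pairing _ v.
have := fibre_form_bound p1 p2 (erefl (fibre2 y)) t0.
have c0 : 0 <= (x0 + fibre2 y) / base2 y ^+ 2 * (v 0 0 ^+ 2 + v 0 1 ^+ 2).
  rewrite mulr_ge0 ?divr_ge0 ?addr_ge0 ?sqr_ge0 //; exact: ltW.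
have f0 := fibre_form_ge0 p1 p2 (erefl (fibre2 y)) t0.
move: (coef_fibre _ * _ + _) f0 => F.
move: ((x0 + fibre2 y) / base2 y ^+ 2 * (v 0 0 ^+ 2 + v 0 1 ^+ 2)) c0 => c c0.
move: (y 0 2 * p1 + y 0 3 * p2) => xi F0 bound.
have x1 := radius2_gt0 t0; have r0 := radial_gt0 t0.
move: (fibre2 y) t0 t1 x1 r0 bound => t t0 t1 x1 r0 bound.
have rk : radial t <= k * (x0 + t) * (1 + t).
  have nn : 0 <= n%:R :> R by [].
  rewrite -subr_ge0; have -> : k * (x0 + t) * (1 + t) - radial t =
    n%:R * t * (x0 + t + 1) + x0 * (1 + t) + t ^+ 2 +
    3 * B * x0 * x0 * (1 + t) + 3 * B * x0 * t ^+ 2 + B * x0 * (1 + t) + B * t by rewrite /k /radial; ring.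
  by rewrite !addr_ge0 ?mulr_ge0 ?addr_ge0 ?sqr_ge0 ?(ltW B0) ?(ltW x00) ?(ltW x1).
have xi2 : xi ^+ 2 <= k * (1 + t) ^+ 2 * F.
  have : xi ^+ 2 <= radial t / (x0 + t) * (t * F).
    by rewrite mulrAC ler_pdivlMr // mulrC -ler_pdivrMl // mulrA [_^-1 * _]mulrC.
  move=> /le_trans; apply; rewrite mulrA; apply: ler_wpM2r => //.
  apply: (@le_trans _ _ (k * (1 + t) * t)).
    by apply: ler_wpM2r => //; rewrite ler_pdivrMr // mulrAC.
  rewrite expr2 mulrA; apply: ler_wpM2l; first by rewrite mulr_ge0 // ltW.
  by rewrite lerDr.
have -> : (2 / (1 + t) * xi) ^+ 2 = 4 * xi ^+ 2 / (1 + t) ^+ 2.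
  by field; rewrite gt_eqF.
rewrite ler_pdivrMr; last by rewrite exprn_gt0.
have := mulr_ge0 (mulr_ge0 k0 (sqr_ge0 (1 + t))) c0.
have -> : 4 * k * (F + c) * (1 + t) ^+ 2 =
  4 * (k * (1 + t) ^+ 2 * F) + 4 * (k * (1 + t) ^+ 2 * c) by ring.
by move: xi2; lra.
Qed.

End ModelMetric.

(** * The transition between the two trivializations *)

Section ComplexPower.
Context {R : realType}.
Implicit Types (z w : R * R).

Definition cmul z w : R * R := (z.1 * w.1 - z.2 * w.2, z.1 * w.2 + z.2 * w.1).
Fixpoint cpow (n : nat) z : R * R := if n is m.+1 then cmul z (cpow m z) else (1, 0).
Definition cnorm2 z : R := z.1 ^+ 2 + z.2 ^+ 2.

Lemma cmulC z w : cmul z w = cmul w z.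
Proof. by rewrite /cmul; congr (_, _); ring. Qed.

Lemma cmulA z w v : cmul z (cmul w v) = cmul (cmul z w) v.
Proof. by rewrite /cmul /=; congr (_, _); ring. Qed.

Lemma cnorm2M z w : cnorm2 (cmul z w) = cnorm2 z * cnorm2 w.
Proof. by rewrite /cnorm2 /cmul /=; ring. Qed.

Lemma cpowM n z w : cpow n (cmul z w) = cmul (cpow n z) (cpow n w).
Proof.
elim: n => [|n IH] /=; first by rewrite /cmul /=; congr (_, _); ring.
by rewrite IH -!cmulA; congr (cmul _ _); rewrite !cmulA [cmul w _]cmulC.
Qed.

Lemma cnorm2X n z : cnorm2 (cpow n z) = cnorm2 z ^+ n.
Proof.
elim: n => [|n IH]; first by rewrite expr0 /cnorm2 /= expr0n addr0 expr1n.
by rewrite /= cnorm2M IH exprS.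
Qed.

Lemma cpow_real n (a : R) : cpow n (a, 0) = (a ^+ n, 0).
Proof.
elim: n => [|n IH] //=; rewrite IH exprS /cmul /=; congr (_, _); ring.
Qed.

Lemma cpow_unit n (a : R) : cpow n (cos a, sin a) = (cos (n%:R * a), sin (n%:R * a)).
Proof.
elim: n => [|n IH]; first by rewrite mul0r cos0 sin0.
by rewrite /= IH -natr1 mulrDl mul1r cosD sinD /cmul /=; congr (_, _); ring.
Qed.

Context {d : nat}.
Local Notation V := 'rV[R]_d.+1.

Lemma smooth_cpow (U : set V) (f g : V -> R) n : open U ->
  smooth_on U f -> smooth_on U g ->
  smooth_on U (fun y => (cpow n (f y, g y)).1) /\
  smooth_on U (fun y => (cpow n (f y, g y)).2).
Proof.
move=> oU sf sg; elim: n => [|n [IH1 IH2]]; first by split; exact: smooth_cst.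
split; first by apply: (smoothB oU); exact: smoothM.
by apply: (smoothD oU); exact: smoothM.
Qed.

(** The derivative of a power of a unit complex number [(f, g)] whose argument
has differential [a]. *)
Lemma grad_cpow (f g : V -> R) (y : V) (a : 'I_d.+1 -> R) n :
  grad f y (fun i => - g y * a i) -> grad g y (fun i => f y * a i) ->
  grad (fun q => (cpow n (f q, g q)).1) y
    (fun i => - (n%:R * (cpow n (f y, g y)).2 * a i)) /\
  grad (fun q => (cpow n (f q, g q)).2) y
    (fun i => n%:R * (cpow n (f y, g y)).1 * a i).
Proof.
move=> gf gg; elim: n => [|n [IH1 IH2]].
  by split; apply: grad_eq (grad_cst _ _) _ => i; rewrite !mul0r ?oppr0.
split.
  apply: grad_eq (gradB (gradM gf IH1) (gradM gg IH2)) _ => i.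
  by rewrite -natr1 /=; ring.
apply: grad_eq (gradD (gradM gf IH2) (gradM gg IH1)) _ => i.
by rewrite -natr1 /=; ring.
Qed.

End ComplexPower.

Section PullbackModel.
Context {R : realType} (n : nat) (B x0 : R).
Local Notation V := 'rV[R]_4.
Local Notation mm := (model_metric n B x0).

Lemma row4_0 (a b c e : R) : row4 a b c e 0 0 = a. Proof. by rewrite mxE. Qed.
Lemma row4_1 (a b c e : R) : row4 a b c e 0 1 = b. Proof. by rewrite mxE. Qed.
Lemma row4_2 (a b c e : R) : row4 a b c e 0 2 = c. Proof. by rewrite mxE. Qed.
Lemma row4_3 (a b c e : R) : row4 a b c e 0 3 = e. Proof. by rewrite mxE. Qed.
Definition row4s := (row4_0, row4_1, row4_2, row4_3).

Lemma grad_coord0 (y : V) : grad (fun z : V => z 0 0) y (row4 1 0 0 0 0).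
Proof. by apply: grad_eq (grad_coord 0 y) _; elim/ord4P; rewrite row4s. Qed.
Lemma grad_coord1 (y : V) : grad (fun z : V => z 0 1) y (row4 0 1 0 0 0).
Proof. by apply: grad_eq (grad_coord 1 y) _; elim/ord4P; rewrite row4s. Qed.
Lemma grad_coord2 (y : V) : grad (fun z : V => z 0 2) y (row4 0 0 1 0 0).
Proof. by apply: grad_eq (grad_coord 2 y) _; elim/ord4P; rewrite row4s. Qed.
Lemma grad_coord3 (y : V) : grad (fun z : V => z 0 3) y (row4 0 0 0 1 0).
Proof. by apply: grad_eq (grad_coord 3 y) _; elim/ord4P; rewrite row4s. Qed.

Lemma grad_row4 (f0 f1 f2 f3 : V -> R) (y : V) (D0 D1 D2 D3 : 'I_4 -> R) :
  grad f0 y D0 -> grad f1 y D1 -> grad f2 y D2 -> grad f3 y D3 ->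
  let F z := row4 (f0 z) (f1 z) (f2 z) (f3 z) in
  differentiable F y /\ forall (w : V) i, (w *m ('J F y)^T) 0 i =
    w 0 0 * D0 i + w 0 1 * D1 i + w 0 2 * D2 i + w 0 3 * D3 i.
Proof.
move=> g0 g1 g2 g3 F.
have FE k : exists D, grad (fun z => F z 0 k) y D.
  by elim/ord4P: k; [exists D0; apply: grad_near g0 | exists D1; apply: grad_near g1 |
    exists D2; apply: grad_near g2 | exists D3; apply: grad_near g3];
    apply: filterE => z; rewrite /F row4s.
have dF : differentiable F y.
  by apply/differentiable_mxP => a k; rewrite (ord1 a); have [D []] := FE k.
split=> // w i; rewrite mxE sum4.
have tr k : ('J F y)^T k i = partial i (fun z => F z 0 k) y.
  by rewrite mxE jacobianE // partial_mx.
rewrite !tr.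
by congr (_ * _ + _ * _ + _ * _ + _ * _);
  [case: g0 => _ <- | case: g1 => _ <- | case: g2 => _ <- | case: g3 => _ <-];
  apply: partial_near; apply: filterE => z; rewrite /F row4s.
Qed.

Lemma pullback_modelE (F : V -> V) (y : V) i j :
  let P1 := fibre_covector1 n (F y) *m ('J F y)^T in
  let P2 := fibre_covector2 n (F y) *m ('J F y)^T in
  let E1 := row4 1 0 0 0 *m ('J F y)^T in
  let E2 := row4 0 1 0 0 *m ('J F y)^T in
  let t := fibre2 (F y) in
  pullback F mm y i j =
  coef_fibre n B x0 t * (P1 0 i * P1 0 j + P2 0 i * P2 0 j) +
  coef_angle n B x0 t * ((F y 0 2 * P2 0 i - F y 0 3 * P1 0 i) *
                  (F y 0 2 * P2 0 j - F y 0 3 * P1 0 j)) +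
  (x0 + t) / base2 (F y) ^+ 2 * (E1 0 i * E1 0 j + E2 0 i * E2 0 j).
Proof.
move=> P1 P2 E1 E2 t; rewrite /pullback /model_metric.
rewrite !mulmxDr !mulmxDl -!scalemxAr -!scalemxAl !mulmxDr !mulmxDl !pullback_sqform.
have -> : angle_covector n (F y) *m ('J F y)^T = F y 0 2 *: P2 - F y 0 3 *: P1.
  by rewrite /angle_covector mulmxBl -!scalemxAl.
have addE (X Y : 'M[R]_4) : (X + Y) i j = X i j + Y i j by rewrite mxE.
have scaleE a (X : 'M[R]_4) : (a *: X) i j = a * X i j by rewrite mxE.
have subE a b k : (a *: P2 - b *: P1) 0 k = a * P2 0 k - b * P1 0 k by rewrite !mxE.
by rewrite !(addE, scaleE) !sqformE !subE.
Qed.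

Lemma model_metricE (y : V) i j :
  let P1 := fibre_covector1 n y in let P2 := fibre_covector2 n y in
  let E1 := row4 1 0 0 0 in let E2 := row4 0 1 0 0 in
  let t := fibre2 y in
  mm y i j =
  coef_fibre n B x0 t * (P1 0 i * P1 0 j + P2 0 i * P2 0 j) +
  coef_angle n B x0 t * ((y 0 2 * P2 0 i - y 0 3 * P1 0 i) *
                  (y 0 2 * P2 0 j - y 0 3 * P1 0 j)) +
  (x0 + t) / base2 y ^+ 2 * (E1 0 i * E1 0 j + E2 0 i * E2 0 j).
Proof.
move=> P1 P2 E1 E2 t; rewrite /model_metric.
have addE (X Y : 'M[R]_4) : (X + Y) i j = X i j + Y i j by rewrite mxE.
have scaleE a (X : 'M[R]_4) : (a *: X) i j = a * X i j by rewrite mxE.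
have subE k : angle_covector n y 0 k = y 0 2 * P2 0 k - y 0 3 * P1 0 k by rewrite !mxE.
by rewrite !(addE, scaleE) !sqformE !subE.
Qed.

(** The change between the trivializations over the two affine charts of the
sphere: inversion of the base coordinate, and multiplication of the fibre by the
[n]-th power of the phase of the base coordinate. *)
Definition clutch (y : V) : V :=
  let p := y 0 0 ^+ 2 + y 0 1 ^+ 2 in
  let u := cpow n (y 0 0 / Num.sqrt p, y 0 1 / Num.sqrt p) in
  row4 (y 0 0 / p) (- (y 0 1 / p)) (y 0 2 * u.1 - y 0 3 * u.2) (y 0 2 * u.2 + y 0 3 * u.1).

Definition off_pole : set V := [set y | y 0 0 ^+ 2 + y 0 1 ^+ 2 != 0].

Lemma off_pole_open : open off_pole.
Proof.
have -> : off_pole = (fun y : V => y 0 0 ^+ 2 + y 0 1 ^+ 2) @^-1` [set r | r != 0] by [].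
apply: open_comp; last exact: open_neq.
move=> y _; have sb : smooth_on setT (fun y : V => y 0 0 ^+ 2 + y 0 1 ^+ 2).
  by apply: smoothD; [exact: openT | apply: smoothX; [exact: openT|] |
    apply: smoothX; [exact: openT|]]; apply: smooth_coord; exact: openT.
by apply: differentiable_continuous; exact: smooth_diff sb _.
Qed.

Lemma off_pole_gt0 y : off_pole y -> 0 < y 0 0 ^+ 2 + y 0 1 ^+ 2.
Proof. by move=> yU; rewrite lt_neqAle eq_sym yU addr_ge0 ?sqr_ge0. Qed.

Lemma clutch_smooth : smooth_on off_pole clutch.
Proof.
have oU := off_pole_open.
have sc j : smooth_on off_pole (fun y => y 0 j) := smooth_coord oU j.
have sp : smooth_on off_pole (fun y => y 0 0 ^+ 2 + y 0 1 ^+ 2).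
  by apply: (smoothD oU); exact: smoothX.
have spV : smooth_on off_pole (fun y => (y 0 0 ^+ 2 + y 0 1 ^+ 2)^-1) by exact: smoothV.
have ssV : smooth_on off_pole (fun y => (Num.sqrt (y 0 0 ^+ 2 + y 0 1 ^+ 2))^-1).
  apply: smoothV => [//|y yU|]; first by rewrite gt_eqF // sqrtr_gt0 off_pole_gt0.
  by apply: smooth_sqrt => // y; exact: off_pole_gt0.
have [su1 su2] := smooth_cpow n oU (smoothM oU (sc 0) ssV) (smoothM oU (sc 1) ssV).
apply: (smooth_row4 oU).
- exact: smoothM.
- by apply: (smoothN oU); exact: smoothM.
- by apply: (smoothB oU); exact: smoothM.
- by apply: (smoothD oU); exact: smoothM.
Qed.

Lemma grad_phase (y : V) : off_pole y ->
  let p z := z 0 0 ^+ 2 + z 0 1 ^+ 2 in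
  let a i := row4 (- (y 0 1 / p y)) (y 0 0 / p y) 0 0 0 i in
  grad (fun z => z 0 0 / Num.sqrt (p z)) y (fun i => - (y 0 1 / Num.sqrt (p y)) * a i) /\
  grad (fun z => z 0 1 / Num.sqrt (p z)) y (fun i => y 0 0 / Num.sqrt (p y) * a i).
Proof.
move=> yU p a; have p0 : 0 < p y := off_pole_gt0 yU.
have gp := gradD (gradX 2 (grad_coord0 y)) (gradX 2 (grad_coord1 y)).
have s0 : Num.sqrt (p y) != 0 by rewrite gt_eqF // sqrtr_gt0.
have gs := gradV (f := fun z => Num.sqrt (p z)) s0 (grad_sqrt p0 gp).
pose s := Num.sqrt (p y); have sE : s ^+ 2 = p y by rewrite sqr_sqrtr // ltW.
have aE i : a i = row4 (- (y 0 1 / s ^+ 2)) (y 0 0 / s ^+ 2) 0 0 0 i by rewrite /a sE.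
have pE : y 0 1 ^+ 2 = s ^+ 2 - y 0 0 ^+ 2 by rewrite sE /p addrAC subrr add0r.
have pE' : y 0 0 ^+ 2 = s ^+ 2 - y 0 1 ^+ 2 by rewrite sE /p addrK.
have s1 : s != 0 := s0.
split.
  apply: grad_eq (gradM (grad_coord0 y) gs) _ => i; rewrite aE /= -/(p y) -/s.
  move: (s) s1 pE => r r0 pE.
  have -> : - (y 0 1 / r) * row4 (- (y 0 1 / r ^+ 2)) (y 0 0 / r ^+ 2) 0 0 0 i =
    row4 (y 0 1 ^+ 2 / r ^+ 3) (- (y 0 0 * y 0 1 / r ^+ 3)) 0 0 0 i.
    by elim/ord4P: i; rewrite !row4s; field.
  by rewrite pE; elim/ord4P: i; rewrite !row4s /=; field.
apply: grad_eq (gradM (grad_coord1 y) gs) _ => i; rewrite aE /= -/(p y) -/s.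
move: (s) s1 pE' => r r0 pE'.
have -> : y 0 0 / r * row4 (- (y 0 1 / r ^+ 2)) (y 0 0 / r ^+ 2) 0 0 0 i =
  row4 (- (y 0 0 * y 0 1 / r ^+ 3)) (y 0 0 ^+ 2 / r ^+ 3) 0 0 0 i.
  by elim/ord4P: i; rewrite !row4s; field.
by rewrite pE'; elim/ord4P: i; rewrite !row4s /=; field.
Qed.

(** Rotating the frame of the fibre leaves the two invariant forms unchanged. *)
Lemma fibre_rotation (c s z1 z2 : R) (U1 U2 P1 P2 : 'I_4 -> R) : c ^+ 2 + s ^+ 2 = 1 ->
  (forall i, P1 i = c * U1 i - s * U2 i) -> (forall i, P2 i = s * U1 i + c * U2 i) ->
  forall i j,
  P1 i * P1 j + P2 i * P2 j = U1 i * U1 j + U2 i * U2 j /\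
  (z1 * c - z2 * s) * P2 i - (z1 * s + z2 * c) * P1 i = z1 * U2 i - z2 * U1 i.
Proof.
move=> cs P1E P2E i j; rewrite !P1E !P2E; split.
  transitivity ((c ^+ 2 + s ^+ 2) * (U1 i * U1 j + U2 i * U2 j)); first by ring.
  by rewrite cs mul1r.
transitivity ((c ^+ 2 + s ^+ 2) * (z1 * U2 i - z2 * U1 i)); first by ring.
by rewrite cs mul1r.
Qed.

Lemma phase_norm (y : V) : off_pole y ->
  let p := y 0 0 ^+ 2 + y 0 1 ^+ 2 in
  let u := cpow n (y 0 0 / Num.sqrt p, y 0 1 / Num.sqrt p) in u.1 ^+ 2 + u.2 ^+ 2 = 1.
Proof.
move=> yU p u; have p0 := off_pole_gt0 yU.
rewrite -/(cnorm2 u) cnorm2X /cnorm2 /= !expr_div_n sqr_sqrtr ?ltW // -mulrDl.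
by rewrite divff ?gt_eqF // expr1n.
Qed.

(** Inversion preserves the round metric of the base and changes [beta] by the
differential of the phase of [w], which the rotation of the fibre compensates. *)
Lemma clutch_pullback y : off_pole y ->
  pullback clutch mm y = mm y.
Proof.
move=> yU; have p0 := off_pole_gt0 yU.
pose u := cpow n (y 0 0 / Num.sqrt (y 0 0 ^+ 2 + y 0 1 ^+ 2),
                  y 0 1 / Num.sqrt (y 0 0 ^+ 2 + y 0 1 ^+ 2)).
have cs : u.1 ^+ 2 + u.2 ^+ 2 = 1 := phase_norm yU.
have [gf gg] := grad_phase yU; have [gu1 gu2] := grad_cpow n gf gg.
have gp := gradD (gradX 2 (grad_coord0 y)) (gradX 2 (grad_coord1 y)).
have pn0 : y 0 0 ^+ 2 + y 0 1 ^+ 2 != 0 by rewrite gt_eqF.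
have gpV := gradV (f := fun z : V => z 0 0 ^+ 2 + z 0 1 ^+ 2) pn0 gp.
have [dF FE] := grad_row4 (gradM (grad_coord0 y) gpV) (gradN (gradM (grad_coord1 y) gpV))
  (gradB (gradM (grad_coord2 y) gu1) (gradM (grad_coord3 y) gu2))
  (gradD (gradM (grad_coord2 y) gu2) (gradM (grad_coord3 y) gu1)).
have b0 : base2 y != 0 by rewrite gt_eqF // base2_gt0.
apply/matrixP => i j; rewrite pullback_modelE model_metricE.
have t_eq : fibre2 (clutch y) = fibre2 y.
  rewrite /fibre2 /clutch !row4s -/u; move: (u) cs => [c s] /= cs.
  transitivity ((c ^+ 2 + s ^+ 2) * (y 0 2 ^+ 2 + y 0 3 ^+ 2)); first by ring.
  by rewrite cs mul1r.
have b_eq : base2 (clutch y) = base2 y / (y 0 0 ^+ 2 + y 0 1 ^+ 2).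
  by rewrite /base2 /clutch !row4s; field.
rewrite t_eq b_eq.
have P1E k : (fibre_covector1 n (clutch y) *m ('J clutch y)^T) 0 k =
    u.1 * fibre_covector1 n y 0 k - u.2 * fibre_covector2 n y 0 k.
  rewrite FE /fibre_covector1 /fibre_covector2 b_eq /clutch !row4s -/u.
  rewrite /base2 in b0 *; move: (u) => [c s] /=.
  by elim/ord4P: k; rewrite !row4s; field; rewrite ?pn0 ?b0.
have P2E k : (fibre_covector2 n (clutch y) *m ('J clutch y)^T) 0 k =
    u.2 * fibre_covector1 n y 0 k + u.1 * fibre_covector2 n y 0 k.
  rewrite FE /fibre_covector1 /fibre_covector2 b_eq /clutch !row4s -/u.
  rewrite /base2 in b0 *; move: (u) => [c s] /=.
  by elim/ord4P: k; rewrite !row4s; field; rewrite ?pn0 ?b0.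
have rot k l := fibre_rotation (y 0 2) (y 0 3) cs P1E P2E k l.
have -> : clutch y 0 2 = y 0 2 * u.1 - y 0 3 * u.2 by rewrite /clutch row4s.
have -> : clutch y 0 3 = y 0 2 * u.2 + y 0 3 * u.1 by rewrite /clutch row4s.
have [-> ->] := rot i j; have [_ ->] := rot j i.
congr (_ + _); rewrite !FE !row4s.
move: b0; move: (base2 y) => S S0; move: (fibre2 y) => t.
by elim/ord4P: i; elim/ord4P: j; rewrite !row4s; field; rewrite ?pn0 ?S0.
Qed.

End PullbackModel.

(** * Curvature in Euler coordinates *)

Section EulerCurvature.
Context {R : realType}.
Local Notation V := 'rV[R]_4.

(** The argument is compared as a natural number, so that an entry at a numeral index
is found by computation. *)
Definition vec4 (a b c d : R) (i : 'I_4) : R :=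
  match nat_of_ord i with 0%N => a | 1%N => b | 2%N => c | _ => d end.

Definition tab4 (a b c d : 'I_4 -> R) (i j : 'I_4) : R := vec4 (a j) (b j) (c j) (d j) i.

Lemma ord4_val : ((0 : 'I_4) = 0%N :> nat) * ((1 : 'I_4) = 1%N :> nat) *
  ((2 : 'I_4) = 2%N :> nat) * ((3 : 'I_4) = 3%N :> nat).
Proof. by []. Qed.

(** In the coordinates [(r, theta, phi, psi)], with [s = sin theta], [c = cos theta]
and [p] the value of [f ^ 2]: the metric, its inverse, and its derivatives in [r]
and [theta]. *)
Definition euler_g (r s c p : R) : 'I_4 -> 'I_4 -> R := tab4
  (vec4 p^-1 0 0 0)
  (vec4 0 (r ^+ 2 / 4) 0 0)
  (vec4 0 0 (r ^+ 2 * (s ^+ 2 + p * c ^+ 2) / 4) (r ^+ 2 * p * c / 4))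
  (vec4 0 0 (r ^+ 2 * p * c / 4) (r ^+ 2 * p / 4)).

Definition euler_ginv (r s c p : R) : 'I_4 -> 'I_4 -> R := tab4
  (vec4 p 0 0 0)
  (vec4 0 (4 / r ^+ 2) 0 0)
  (vec4 0 0 (4 / (r ^+ 2 * s ^+ 2)) (- (4 * c / (r ^+ 2 * s ^+ 2))))
  (vec4 0 0 (- (4 * c / (r ^+ 2 * s ^+ 2))) (4 / (r ^+ 2 * p) + 4 * c ^+ 2 / (r ^+ 2 * s ^+ 2))).

Definition euler_g_r (r s c p p1 : R) : 'I_4 -> 'I_4 -> R := tab4
  (vec4 (- (p1 / p ^+ 2)) 0 0 0)
  (vec4 0 (r / 2) 0 0)
  (vec4 0 0 (r * (s ^+ 2 + p * c ^+ 2) / 2 + r ^+ 2 * p1 * c ^+ 2 / 4)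
            ((2 * r * p + r ^+ 2 * p1) * c / 4))
  (vec4 0 0 ((2 * r * p + r ^+ 2 * p1) * c / 4) ((2 * r * p + r ^+ 2 * p1) / 4)).

Definition euler_g_theta (r s c p : R) : 'I_4 -> 'I_4 -> R := tab4
  (vec4 0 0 0 0)
  (vec4 0 0 0 0)
  (vec4 0 0 (r ^+ 2 * (2 * s * c - 2 * p * c * s) / 4) (- (r ^+ 2 * p * s / 4)))
  (vec4 0 0 (- (r ^+ 2 * p * s / 4)) 0).

(** The Christoffel symbols, listed by upper index, and their derivatives in [r]
and [theta]; [p1] and [p2] are the derivatives of [f ^ 2]. *)
Definition euler_gamma (r s c p p1 : R) (k i j : 'I_4) : R := vec4
  (tab4
    (vec4 (- (p1 / (2 * p))) 0 0 0)
    (vec4 0 (- (r * p / 4)) 0 0)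
    (vec4 0 0 (- (p * (r * (s ^+ 2 + p * c ^+ 2) / 4 + r ^+ 2 * p1 * c ^+ 2 / 8)))
              (- (p * (2 * r * p + r ^+ 2 * p1) * c / 8)))
    (vec4 0 0 (- (p * (2 * r * p + r ^+ 2 * p1) * c / 8))
              (- (p * (2 * r * p + r ^+ 2 * p1) / 8))) i j)
  (tab4
    (vec4 0 r^-1 0 0)
    (vec4 r^-1 0 0 0)
    (vec4 0 0 (- (s * c * (1 - p))) (p * s / 2))
    (vec4 0 0 (p * s / 2) 0) i j)
  (tab4
    (vec4 0 0 r^-1 0)
    (vec4 0 0 (c / s * (1 - p / 2)) (- (p / (2 * s))))
    (vec4 r^-1 (c / s * (1 - p / 2)) 0 0)
    (vec4 0 (- (p / (2 * s))) 0 0) i j)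
  (tab4
    (vec4 0 0 (c * p1 / (2 * p)) (r^-1 + p1 / (2 * p)))
    (vec4 0 0 (- (c ^+ 2 * (2 - p) / (2 * s)) - s / 2) (c * p / (2 * s)))
    (vec4 (c * p1 / (2 * p)) (- (c ^+ 2 * (2 - p) / (2 * s)) - s / 2) 0 0)
    (vec4 (r^-1 + p1 / (2 * p)) (c * p / (2 * s)) 0 0) i j) k.

Definition euler_gamma_r (r s c p p1 p2 : R) (k i j : 'I_4) : R :=
  let q := (2 * r * p + r ^+ 2 * p1) in
  let q1 := (2 * p + 4 * r * p1 + r ^+ 2 * p2) in
  let h := p2 / (2 * p) - p1 ^+ 2 / (2 * p ^+ 2) in vec4
  (tab4
    (vec4 (- h) 0 0 0)
    (vec4 0 (- ((p + r * p1) / 4)) 0 0)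
    (vec4 0 0 (- (p1 * (r * (s ^+ 2 + p * c ^+ 2) / 4 + r ^+ 2 * p1 * c ^+ 2 / 8)
                  + p * ((s ^+ 2 + p * c ^+ 2) / 4 + r * p1 * c ^+ 2 / 2
                         + r ^+ 2 * p2 * c ^+ 2 / 8)))
              (- ((p1 * q + p * q1) * c / 8)))
    (vec4 0 0 (- ((p1 * q + p * q1) * c / 8)) (- ((p1 * q + p * q1) / 8))) i j)
  (tab4
    (vec4 0 (- r ^- 2) 0 0)
    (vec4 (- r ^- 2) 0 0 0)
    (vec4 0 0 (s * c * p1) (p1 * s / 2))
    (vec4 0 0 (p1 * s / 2) 0) i j)
  (tab4
    (vec4 0 0 (- r ^- 2) 0)
    (vec4 0 0 (- (c / s * p1 / 2)) (- (p1 / (2 * s))))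
    (vec4 (- r ^- 2) (- (c / s * p1 / 2)) 0 0)
    (vec4 0 (- (p1 / (2 * s))) 0 0) i j)
  (tab4
    (vec4 0 0 (c * h) (- r ^- 2 + h))
    (vec4 0 0 (c ^+ 2 * p1 / (2 * s)) (c * p1 / (2 * s)))
    (vec4 (c * h) (c ^+ 2 * p1 / (2 * s)) 0 0)
    (vec4 (- r ^- 2 + h) (c * p1 / (2 * s)) 0 0) i j) k.

Definition euler_gamma_theta (r s c p p1 : R) (k i j : 'I_4) : R :=
  let q := (2 * r * p + r ^+ 2 * p1) in vec4
  (tab4
    (vec4 0 0 0 0)
    (vec4 0 0 0 0)
    (vec4 0 0 (- (p * (r * (2 * s * c - 2 * p * c * s) / 4 - r ^+ 2 * p1 * c * s / 4)))
              (p * q * s / 8))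
    (vec4 0 0 (p * q * s / 8) 0) i j)
  (tab4
    (vec4 0 0 0 0)
    (vec4 0 0 0 0)
    (vec4 0 0 (- ((c ^+ 2 - s ^+ 2) * (1 - p))) (p * c / 2))
    (vec4 0 0 (p * c / 2) 0) i j)
  (tab4
    (vec4 0 0 0 0)
    (vec4 0 0 (- ((1 + c ^+ 2 / s ^+ 2) * (1 - p / 2))) (p * c / (2 * s ^+ 2)))
    (vec4 0 (- ((1 + c ^+ 2 / s ^+ 2) * (1 - p / 2))) 0 0)
    (vec4 0 (p * c / (2 * s ^+ 2)) 0 0) i j)
  (tab4
    (vec4 0 0 (- (s * p1 / (2 * p))) 0)
    (vec4 0 0 (c * (2 - p) + c ^+ 3 * (2 - p) / (2 * s ^+ 2) - c / 2)
              (- ((1 + c ^+ 2 / s ^+ 2) * p / 2)))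
    (vec4 (- (s * p1 / (2 * p)))
          (c * (2 - p) + c ^+ 3 * (2 - p) / (2 * s ^+ 2) - c / 2) 0 0)
    (vec4 0 (- ((1 + c ^+ 2 / s ^+ 2) * p / 2)) 0 0) i j) k.

(** The two eigenvalues of the Ricci tensor, on the plane spanned by the directions of [r]
and [psi] and on its orthogonal complement. *)
Definition euler_ricci_fibre (r p1 p2 : R) : R := - (p2 / 2) - 5 * p1 / (2 * r).
Definition euler_ricci_base (r p p1 : R) : R := - (p1 / r) - 4 * (p - 1) / r ^+ 2.

Definition euler_ricci (r s c p p1 p2 : R) : 'I_4 -> 'I_4 -> R :=
  let a := euler_ricci_fibre r p1 p2 in let b := euler_ricci_base r p p1 in tab4
  (vec4 (a / p) 0 0 0)
  (vec4 0 (b * r ^+ 2 / 4) 0 0)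
  (vec4 0 0 (b * r ^+ 2 * s ^+ 2 / 4 + a * r ^+ 2 * p * c ^+ 2 / 4) (a * r ^+ 2 * p * c / 4))
  (vec4 0 0 (a * r ^+ 2 * p * c / 4) (a * r ^+ 2 * p / 4)).

Lemma euler_ginvP r s c p : r != 0 -> s != 0 -> p != 0 -> forall i j,
  \sum_k euler_g r s c p i k * euler_ginv r s c p k j = (i == j)%:R.
Proof.
move=> r0 s0 p0 i j; rewrite sum4 /euler_g /euler_ginv /tab4.
elim/ord4P: i; elim/ord4P: j; rewrite /vec4 !ord4_val /= ?(mul0r, mulr0, addr0, add0r) //=;
  by field; rewrite ?r0 ?s0 ?p0.
Qed.

Lemma euler_gamma_formula r s c p p1 : r != 0 -> s != 0 -> p != 0 ->
  c ^+ 2 = 1 - s ^+ 2 -> forall k i j,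
  let dg l i j := vec4 (euler_g_r r s c p p1 i j) (euler_g_theta r s c p i j) 0 0 l in
  2^-1 * \sum_l euler_ginv r s c p k l * (dg i j l + dg j i l - dg l i j) =
  euler_gamma r s c p p1 k i j.
Proof.
move=> r0 s0 p0 cs k i j dg; rewrite sum4 /dg /euler_ginv /euler_g_r /euler_g_theta
  /euler_gamma /tab4.
elim/ord4P: k; elim/ord4P: i; elim/ord4P: j;
  rewrite /vec4 !ord4_val /= ?(mul0r, mulr0, addr0, add0r, subr0, sub0r, oppr0) //;
  by field: cs; rewrite ?r0 ?s0 ?p0.
Qed.

Definition euler_gamma_d (r s c p p1 p2 : R) (l k i j : 'I_4) : R :=
  vec4 (euler_gamma_r r s c p p1 p2 k i j) (euler_gamma_theta r s c p p1 k i j) 0 0 l.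

Definition euler_ricci_sum (r s c p p1 p2 : R) (l j : 'I_4) : R :=
  let g := euler_gamma r s c p p1 in let dg := euler_gamma_d r s c p p1 p2 in
  \sum_k (dg k k j l - dg j k k l + \sum_m (g k k m * g m j l - g k j m * g m k l)).

Ltac euler_ricci_tac cs r0 s0 p0 :=
  rewrite /euler_ricci_sum sum4 !sum4 /euler_gamma_d /euler_gamma /euler_gamma_r
    /euler_gamma_theta /euler_ricci /euler_ricci_fibre /euler_ricci_base /tab4 /vec4 !ord4_val /=
    ?(mul0r, mulr0, addr0, add0r, subr0, sub0r, oppr0) //;
  by field: cs; rewrite ?r0 ?s0 ?p0.

Lemma euler_ricci00 r s c p p1 p2 : r != 0 -> s != 0 -> p != 0 -> c ^+ 2 = 1 - s ^+ 2 ->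
  euler_ricci_sum r s c p p1 p2 0 0 = euler_ricci r s c p p1 p2 0 0.
Proof. move=> r0 s0 p0 cs; euler_ricci_tac cs r0 s0 p0. Qed.

Lemma euler_ricci11 r s c p p1 p2 : r != 0 -> s != 0 -> p != 0 -> c ^+ 2 = 1 - s ^+ 2 ->
  euler_ricci_sum r s c p p1 p2 1 1 = euler_ricci r s c p p1 p2 1 1.
Proof. move=> r0 s0 p0 cs; euler_ricci_tac cs r0 s0 p0. Qed.

Lemma euler_ricci22 r s c p p1 p2 : r != 0 -> s != 0 -> p != 0 -> c ^+ 2 = 1 - s ^+ 2 ->
  euler_ricci_sum r s c p p1 p2 2 2 = euler_ricci r s c p p1 p2 2 2.
Proof. move=> r0 s0 p0 cs; euler_ricci_tac cs r0 s0 p0. Qed.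

Lemma euler_ricci23 r s c p p1 p2 : r != 0 -> s != 0 -> p != 0 -> c ^+ 2 = 1 - s ^+ 2 ->
  euler_ricci_sum r s c p p1 p2 2 3 = euler_ricci r s c p p1 p2 2 3.
Proof. move=> r0 s0 p0 cs; euler_ricci_tac cs r0 s0 p0. Qed.

Lemma euler_ricci32 r s c p p1 p2 : r != 0 -> s != 0 -> p != 0 -> c ^+ 2 = 1 - s ^+ 2 ->
  euler_ricci_sum r s c p p1 p2 3 2 = euler_ricci r s c p p1 p2 3 2.
Proof. move=> r0 s0 p0 cs; euler_ricci_tac cs r0 s0 p0. Qed.

Lemma euler_ricci33 r s c p p1 p2 : r != 0 -> s != 0 -> p != 0 -> c ^+ 2 = 1 - s ^+ 2 ->
  euler_ricci_sum r s c p p1 p2 3 3 = euler_ricci r s c p p1 p2 3 3.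
Proof. move=> r0 s0 p0 cs; euler_ricci_tac cs r0 s0 p0. Qed.

Lemma euler_scalar r s c p p1 p2 : r != 0 -> s != 0 -> p != 0 -> c ^+ 2 = 1 - s ^+ 2 ->
  \sum_i \sum_j euler_ginv r s c p i j * euler_ricci_sum r s c p p1 p2 i j =
  - (p2 + 7 * p1 / r + 8 * (p - 1) / r ^+ 2).
Proof.
move=> r0 s0 p0 cs.
transitivity (\sum_i \sum_j euler_ginv r s c p i j * euler_ricci r s c p p1 p2 i j).
  apply: eq_bigr => i _; apply: eq_bigr => j _.
  elim/ord4P: i; elim/ord4P: j;
    rewrite ?euler_ricci00 ?euler_ricci11 ?euler_ricci22 ?euler_ricci23 ?euler_ricci32
      ?euler_ricci33 // /euler_ginv /tab4 /vec4 !ord4_val /= !mul0r //.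
rewrite sum4 !sum4 /euler_ginv /euler_ricci /euler_ricci_fibre /euler_ricci_base /tab4 /vec4 !ord4_val /=.
rewrite ?(mul0r, mulr0, addr0, add0r).
by field: cs; rewrite ?r0 ?s0 ?p0.
Qed.

End EulerCurvature.

Section EulerGradients.
Context {R : realType}.
Local Notation V := 'rV[R]_4.
Variables (fr fs fc fp fp1 : V -> R) (x : V) (p2 : R).
Hypotheses (gr : grad fr x (row4 1 0 0 0 0)) (gs : grad fs x (row4 0 (fc x) 0 0 0))
  (gc : grad fc x (row4 0 (- fs x) 0 0 0)) (gp : grad fp x (row4 (fp1 x) 0 0 0 0))
  (gp1 : grad fp1 x (row4 p2 0 0 0 0)).
Hypotheses (r0 : fr x != 0) (s0 : fs x != 0) (p0 : fp x != 0).

Let p20 : 2 * fp x != 0. Proof. by rewrite mulf_neq0 // pnatr_eq0. Qed.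
Let s20 : 2 * fs x != 0. Proof. by rewrite mulf_neq0 // pnatr_eq0. Qed.
Let r20 : fr x ^+ 2 != 0. Proof. exact: expf_neq0. Qed.

Ltac grad_step := first [exact: gr | exact: gs | exact: gc | exact: gp | exact: gp1
  | exact: grad_cst | eapply gradD | eapply gradN | eapply gradM
  | eapply gradV; [first [exact: r0 | exact: s0 | exact: p0 | exact: p20 | exact: s20
                         | exact: r20 | by rewrite pnatr_eq0] |]
  | eapply gradX].
Ltac grad_entry := rewrite /vec4 !ord4_val /=; (eapply grad_eq; first by repeat grad_step).

Lemma grad_euler_g i j :
  grad (fun z => euler_g (fr z) (fs z) (fc z) (fp z) i j) x
    (fun l => vec4 (euler_g_r (fr x) (fs x) (fc x) (fp x) (fp1 x) i j)
                   (euler_g_theta (fr x) (fs x) (fc x) (fp x) i j) 0 0 l).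
Proof.
rewrite /euler_g /euler_g_r /euler_g_theta /tab4.
by elim/ord4P: i; elim/ord4P: j; grad_entry; elim/ord4P; rewrite ?row4s !ord4_val /=;
  field; rewrite ?r0 ?s0 ?p0.
Qed.

Lemma grad_euler_gamma k i j :
  grad (fun z => euler_gamma (fr z) (fs z) (fc z) (fp z) (fp1 z) k i j) x
    (fun l => euler_gamma_d (fr x) (fs x) (fc x) (fp x) (fp1 x) p2 l k i j).
Proof.
rewrite /euler_gamma_d /euler_gamma /euler_gamma_r /euler_gamma_theta /tab4.
by elim/ord4P: k; elim/ord4P: i; elim/ord4P: j; grad_entry; elim/ord4P; rewrite ?row4s !ord4_val /=;
  field; rewrite ?r0 ?s0 ?p0.
Qed.

End EulerGradients.

Section EulerScalar.
Context {R : realType}.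
Local Notation V := 'rV[R]_4.
Variables (U : set V) (P P1 P2 : R -> R).
Hypotheses (oU : open U)
  (P_d : forall x : V, U x -> is_derive (x 0 0 : R) (1 : R) P (P1 (x 0 0)))
  (P1_d : forall x : V, U x -> is_derive (x 0 0 : R) (1 : R) P1 (P2 (x 0 0)))
  (P_neq0 : forall x : V, U x -> P (x 0 0) != 0)
  (r_neq0 : forall x : V, U x -> x 0 0 != 0)
  (s_neq0 : forall x : V, U x -> sin (x 0 1) != 0).

Let fr (z : V) := z 0 0.
Let fs (z : V) := sin (z 0 1).
Let fc (z : V) := cos (z 0 1).
Let fp (z : V) := P (z 0 0).
Let fp1 (z : V) := P1 (z 0 0).
Definition euler_metric (z : V) : 'M[R]_4 :=
  \matrix_(i, j) euler_g (z 0 0) (sin (z 0 1)) (cos (z 0 1)) (P (z 0 0)) i j.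

Let gr x : grad fr x (row4 1 0 0 0 0).
Proof. exact: grad_coord0. Qed.
Let gs x : grad fs x (row4 0 (fc x) 0 0 0).
Proof.
apply: grad_eq (grad_sin (grad_coord1 x)) _.
by elim/ord4P; rewrite !row4s ?mulr0 ?mulr1.
Qed.
Let gc x : grad fc x (row4 0 (- fs x) 0 0 0).
Proof.
apply: grad_eq (grad_cos (grad_coord1 x)) _.
by elim/ord4P; rewrite !row4s ?mulr0 ?mulr1.
Qed.
Let gp x : U x -> grad fp x (row4 (fp1 x) 0 0 0 0).
Proof.
move=> xU; apply: grad_eq (grad_comp (P_d xU) (grad_coord0 x)) _.
by elim/ord4P; rewrite !row4s ?mulr0 ?mulr1.
Qed.
Let gp1 x : U x -> grad fp1 x (row4 (P2 (x 0 0)) 0 0 0 0).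
Proof.
move=> xU; apply: grad_eq (grad_comp (P1_d xU) (grad_coord0 x)) _.
by elim/ord4P; rewrite !row4s ?mulr0 ?mulr1.
Qed.

Let cs x : fc x ^+ 2 = 1 - fs x ^+ 2.
Proof. by rewrite /fc /fs -(cos2Dsin2 (x 0 1)) addrK. Qed.

Lemma euler_metric_inv x : U x -> euler_metric x \in unitmx /\
  invmx (euler_metric x) =
  \matrix_(i, j) euler_ginv (x 0 0) (sin (x 0 1)) (cos (x 0 1)) (P (x 0 0)) i j.
Proof.
move=> xU; set H := \matrix_(i, j) euler_ginv _ _ _ _ i j.
have GH : euler_metric x *m H = 1%:M.
  apply/matrixP => i j; rewrite !mxE -(euler_ginvP (cos (x 0 1)) (r_neq0 xU) (s_neq0 xU) (P_neq0 xU)).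
  by apply: eq_bigr => k _; rewrite !mxE.
have [uG _] := mulmx1_unit GH; split=> //.
by rewrite -[LHS]mulmx1 -GH mulmxA mulVmx // mul1mx.
Qed.

Lemma euler_christoffel k i j x : U x -> christoffel euler_metric k i j x =
  euler_gamma (fr x) (fs x) (fc x) (fp x) (fp1 x) k i j.
Proof.
move=> xU.
rewrite -(euler_gamma_formula (fp1 x) (r_neq0 xU) (s_neq0 xU) (P_neq0 xU) (cs x)).
rewrite /christoffel; congr (_ * _); apply: eq_bigr => l _.
have [_ ->] := euler_metric_inv xU; rewrite mxE; congr (_ * _).
have gE a b m : partial m (fun y => euler_metric y a b) x =
    vec4 (euler_g_r (fr x) (fs x) (fc x) (fp x) (fp1 x) a b)
                   (euler_g_theta (fr x) (fs x) (fc x) (fp x) a b) 0 0 m.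
  have [_ <-] := grad_euler_g (gr x) (gs x) (gc x) (gp xU) (P_neq0 xU) a b.
  by apply: partial_near; apply: filterE => z; rewrite /euler_metric mxE.
by rewrite !gE.
Qed.

Lemma euler_scalar_curvature x : U x -> scalar_curvature_in euler_metric x =
  - (P2 (x 0 0) + 7 * P1 (x 0 0) / x 0 0 + 8 * (P (x 0 0) - 1) / x 0 0 ^+ 2).
Proof.
move=> xU.
rewrite -(euler_scalar (P1 (x 0 0)) (P2 (x 0 0)) (r_neq0 xU) (s_neq0 xU) (P_neq0 xU) (cs x)).
have [_ iE] := euler_metric_inv xU.
rewrite /scalar_curvature_in; apply: eq_bigr => l _; apply: eq_bigr => j _.
rewrite iE mxE; congr (_ * _).
rewrite /ricci /euler_ricci_sum; apply: eq_bigr => k _.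
have gE m a b d : partial m (christoffel euler_metric a b d) x =
    euler_gamma_d (fr x) (fs x) (fc x) (fp x) (fp1 x) (P2 (x 0 0)) m a b d.
  have [_ <-] := grad_euler_gamma (gr x) (gs x) (gc x) (gp xU) (gp1 xU)
    (r_neq0 xU) (s_neq0 xU) (P_neq0 xU) a b d.
  apply: partial_near; move: (open_nbhs_nbhs (conj oU xU)); apply: filterS => z zU.
  exact: euler_christoffel.
rewrite /riemann !gE; congr (_ + _).
by apply: eq_bigr => m _; rewrite !euler_christoffel.
Qed.

End EulerScalar.

(** * Euler coordinates in a trivialization *)

Section EulerChart.
Context {R : realType} (n : nat) (B r0 : R).
Local Notation V := 'rV[R]_4.
Hypotheses (n0 : (0 < n)%N) (B0 : 0 < B) (r00 : 0 < r0).
Let x0 : R := r0 ^+ 2.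
Local Notation mm := (model_metric n B x0).

Definition half_tan (y : V) : R := sin (y 0 1 / 2) / cos (y 0 1 / 2).
Definition fibre_radius (y : V) : R := Num.sqrt (y 0 0 ^+ 2 - r0 ^+ 2).
Definition fibre_angle (y : V) : R := n%:R * ((y 0 3 + y 0 2) / 2).

(** The point with Euler coordinates [y] in the trivialization over
[z2 / z1 = tan (theta / 2) exp (- i phi)]. *)
Definition euler_chart (y : V) : V :=
  row4 (half_tan y * cos (y 0 2)) (half_tan y * - sin (y 0 2))
       (fibre_radius y * cos (fibre_angle y)) (fibre_radius y * sin (fibre_angle y)).

(** The function [f ^ 2], with the factor that vanishes at the bolt split off. *)
Definition bolt_profile (r : R) : R :=
  (r ^+ 2 - r0 ^+ 2) * radial n B (r0 ^+ 2) (r ^+ 2 - r0 ^+ 2) / r ^+ 4.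

Let U : set V := euler_regular r0.

Lemma euler_regular_open : open (euler_regular r0 : set V).
Proof.
have -> : euler_regular r0 = (fun y : V => y 0 0) @^-1` [set s : R | r0 < s] `&`
    ((fun y : V => y 0 1) @^-1` [set s : R | 0 < s] `&`
     (fun y : V => y 0 1) @^-1` [set s : R | s < pi]).
  by apply/seteqP; split=> y; rewrite /euler_regular /=; [move=> [? /andP[? ?]] |
    move=> [? [? ?]]; split=> //; apply/andP].
apply: openI; first by apply: open_comp; [move=> y _; exact: coord_continuous | exact: open_gt].
apply: openI; (apply: open_comp; first by move=> y _; exact: coord_continuous).
  exact: open_gt.
exact: open_lt.
Qed.

Lemma regular_r y : U y -> 0 < y 0 0.
Proof. by move=> [yr _]; exact: lt_trans yr. Qed.

Lemma regular_t y : U y -> 0 < y 0 0 ^+ 2 - r0 ^+ 2.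
Proof. by move=> [yr _]; rewrite subr_gt0 ltr_pXn2r ?nnegrE ?ltW // (lt_trans r00 yr). Qed.

Lemma regular_sin y : U y -> 0 < sin (y 0 1).
Proof. by move=> [_ yt]; apply: sin_gt0_pi. Qed.

Lemma regular_half y : U y -> 0 < cos (y 0 1 / 2) /\ 0 < sin (y 0 1 / 2).
Proof.
move=> [_ /andP[t0 tp]]; rewrite /coord_theta in t0 tp.
have pi0 : 0 < pi :> R := pi_gt0 R.
split; last by apply: sin_gt0_pi; apply/andP; split; lra.
by apply: cos_gt0_pihalf; apply/andP; split; lra.
Qed.

Lemma smooth_half_tan : smooth_on U half_tan.
Proof.
have oU := euler_regular_open.
have sh : smooth_on U (fun y => y 0 1 / 2).
  by apply: (smoothM oU); [exact: smooth_coord | exact: smooth_cst].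
apply: (smoothM oU); first exact: smooth_sin.
apply: smoothV => //; last exact: smooth_cos.
by move=> y yU; rewrite gt_eqF //; case: (regular_half yU).
Qed.

Lemma smooth_fibre_radius : smooth_on U fibre_radius.
Proof.
have oU := euler_regular_open.
apply: smooth_sqrt => //; first by move=> y; exact: regular_t.
apply: (smoothB oU); last exact: smooth_cst.
by apply: smoothX => //; exact: smooth_coord.
Qed.

Lemma smooth_euler_chart : smooth_on U euler_chart.
Proof.
have oU := euler_regular_open.
have sf := smooth_coord oU (2 : 'I_4).
have sa : smooth_on U fibre_angle.
  apply: (smoothM oU); first exact: smooth_cst.
  apply: (smoothM oU); last exact: smooth_cst.
  by apply: (smoothD oU); exact: smooth_coord.
have sT := smooth_half_tan; have sr := smooth_fibre_radius.
apply: (smooth_row4 oU); apply: (smoothM oU) => //.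
- exact: smooth_cos.
- by apply: (smoothN oU); exact: smooth_sin.
- exact: smooth_cos.
- exact: smooth_sin.
Qed.

Lemma grad_half_tan y : U y ->
  grad half_tan y (row4 0 (2 * cos (y 0 1 / 2) ^+ 2)^-1 0 0 0).
Proof.
move=> yU; have [c0 _] := regular_half yU.
have gh : grad (fun z : V => z 0 1 / 2) y (row4 0 2^-1 0 0 0).
  apply: grad_eq (gradM (grad_coord1 y) (grad_cst 2^-1 y)) _.
  by elim/ord4P; rewrite !row4s ?(mul0r, mulr0, addr0, mul1r).
have c1 : cos (y 0 1 / 2) != 0 by rewrite gt_eqF.
apply: grad_eq (gradM (grad_sin gh) (gradV (f := fun z : V => cos (z 0 1 / 2)) c1 (grad_cos gh))) _.
have := cos2Dsin2 (y 0 1 / 2); move: (cos _) (sin _) c1 => c s c1 /= cs.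
have sE : s ^+ 2 = 1 - c ^+ 2 by rewrite -cs addrAC subrr add0r.
elim/ord4P; rewrite !row4s ?(mul0r, mulr0, addr0) //.
by field: sE.
Qed.

Lemma grad_fibre_radius y : U y ->
  grad fibre_radius y (row4 (y 0 0 / fibre_radius y) 0 0 0 0).
Proof.
move=> yU; have t0 := regular_t yU.
have g := gradB (gradX 2 (grad_coord0 y)) (grad_cst (r0 ^+ 2) y).
apply: grad_eq (grad_sqrt t0 g) _; rewrite -/(fibre_radius y).
have : fibre_radius y != 0 by rewrite gt_eqF // sqrtr_gt0.
move: (fibre_radius y) => r rr.
by elim/ord4P; rewrite !row4s ?(mul0r, mulr0, subr0, addr0) //=; field.
Qed.

Lemma grad_fibre_angle y : grad fibre_angle y (row4 0 0 (n%:R / 2) (n%:R / 2) 0).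
Proof.
apply: grad_eq (gradM (grad_cst n%:R y) (gradM (gradD (grad_coord3 y) (grad_coord2 y))
  (grad_cst 2^-1 y))) _.
by elim/ord4P; rewrite !row4s; ring.
Qed.

(** The phase of the fibre coordinate rotates the pair of covectors; in the rotated frame
they are multiples of [dr] and of [sigma3]. The base contributes
[sigma1 ^ 2 + sigma2 ^ 2], which does not depend on [psi]. *)
Lemma euler_chart_pullback y : U y ->
  pullback euler_chart mm y = euler_metric bolt_profile y.
Proof.
move=> yU; have t0 := regular_t yU; have yr := regular_r yU.
have [c0 s0] := regular_half yU.
pose rho := fibre_radius y; pose chi := fibre_angle y.
have rho0 : rho != 0 by rewrite gt_eqF // sqrtr_gt0.
have rhoE : rho ^+ 2 = y 0 0 ^+ 2 - r0 ^+ 2 by rewrite sqr_sqrtr // ltW.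
have gT := grad_half_tan yU; have gr := grad_fibre_radius yU.
have ga := grad_fibre_angle y.
have [dF FE] := grad_row4 (gradM gT (grad_cos (grad_coord2 y)))
  (gradM gT (gradN (grad_sin (grad_coord2 y))))
  (gradM gr (grad_cos ga)) (gradM gr (grad_sin ga)).
rewrite -/euler_chart in dF FE.
have cs : cos chi ^+ 2 + sin chi ^+ 2 = 1 by exact: cos2Dsin2.
have csf : cos (y 0 2) ^+ 2 + sin (y 0 2) ^+ 2 = 1 by exact: cos2Dsin2.
have csh : cos (y 0 1 / 2) ^+ 2 + sin (y 0 1 / 2) ^+ 2 = 1 by exact: cos2Dsin2.
have thE : y 0 1 = y 0 1 / 2 *+ 2 by rewrite mulr2n -splitr.
have sinE : sin (y 0 1) = 2 * (cos (y 0 1 / 2) * sin (y 0 1 / 2)).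
  by rewrite [in LHS]thE sin_mulr2n mulr_natl [X in X *+ _]mulrC.
have cosE : cos (y 0 1) = 2 * cos (y 0 1 / 2) ^+ 2 - 1.
  by rewrite [in LHS]thE cos_mulr2n mulr_natl.
have c1 : cos (y 0 1 / 2) != 0 by rewrite gt_eqF.
have sE : sin (y 0 1 / 2) ^+ 2 = 1 - cos (y 0 1 / 2) ^+ 2.
  by rewrite -[X in X - _]csh addrAC subrr add0r.
have base_eq : base2 (euler_chart y) = (cos (y 0 1 / 2) ^+ 2)^-1.
  rewrite /base2 /euler_chart !row4s /half_tan.
  transitivity (1 + (sin (y 0 1 / 2) / cos (y 0 1 / 2)) ^+ 2 *
    (cos (y 0 2) ^+ 2 + sin (y 0 2) ^+ 2)); first by ring.
  by rewrite csf mulr1 expr_div_n sE; field.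
have fibre_eq : fibre2 (euler_chart y) = y 0 0 ^+ 2 - r0 ^+ 2.
  rewrite /fibre2 /euler_chart !row4s -rhoE -/rho -/chi.
  transitivity (rho ^+ 2 * (cos chi ^+ 2 + sin chi ^+ 2)); first by ring.
  by rewrite cs mulr1.
pose U1 := row4 (y 0 0 / rho) 0 0 0 0.
pose U2 := row4 0 0 (rho * n%:R * cos (y 0 1) / 2) (rho * n%:R / 2) 0.
have P1E k : (fibre_covector1 n (euler_chart y) *m ('J euler_chart y)^T) 0 k =
    cos chi * U1 k - sin chi * U2 k.
  rewrite FE /fibre_covector1 base_eq /euler_chart !row4s -/rho -/chi /half_tan /U1 /U2 cosE.
  move: csf; move: (cos (y 0 2)) (sin (y 0 2)) => cf sf csf.
  have sfE : sf ^+ 2 = 1 - cf ^+ 2 by rewrite -[X in X - _]csf addrAC subrr add0r.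
  move: (cos (y 0 1 / 2)) (sin (y 0 1 / 2)) c1 sE => a b a0 bE.
  by elim/ord4P: k; rewrite !row4s; field: sfE bE; rewrite ?a0 ?rho0.
have P2E k : (fibre_covector2 n (euler_chart y) *m ('J euler_chart y)^T) 0 k =
    sin chi * U1 k + cos chi * U2 k.
  rewrite FE /fibre_covector2 base_eq /euler_chart !row4s -/rho -/chi /half_tan /U1 /U2 cosE.
  move: csf; move: (cos (y 0 2)) (sin (y 0 2)) => cf sf csf.
  have sfE : sf ^+ 2 = 1 - cf ^+ 2 by rewrite -[X in X - _]csf addrAC subrr add0r.
  move: (cos (y 0 1 / 2)) (sin (y 0 1 / 2)) c1 sE => a b a0 bE.
  by elim/ord4P: k; rewrite !row4s; field: sfE bE; rewrite ?a0 ?rho0.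
have rot k l := fibre_rotation rho 0 cs P1E P2E k l.
have baseE k l : (row4 1 0 0 0 *m ('J euler_chart y)^T) 0 k * (row4 1 0 0 0 *m ('J euler_chart y)^T) 0 l
   + (row4 0 1 0 0 *m ('J euler_chart y)^T) 0 k * (row4 0 1 0 0 *m ('J euler_chart y)^T) 0 l =
   (cos (y 0 1 / 2) ^+ 4)^-1 * (row4 0 2^-1 0 0 0 k * row4 0 2^-1 0 0 0 l +
     row4 0 0 (sin (y 0 1) / 2) 0 0 k * row4 0 0 (sin (y 0 1) / 2) 0 0 l).
  rewrite !FE !row4s sinE /half_tan.
  move: csf; move: (cos (y 0 2)) (sin (y 0 2)) => cf sf csf.
  have sfE : sf ^+ 2 = 1 - cf ^+ 2 by rewrite -[X in X - _]csf addrAC subrr add0r.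
  move: (cos (y 0 1 / 2)) (sin (y 0 1 / 2)) c1 sE => a b a0 bE.
  by elim/ord4P: k; elim/ord4P: l; rewrite !row4s; field: sfE bE; rewrite ?a0.
apply/matrixP => i j; rewrite pullback_modelE baseE fibre_eq.
have -> : euler_chart y 0 2 = rho * cos chi - 0 * sin chi.
  by rewrite /euler_chart row4s mul0r subr0.
have -> : euler_chart y 0 3 = rho * sin chi + 0 * cos chi.
  by rewrite /euler_chart row4s mul0r addr0.
have [-> ->] := rot i j; have [_ ->] := rot j i.
rewrite base_eq /euler_metric mxE /bolt_profile.
pose t := y 0 0 ^+ 2 - r0 ^+ 2; rewrite -/t.
have t0' : 0 <= t by exact: ltW.
have Q0 := radial_gt0 n0 B0 (exprn_gt0 2 r00) t0'.
have abE := coef_sum n0 B0 (exprn_gt0 2 r00) t0'.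
have yE : r0 ^+ 2 + t = y 0 0 ^+ 2 by rewrite /t addrC subrK.
have aE : coef_fibre n B x0 t = y 0 0 ^+ 2 / radial n B (r0 ^+ 2) t by rewrite /coef_fibre /x0 yE.
have csE : cos (y 0 1) ^+ 2 = 1 - sin (y 0 1) ^+ 2 by rewrite -(cos2Dsin2 (y 0 1)) addrK.
have U12 : coef_fibre n B x0 t * (U1 i * U1 j + U2 i * U2 j) + coef_angle n B x0 t *
    ((rho * U2 i - 0 * U1 i) * (rho * U2 j - 0 * U1 j)) =
  coef_fibre n B x0 t * (U1 i * U1 j) +
  (coef_fibre n B x0 t + coef_angle n B x0 t * t) * (U2 i * U2 j).
  by rewrite /t -rhoE; ring.
rewrite U12 -/x0 in abE *; rewrite abE yE aE /U1 /U2 -/x0.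
move: (radial n B x0 t) Q0 => Q /gt_eqF/negbT Q0.
have rhoE' : rho ^+ 2 = t by [].
have tn : t != 0 by rewrite gt_eqF.
have yn : y 0 0 != 0 by rewrite gt_eqF.
have nn : n%:R != 0 :> R by rewrite pnatr_eq0 -lt0n.
move: (y 0 0) (cos (y 0 1)) (sin (y 0 1)) (cos (y 0 1 / 2)) yn csE c1 => r c s a yn csE c1.
rewrite /euler_g /tab4 /vec4.
clear U12; rewrite -!rhoE'; move: (rho) rho0 (n%:R) nn => rho' rho0' m nn.
by elim/ord4P: i; elim/ord4P: j; rewrite !row4s !ord4_val /=; field: csE; rewrite ?Q0 ?yn ?c1 ?nn ?rho0'.
Qed.

End EulerChart.

(** * The constants of the bolt *)

Section BoltConstants.
Context {R : realType} (n : nat) (B C : R).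
Hypotheses (B0 : 0 < B) (n3 : (3 <= n)%N) (CB : C <= (n%:R - 2) ^+ 2 / (12 * B)).

Let disc_ge0 : 0 <= (n%:R - 2) ^+ 2 - 12 * B * C.
Proof.
have b0 : 0 < 12 * B by rewrite mulr_gt0.
by rewrite subr_ge0 mulrC -ler_pdivlMr.
Qed.

Let s := Num.sqrt ((n%:R - 2) ^+ 2 - 12 * B * C).
Let s2 : s ^+ 2 = (n%:R - 2) ^+ 2 - 12 * B * C.
Proof. exact: sqr_sqrtr. Qed.
Let r2 : R := (n%:R - 2 + s) / (6 * B).

Let r2_gt0 : 0 < r2.
Proof.
have n2 : 3 <= n%:R :> R by rewrite ler_nat.
have s0 : 0 <= s by exact: sqrtr_ge0.
by rewrite divr_gt0 ?mulr_gt0 //; move: (s) s0 (n%:R) n2 => a a0 b b0; lra.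
Qed.

Lemma bolt_radius_gt0 : 0 < bolt_radius n B C.
Proof. by rewrite /bolt_radius sqrtr_gt0; exact: r2_gt0. Qed.

Let r2E : bolt_radius n B C ^+ 2 = r2.
Proof. by rewrite /bolt_radius sqr_sqrtr // ltW // r2_gt0. Qed.

Let sE : s = 6 * B * r2 - (n%:R - 2).
Proof.
have b0 : B != 0 by rewrite gt_eqF.
by rewrite /r2; move: (s) => a; field.
Qed.

(** The square of [r0] is the larger root of [3 * B * x ^ 2 - (n - 2) * x + C]. *)
Lemma bolt_C : C = (n%:R - 2) * bolt_radius n B C ^+ 2 - 3 * B * bolt_radius n B C ^+ 4.
Proof.
have b0 : 12 * B != 0 by rewrite mulf_neq0 ?pnatr_eq0 // gt_eqF.
rewrite -[4%N]/(2 * 2)%N exprM r2E; apply: (mulfI b0).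
have -> : 12 * B * C = (n%:R - 2) ^+ 2 - s ^+ 2 by rewrite s2 subKr.
by rewrite sE; move: (r2) (n%:R) => x m; ring.
Qed.

(** This is the condition [f r0 = 0], once [C] is expressed by [r0]. *)
Lemma bolt_AE : bolt_A n B C =
  (1 - n%:R) * bolt_radius n B C ^+ 4 + 2 * B * bolt_radius n B C ^+ 6.
Proof.
rewrite /bolt_A -/s -[4%N]/(2 * 2)%N -[6%N]/(2 * 3)%N !exprM r2E sE.
by move: (r2) (n%:R) => x m; field.
Qed.

End BoltConstants.

Lemma is_derive_scale {R : realType} (c : R) (f : R -> R) (t df : R) :
  is_derive t (1 : R) f df -> is_derive t (1 : R) (fun s => c * f s) (c * df).
Proof.
move=> hf; have hc : is_derive t (1 : R) (fun=> c) 0 by exact: is_derive_cst.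
by have := is_derive_mulr hc hf; rewrite mul0r add0r.
Qed.

Lemma is_derive_addr {R : realType} (f g : R -> R) (t df dg : R) :
  is_derive t (1 : R) f df -> is_derive t (1 : R) g dg ->
  is_derive t (1 : R) (fun s => f s + g s) (df + dg).
Proof. by move=> hf hg; exact: is_deriveD. Qed.

Lemma is_derive_pow {R : realType} k (r : R) :
  is_derive r (1 : R) (fun r : R => r ^+ k) (k%:R * r ^+ k.-1).
Proof. by split; [exact: exprn_derivable | rewrite exp_derive; exact: mulr1]. Qed.

Lemma is_derive_powV {R : realType} k (r : R) : r != 0 ->
  is_derive r (1 : R) (fun r : R => (r ^+ k)^-1) (- (k%:R / r ^+ k.+1)).
Proof.
move=> rn; apply: is_derive_eq.
  by apply: is_deriveV; [exact: expf_neq0 | exact: is_derive_pow].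
change (- (r ^+ k) ^- 2 * (k%:R * r ^+ k.-1) = - (k%:R / r ^+ k.+1)).
case: k => [|k]; first by rewrite !mul0r !mulr0 oppr0.
by rewrite mulNr [k.+1.-1]/= !exprS; field; rewrite rn expf_neq0.
Qed.

Section MetricExpression.
Context {R : realType} (n : nat) (B r0 A C : R).
Local Notation V := 'rV[R]_4.
Hypotheses (n0 : (0 < n)%N) (B0 : 0 < B) (r00 : 0 < r0).
Hypotheses (CE : C = (n%:R - 2) * r0 ^+ 2 - 3 * B * r0 ^+ 4)
  (AE : A = (1 - n%:R) * r0 ^+ 4 + 2 * B * r0 ^+ 6).

Lemma bolt_profileE r : r != 0 ->
  bolt_profile n B r0 r = 1 + C / r ^+ 2 + A / r ^+ 4 + B * r ^+ 2.
Proof. by move=> rn0; rewrite /bolt_profile /radial CE AE; field. Qed.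

Lemma bolt_profile_gt0 r : r0 < r -> 0 < bolt_profile n B r0 r.
Proof.
move=> rr; have t0 : 0 < r ^+ 2 - r0 ^+ 2.
  by rewrite subr_gt0 ltr_pXn2r // nnegrE ltW // (lt_trans r00 rr).
by rewrite divr_gt0 ?exprn_gt0 ?(lt_trans r00 rr) // mulr_gt0 // radial_gt0 ?ltW ?exprn_gt0.
Qed.

Lemma g_matrixE (y : V) : euler_regular r0 y ->
  g_matrix A B C y = euler_metric (bolt_profile n B r0) y.
Proof.
move=> yU; have yr := regular_r r00 yU; have yn : y 0 0 != 0 by rewrite gt_eqF.
have p0 : 0 < bolt_profile n B r0 (y 0 0) by apply: bolt_profile_gt0; case: yU.
have fE : profile A B C (y 0 0) ^+ 2 = bolt_profile n B r0 (y 0 0).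
  by rewrite /profile -bolt_profileE // sqr_sqrtr // ltW.
apply/matrixP => i j; rewrite /g_matrix /coord_r fE.
have addE (X Y : 'M[R]_4) : (X + Y) i j = X i j + Y i j by rewrite mxE.
have scaleE a (X : 'M[R]_4) : (a *: X) i j = a * X i j by rewrite mxE.
have rE a (w : V) k : (a *: w) 0 k = a * w 0 k by rewrite mxE.
rewrite !(addE, scaleE) !sqformE /sigma1 /sigma2 /sigma3 /d_r /coord_theta /coord_psi !rE.
rewrite /euler_metric mxE /euler_g /tab4 /vec4.
have := cos2Dsin2 (y 0 3); move: (bolt_profile n B r0 (y 0 0)) p0 => p /gt_eqF/negbT p0.
move: (y 0 0) yn (cos (y 0 1)) (sin (y 0 1)) (cos (y 0 3)) (sin (y 0 3)) => r rn c s a b ab.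
have bE : b ^+ 2 = 1 - a ^+ 2 by rewrite -[X in X - _]ab addrAC subrr add0r.
clear addE scaleE; by elim/ord4P: i; elim/ord4P: j; rewrite !row4s !ord4_val /=; field: bE; rewrite ?rn ?p0.
Qed.

Let sin_neq0 (y : V) : euler_regular r0 y -> sin (y 0 1) != 0.
Proof. by move=> yU; rewrite gt_eqF // (regular_sin yU). Qed.
Let r_neq0 (y : V) : euler_regular r0 y -> y 0 0 != 0.
Proof. by move=> yU; rewrite gt_eqF // (regular_r r00 yU). Qed.
Let P_neq0 (y : V) : euler_regular r0 y -> bolt_profile n B r0 (y 0 0) != 0.
Proof. by move=> yU; rewrite gt_eqF // bolt_profile_gt0 //; case: yU. Qed.

Lemma euler_metric_unit (y : V) : euler_regular r0 y ->
  euler_metric (bolt_profile n B r0) y \in unitmx.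
Proof.
have oU := @euler_regular_open R r0.
by move=> yU; case: (euler_metric_inv P_neq0 r_neq0 sin_neq0 yU).
Qed.

Lemma euler_metric_scalar (y : V) : euler_regular r0 y ->
  scalar_curvature_in (euler_metric (bolt_profile n B r0)) y = - (24 * B).
Proof.
move=> yU; have oU := @euler_regular_open R r0.
pose P1 r := - (2 * C) / r ^+ 3 + - (4 * A) / r ^+ 5 + 2 * B * r.
pose P2 r := 6 * C / r ^+ 4 + 20 * A / r ^+ 6 + 2 * B.
have P_d z : euler_regular r0 z ->
    is_derive (z 0 0 : R) (1 : R) (bolt_profile n B r0) (P1 (z 0 0)).
  move=> zU; have z0 := r_neq0 zU.
  apply: (@near_eq_is_derive _ _ _ (fun r : R => 1 + C / r ^+ 2 + A / r ^+ 4 + B * r ^+ 2)).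
    move: (open_nbhs_nbhs (conj (@open_neq R 0) z0)); apply: filterS => r r0'.
    by rewrite bolt_profileE.
  have d0 : is_derive (z 0 0 : R) (1 : R) (fun=> 1 : R) 0 by exact: is_derive_cst.
  apply: is_derive_eq (is_derive_addr (is_derive_addr (is_derive_addr d0
    (is_derive_scale C (is_derive_powV 2 z0))) (is_derive_scale A (is_derive_powV 4 z0)))
    (is_derive_scale B (is_derive_pow 2 (z 0 0)))) _.
  by rewrite /P1 /=; field.
have P1_d z : euler_regular r0 z -> is_derive (z 0 0 : R) (1 : R) P1 (P2 (z 0 0)).
  move=> zU; have z0 := r_neq0 zU; rewrite /P1.
  have d1 : is_derive (z 0 0 : R) (1 : R) (fun r : R => r) 1 by exact: is_derive_id.
  apply: is_derive_eq (is_derive_addr (is_derive_addr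
    (is_derive_scale (- (2 * C)) (is_derive_powV 3 z0))
    (is_derive_scale (- (4 * A)) (is_derive_powV 5 z0))) (is_derive_scale (2 * B) d1)) _.
  by rewrite /P2 /=; field.
have z0 := r_neq0 yU.
rewrite (euler_scalar_curvature oU P_d P1_d P_neq0 r_neq0 sin_neq0 yU) bolt_profileE //.
by rewrite /P1 /P2; field.
Qed.

End MetricExpression.

(** * Subspaces of finite-dimensional spaces *)

Section Continuity.
Context {R : realType}.

Lemma continuous_rV {T : topologicalType} {d : nat} (f : T -> 'rV[R]_d) (t : T) :
  (forall j, {for t, continuous (fun s => f s 0 j)}) -> {for t, continuous f}.
Proof.
move=> fc; apply/cvgrPdist_le => e e0.
have : \forall s \near t, forall j, `|f t 0 j - f s 0 j| <= e.
  by apply: filter_forall => j; have /cvgrPdist_le/(_ e e0) := fc j.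
by apply: filterS => s H; apply: rV_norm_le (ltW e0) _ => j; rewrite !mxE.
Qed.

Lemma continuous_set_type {T X : topologicalType} (A : set X) (f : T -> set_type A) (t : T) :
  {for t, continuous (fun s => \val (f s))} -> {for t, continuous f}.
Proof. by move=> cf U [/= _ [[W oW <-] Wt] /filterS]; apply; apply: cf; exact: open_nbhs_nbhs. Qed.

Lemma val_continuous {X : topologicalType} (A : set X) :
  continuous (fun p : set_type A => \val p).
Proof. exact: initial_continuous. Qed.

Lemma set_type_hausdorff {X : topologicalType} (A : set X) :
  hausdorff_space X -> hausdorff_space (set_type A).
Proof.
move=> hX p q pq; apply/val_inj; apply: hX => U V Up Vq.
have [r [rU rV]] := pq _ _ (val_continuous Up) (val_continuous Vq).
by exists (\val r).
Qed.

Lemma set_type_second_countable {X : topologicalType} (A : set X) :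
  @second_countable X -> @second_countable (set_type A).
Proof.
move=> [B cB [oB bB]]; exists ((fun U => (fun p : set_type A => \val p) @^-1` U) @` B).
  exact: sub_countable (card_image_le _ _) cB.
split; first by move=> _ [U BU <-]; exists U => //; exact: oB.
move=> p U [/= _ [[W oW <-] Wp] WU].
have [V [BV Vp] VW] := bB (\val p) W (open_nbhs_nbhs (conj oW Wp)).
exists ((fun p : set_type A => \val p) @^-1` V); first by split => //; exists V.
by move=> r rV; apply: WU; exact: VW.
Qed.

Lemma rV_second_countable d : @second_countable ('rV[R]_d.+1).
Proof.
pose mq (q : 'rV[rat]_d.+1) : 'rV[R]_d.+1 := map_mx ratr q.
pose f (a : 'rV[rat]_d.+1 * nat) : set 'rV[R]_d.+1 :=
  [set v | `|mq a.1 - v| < a.2.+1%:R^-1].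
exists (range f); first exact: sub_countable (card_image_le _ _) (countableP _).
split.
  move=> _ [[q k] _ <-].
  have -> : f (q, k) = ball (mq q) (k.+1%:R^-1) by rewrite -ball_normE.
  exact: ball_open.
move=> x V /nbhs_normP[e /= e0 eV].
have [k _ ke] : exists2 k : nat, True & k.+1%:R^-1 < e / 2.
  have [k ke] := ltr_add_invr (divr_gt0 e0 (ltr0Sn R 1)); exists k => //.
  by rewrite add0r in ke.
have k0 : 0 < k.+1%:R^-1 :> R by rewrite invr_gt0.
have H j : exists q : rat, `|ratr q - x 0 j| < k.+1%:R^-1.
  have [q] := @rat_in_itvoo R (x 0 j - k.+1%:R^-1) (x 0 j + k.+1%:R^-1)
    ltac:(by rewrite ltrD2l gtrN).
  by rewrite in_itv /= => /andP[q1 q2]; exists q; rewrite ltr_distl q1 q2.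
have [q qE] := choice H; pose Q : 'rV[rat]_d.+1 := \row_j q j.
have xQ : `|mq Q - x| < k.+1%:R^-1.
  change (mx_norm (mq Q - x) < k.+1%:R^-1); rewrite mx_normrE.
  by apply: bigmax_lt => //= -[a j] _ /=; rewrite (ord1 a) !mxE.
exists (f (Q, k)); first by split => //; exists (Q, k).
move=> v /= vQ; apply: eV => /=.
apply: le_lt_trans (ler_distD (mq Q) _ _) _.
by rewrite (splitr e); apply: ltrD; [rewrite distrC; exact: lt_trans ke | exact: lt_trans ke].
Qed.

Lemma compact_set_type {X : topologicalType} (A : set X) :
  compact A -> compact [set: set_type A].
Proof.
move=> cA F PF FT.
pose G : set_system X := [set U | F ((fun p : set_type A => \val p) @^-1` U)].
have FG : ProperFilter G.
  split; first by rewrite /G /= preimage_set0; exact: filter_not_empty.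
  split; rewrite /G /=; first by rewrite preimage_setT; exact: filterT.
    by move=> P Q GP GQ; exact: filterI GP GQ.
  by move=> P Q PQ; apply: filterS => r; exact: PQ.
have GA : G A.
  rewrite /G /=; suff -> : (fun p : set_type A => \val p) @^-1` A = setT by [].
  by apply/seteqP; split=> // -[p pA] _; exact: set_mem pA.
have [x [Ax cx]] := cA G FG GA.
exists (exist _ x (mem_set Ax)); split=> // U V FU [/= _ [[W oW <-] Wx] WV].
have GU : G ((fun p : set_type A => \val p) @` U).
  by rewrite /G /=; apply: (filterS _ FU) => p Up; exists p.
have [_ [[p Up <-] Wp]] := cx _ _ GU (open_nbhs_nbhs (conj oW Wx)).
by exists p; split => //; exact: WV.
Qed.

End Continuity.

(** * Angles *)

Section Angles.
Context {R : realType}.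
Implicit Types a b : R.

Lemma polar_angle a b : a ^+ 2 + b ^+ 2 = 1 -> exists t, a = cos t /\ b = sin t.
Proof.
move=> ab; have b2 := sqr_ge0 b.
have a1 : -1 <= a <= 1 by apply/andP; split; nra.
have cE : cos (acos a) = a by rewrite acosK // in_itv.
have : sin (acos a) ^+ 2 = b ^+ 2 by rewrite sin2cos2 cE -ab addrAC subrr add0r.
move/eqP; rewrite eqf_sqr => /orP[] /eqP sb.
  by exists (acos a); rewrite cE.
by exists (- acos a); rewrite cosN sinN cE sb opprK.
Qed.

Lemma cos_sin_period (k : int) a :
  cos (a + k%:~R * (2 * pi)) = cos a /\ sin (a + k%:~R * (2 * pi)) = sin a.
Proof.
have H (m : nat) (c : R) : cos (c + m%:R * (2 * pi)) = cos c /\ sin (c + m%:R * (2 * pi)) = sin c.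
  elim: m => [|m [IHc IHs]]; first by rewrite mul0r addr0.
  have -> : c + m.+1%:R * (2 * pi) = c + m%:R * (2 * pi) + pi *+ 2.
    by rewrite -[m.+1%:R]natr1 mulr2n; move: (m%:R) => x; ring.
  by rewrite cosD2pi sinD2pi.
case: k => m; first exact: H.
have [hc hs] := H m.+1 (a + (Negz m)%:~R * (2 * pi)).
have E : a + (Negz m)%:~R * (2 * pi) + m.+1%:R * (2 * pi) = a.
  by rewrite NegzE mulrNz mulNr addrNK.
by rewrite E in hc hs.
Qed.

Lemma reduce_period (P a : R) : 0 < P -> exists k : int, 0 <= a + k%:~R * P < P.
Proof.
move=> P0; exists (- Num.floor (a / P)).
have /andP[] := floor_itv (a / P); rewrite intrD ler_pdivlMr // ltr_pdivrMr //.
by rewrite mulrNz mulNr; move: (_%:~R) => F f1 f2; apply/andP; split; lra.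
Qed.

Lemma cos_eq1 a : cos a = 1 -> exists k : int, a = k%:~R * (2 * pi).
Proof.
move=> ca; have p0 : 0 < 2 * pi :> R by rewrite mulr_gt0 // pi_gt0.
have [k /andP[k1 k2]] := reduce_period a p0; exists (- k).
have [cE _] := cos_sin_period k a; move: cE k1 k2; rewrite ca.
move bE : (a + _) => b cb b0 b2.
suff b00 : b = 0 by rewrite mulrNz mulNr; apply/eqP; rewrite -addr_eq0 bE b00.
apply/eqP; rewrite eq_le b0 andbT leNgt; apply/negP => b1.
have : 0 < sin (b / 2) by apply: sin_gt0_pi; apply/andP; split; lra.
have : cos b = 1 - 2 * sin (b / 2) ^+ 2.
  have bE2 : b = b / 2 *+ 2 by rewrite mulr2n -splitr.
  by rewrite [in LHS]bE2 cos_mulr2n sin2cos2; move: (cos _) => c; ring.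
rewrite cb => E s0; have : sin (b / 2) ^+ 2 = 0 by lra.
by move/eqP; rewrite expf_eq0 /= gt_eqF.
Qed.

Lemma same_angle a b : cos a = cos b -> sin a = sin b ->
  exists k : int, a = b + k%:~R * (2 * pi).
Proof.
move=> cE sE; have [|k kE] := @cos_eq1 (a - b).
  by rewrite cosB cE sE -!expr2 cos2Dsin2.
by exists k; rewrite -kE addrC subrK.
Qed.

End Angles.

(** * The total space *)

Section BoltSpace.
Context {R : realType} (n : nat).
Hypothesis n0 : (0 < n)%N.
Local Notation V := 'rV[R]_4.
Local Notation W := 'rV[R]_7.
Implicit Types (x y : V) (v : W).

Definition row7 (a0 a1 a2 a3 a4 a5 a6 : R) : W :=
  \row_(i < 7) [:: a0; a1; a2; a3; a4; a5; a6]`_i.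

Lemma row7s a0 a1 a2 a3 a4 a5 a6 : let w := row7 a0 a1 a2 a3 a4 a5 a6 in
  (w 0 0 = a0) * (w 0 1 = a1) * (w 0 2 = a2) * (w 0 3 = a3) * (w 0 4 = a4) *
  (w 0 5 = a5) * (w 0 6 = a6).
Proof. by rewrite /row7 !mxE. Qed.

Lemma ord7P (P : 'I_7 -> Prop) : P 0 -> P 1 -> P 2 -> P 3 -> P 4 -> P 5 -> P 6 -> forall i, P i.
Proof.
move=> p0 p1 p2 p3 p4 p5 p6 i.
case: i => [[|[|[|[|[|[|[|//]]]]]]] hi].
- by have -> : Ordinal hi = 0 by apply/val_inj.
- by have -> : Ordinal hi = 1 by apply/val_inj.
- by have -> : Ordinal hi = 2 by apply/val_inj.
- by have -> : Ordinal hi = 3 by apply/val_inj.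
- by have -> : Ordinal hi = 4 by apply/val_inj.
- by have -> : Ordinal hi = 5 by apply/val_inj.
- by have -> : Ordinal hi = 6 by apply/val_inj.
Qed.

Lemma row7P v v' : v 0 0 = v' 0 0 -> v 0 1 = v' 0 1 -> v 0 2 = v' 0 2 -> v 0 3 = v' 0 3 ->
  v 0 4 = v' 0 4 -> v 0 5 = v' 0 5 -> v 0 6 = v' 0 6 -> v = v'.
Proof. by move=> *; apply/rowP; elim/ord7P. Qed.

Definition powers x : R * R * (R * R) := (cpow n (x 0 0, x 0 1), cpow n (x 0 2, x 0 3)).

(** The quotient of the sphere, embedded by the Hopf map and the two [n]-th powers. *)
Definition hopf x : W :=
  row7 (x 0 0 ^+ 2 + x 0 1 ^+ 2 - (x 0 2 ^+ 2 + x 0 3 ^+ 2))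
       (x 0 0 * x 0 2 + x 0 1 * x 0 3) (x 0 1 * x 0 2 - x 0 0 * x 0 3)
       (powers x).1.1 (powers x).1.2 (powers x).2.1 (powers x).2.2.

(** Shrinks the [psi]-circles, each of which becomes a point for [a = 0]. *)
Definition squeeze (a : R) v : W :=
  row7 (v 0 0) (v 0 1) (v 0 2) (a * v 0 3) (a * v 0 4) (a * v 0 5) (a * v 0 6).

Definition bolt_set : set W := [set v | exists a x, [/\ 0 <= a, S3 x & v = squeeze a (hopf x)]].

(** The effect of exchanging [z1] and [z2], which carries one chart to the other. *)
Definition swap v : W := row7 (- v 0 0) (v 0 1) (- v 0 2) (v 0 5) (v 0 6) (v 0 3) (v 0 4).
Definition swap4 x : V := row4 (x 0 2) (x 0 3) (x 0 0) (x 0 1).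

Lemma swapK : involutive swap.
Proof. by move=> v; apply: row7P; rewrite /swap !row7s ?opprK. Qed.

Lemma S3E x : S3 x <-> x 0 0 ^+ 2 + x 0 1 ^+ 2 + (x 0 2 ^+ 2 + x 0 3 ^+ 2) = 1.
Proof. by rewrite /S3 /= sum4 !addrA. Qed.

Lemma swap_squeeze a x : swap (squeeze a (hopf x)) = squeeze a (hopf (swap4 x)).
Proof.
apply: row7P; rewrite /swap ?row7s /squeeze ?row7s /hopf ?row7s /powers /swap4 ?row4s //.
- by rewrite opprB.
- by rewrite ![x 0 0 * _]mulrC ![x 0 1 * _]mulrC.
- by rewrite opprB mulrC [x 0 1 * _]mulrC.
Qed.

Lemma swap_bolt v : bolt_set v -> bolt_set (swap v).
Proof.
move=> [a [x [a0 xS ->]]]; exists a, (swap4 x); split=> //; last exact: swap_squeeze.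
by apply/S3E; rewrite /swap4 !row4s addrC; exact/S3E.
Qed.

Lemma bolt_cover v : bolt_set v -> -1 < v 0 0 \/ -1 < swap v 0 0.
Proof.
move=> _; rewrite /swap row7s ltrN2; case: (ltP (v 0 0) 1) => h; [by right | left].
by apply: lt_le_trans h; rewrite gtrN.
Qed.

(** The coordinates [w = z2 / z1] and [zeta = a * (z1 / |z1|) ^ n], expressed by the
invariants; [m] is [|z1| ^ 2]. *)
Definition trivialize v : V :=
  let m := (1 + v 0 0) / 2 in let c := (Num.sqrt m ^+ n)^-1 in
  row4 (v 0 1 / m) (- (v 0 2 / m)) (v 0 3 * c) (v 0 4 * c).

Definition untrivialize y : W :=
  let S := base2 y in let c := (Num.sqrt S ^+ n)^-1 in
  let u := cpow n (y 0 0, y 0 1) in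
  row7 ((2 - S) / S) (y 0 0 / S) (- (y 0 1 / S)) (c * y 0 2) (c * y 0 3)
       (c * (y 0 2 * u.1 - y 0 3 * u.2)) (c * (y 0 2 * u.2 + y 0 3 * u.1)).

Let base_neq0 y : base2 y != 0. Proof. by rewrite gt_eqF // base2_gt0. Qed.
Let sqrt_neq0 (a : R) : 0 < a -> Num.sqrt a ^+ n != 0.
Proof. by move=> a0; rewrite expf_neq0 // gt_eqF // sqrtr_gt0. Qed.

Lemma untrivialize_dom y : -1 < untrivialize y 0 0.
Proof.
rewrite /untrivialize row7s; have S0 := base2_gt0 y.
by rewrite ltr_pdivlMr //; move: (base2 y) S0 => S; lra.
Qed.

Lemma untrivializeK y : trivialize (untrivialize y) = y.
Proof.
have S0 := base2_gt0 y; have sS := sqrt_neq0 S0; have Sn := base_neq0 y.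
apply/rowP => i; rewrite /trivialize /untrivialize !row7s.
have -> : (1 + (2 - base2 y) / base2 y) / 2 = (base2 y)^-1 by field.
rewrite sqrtrV ?ltW // exprVn !invrK.
by elim/ord4P: i; rewrite !row4s; move: (Num.sqrt _ ^+ n) sS => c c0; field; rewrite ?Sn ?c0.
Qed.

Lemma untrivialize_bolt y : bolt_set (untrivialize y).
Proof.
have S0 := base2_gt0 y; have Sn := base_neq0 y.
pose a := Num.sqrt (fibre2 y); have a2 : a ^+ 2 = fibre2 y by rewrite sqr_sqrtr // fibre2_ge0.
have [t [tc ts]] : exists t, y 0 2 = a * cos t /\ y 0 3 = a * sin t.
  have [a0|a0] := eqVneq a 0.
    move: a2; rewrite a0 expr0n /= => /esym/eqP; rewrite paddr_eq0 ?sqr_ge0 //.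
    by rewrite !expf_eq0 /= => /andP[/eqP -> /eqP ->]; exists 0; rewrite !mul0r.
  have [|t [tc ts]] := @polar_angle _ (y 0 2 / a) (y 0 3 / a).
    by rewrite !expr_div_n -mulrDl -/(fibre2 y) -a2 divff // expf_neq0.
  by exists t; rewrite -tc -ts ![a * _]mulrC !divfK.
have nn : n%:R != 0 :> R by rewrite pnatr_eq0 -lt0n.
(* an [n]-th root of the phase of [zeta] serves as the phase of [z1] *)
pose c := (Num.sqrt (base2 y))^-1; pose z := (c * cos (t / n%:R), c * sin (t / n%:R)).
have zE : z = cmul (c, 0) (cos (t / n%:R), sin (t / n%:R)).
  by rewrite /cmul /z /=; congr (_, _); ring.
have zn : cpow n z = (c ^+ n * cos t, c ^+ n * sin t).
  rewrite zE cpowM cpow_real cpow_unit mulrC divfK //.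
  by rewrite /cmul /=; congr (_, _); ring.
have c2 : c ^+ 2 = (base2 y)^-1 by rewrite exprVn sqr_sqrtr // ltW.
have z2 : z.1 ^+ 2 + z.2 ^+ 2 = (base2 y)^-1.
  by rewrite /z /= !exprMn -mulrDr cos2Dsin2 mulr1.
pose w := cmul z (y 0 0, y 0 1).
have w2 : w.1 ^+ 2 + w.2 ^+ 2 = (base2 y - 1) / base2 y.
  rewrite -/(cnorm2 w) cnorm2M {1}/cnorm2 z2 mulrC /cnorm2 /=.
  by rewrite /base2 addrAC subrr add0r.
exists a, (row4 z.1 z.2 w.1 w.2); split; first exact: sqrtr_ge0.
  by apply/S3E; rewrite !row4s w2 z2; field.
have pE : powers (row4 z.1 z.2 w.1 w.2) = (cpow n z, cmul (cpow n z) (cpow n (y 0 0, y 0 1))).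
  by rewrite /powers !row4s -cpowM -!surjective_pairing.
have cn : (Num.sqrt (base2 y) ^+ n)^-1 = c ^+ n by rewrite exprVn.
apply: row7P; rewrite /untrivialize /squeeze /hopf !row7s ?row4s ?pE ?zn ?cn ?tc ?ts ?w2 ?z2 /=.
- by field.
- transitivity (y 0 0 * (z.1 ^+ 2 + z.2 ^+ 2)); first by rewrite z2.
  by rewrite /w /cmul /=; ring.
- transitivity (- (y 0 1 * (z.1 ^+ 2 + z.2 ^+ 2))); first by rewrite z2.
  by rewrite /w /cmul /=; ring.
- by ring.
- by ring.
- by ring.
- by ring.
Qed.

Lemma trivializeK v : bolt_set v -> -1 < v 0 0 -> untrivialize (trivialize v) = v.
Proof.
move=> [a [x [a0 /S3E xS ->]]]; rewrite {1}/squeeze {1}/hopf !row7s => m0.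
pose m := x 0 0 ^+ 2 + x 0 1 ^+ 2; pose k := x 0 2 ^+ 2 + x 0 3 ^+ 2.
have kE : k = 1 - m by rewrite -xS addrAC subrr add0r.
have mp : 0 < m by move: m0; rewrite -/m -/k kE; move: (m) => q; lra.
have mn : m != 0 by rewrite gt_eqF.
have vm : (1 + squeeze a (hopf x) 0 0) / 2 = m.
  by rewrite /squeeze /hopf !row7s -/m -/k kE; field.
pose w := trivialize (squeeze a (hopf x)).
have wz : cmul (x 0 0, x 0 1) (w 0 0, w 0 1) = (x 0 2, x 0 3).
  rewrite /w /trivialize vm /squeeze /hopf !row7s !row4s /cmul /=; congr (_, _).
    by transitivity (m * x 0 2 / m); [rewrite /m; ring | field].
  by transitivity (m * x 0 3 / m); [rewrite /m; ring | field].
have bE : base2 w = m^-1.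
  have : cnorm2 (cmul (x 0 0, x 0 1) (w 0 0, w 0 1)) = k by rewrite wz.
  rewrite cnorm2M /cnorm2 /= -/m kE /base2 => H.
  have -> : w 0 0 ^+ 2 + w 0 1 ^+ 2 = (1 - m) / m by rewrite -H mulrC mulKf.
  by field.
have sm := sqrt_neq0 mp.
have pw : cmul (cpow n (x 0 0, x 0 1)) (cpow n (w 0 0, w 0 1)) = cpow n (x 0 2, x 0 3).
  by rewrite -cpowM wz.
have sE : (Num.sqrt (base2 w) ^+ n)^-1 = Num.sqrt m ^+ n.
  by rewrite bE sqrtrV ?ltW // exprVn invrK.
have w2 : w 0 2 = a * (powers x).1.1 / Num.sqrt m ^+ n.
  by rewrite /w /trivialize vm row4s /squeeze /hopf !row7s.
have w3 : w 0 3 = a * (powers x).1.2 / Num.sqrt m ^+ n.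
  by rewrite /w /trivialize vm row4s /squeeze /hopf !row7s.
have w0 : w 0 0 = (x 0 0 * x 0 2 + x 0 1 * x 0 3) / m.
  by rewrite /w /trivialize vm row4s /squeeze /hopf !row7s.
have w1 : w 0 1 = - ((x 0 1 * x 0 2 - x 0 0 * x 0 3) / m).
  by rewrite /w /trivialize vm row4s /squeeze /hopf !row7s.
rewrite -/w; move: (Num.sqrt m ^+ n) sm sE w2 w3 => c cn sE w2 w3.
rewrite /squeeze /hopf; apply: row7P; rewrite /untrivialize sE ?bE !row7s.
- by rewrite -/m -/k kE; field.
- by rewrite w0; field.
- by rewrite w1; field.
- by rewrite w2; field.
- by rewrite w3; field.
- by rewrite w2 w3 [in RHS]/powers -pw /powers /cmul /=; field.
- by rewrite w2 w3 [in RHS]/powers -pw /powers /cmul /=; field.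
Qed.

Lemma trivialize_fibre2 a x : S3 x -> -1 < squeeze a (hopf x) 0 0 ->
  fibre2 (trivialize (squeeze a (hopf x))) = a ^+ 2.
Proof.
move=> /S3E xS; rewrite {1}/squeeze {1}/hopf !row7s => m0.
pose m := x 0 0 ^+ 2 + x 0 1 ^+ 2; pose k := x 0 2 ^+ 2 + x 0 3 ^+ 2.
have kE : k = 1 - m by rewrite -xS addrAC subrr add0r.
have mp : 0 < m by move: m0; rewrite -/m -/k kE; move: (m) => q; lra.
have vm : (1 + squeeze a (hopf x) 0 0) / 2 = m.
  by rewrite /squeeze /hopf !row7s -/m -/k kE; field.
rewrite /fibre2 /trivialize vm !row4s /squeeze /hopf !row7s.
have sm := sqrt_neq0 mp.
have : (powers x).1.1 ^+ 2 + (powers x).1.2 ^+ 2 = (Num.sqrt m ^+ n) ^+ 2.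
  by rewrite -/(cnorm2 _) cnorm2X /cnorm2 /= -/m exprAC sqr_sqrtr // ltW.
move: (Num.sqrt m ^+ n) sm (powers x).1 => c c0 [p q] /= pq.
have qE : q ^+ 2 = c ^+ 2 - p ^+ 2 by rewrite -pq addrAC subrr add0r.
by field: qE.
Qed.

Lemma trivialize_swap y : off_pole y -> trivialize (swap (untrivialize y)) = clutch n y.
Proof.
move=> yU; have p0 := off_pole_gt0 yU; have Sn := base_neq0 y; have S0 := base2_gt0 y.
have pE : y 0 0 ^+ 2 + y 0 1 ^+ 2 = base2 y - 1 by rewrite /base2 addrAC subrr add0r.
rewrite /clutch; move: p0; move pP : (y 0 0 ^+ 2 + y 0 1 ^+ 2) => p p0.
have pS : base2 y = 1 + p by rewrite -pP.
have pn : p != 0 by rewrite gt_eqF.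
have vm : (1 + swap (untrivialize y) 0 0) / 2 = p / base2 y.
  by rewrite /swap /untrivialize !row7s; move: Sn; rewrite pS => Sn; field.
have uE : cpow n (y 0 0 / Num.sqrt p, y 0 1 / Num.sqrt p) =
    cmul ((Num.sqrt p ^+ n)^-1, 0) (cpow n (y 0 0, y 0 1)).
  by rewrite -exprVn -cpow_real -cpowM /cmul /=; congr (cpow n (_, _)); ring.
have c0 := sqrt_neq0 p0; have d0 := sqrt_neq0 S0.
have cE : Num.sqrt (p / base2 y) ^+ n = Num.sqrt p ^+ n / Num.sqrt (base2 y) ^+ n.
  by rewrite sqrtrM ?ltW // sqrtrV ?ltW // exprMn exprVn.
apply/rowP => i; rewrite uE /trivialize vm cE /swap /untrivialize !row7s /cmul /=.
move: (Num.sqrt p ^+ n) (Num.sqrt (base2 y) ^+ n) (cpow n _) c0 d0 => c d u c0 d0.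
by elim/ord4P: i; rewrite !row4s; field; rewrite ?c0 ?d0 ?pn ?Sn.
Qed.

Lemma swap_untrivialize_dom y : -1 < swap (untrivialize y) 0 0 -> off_pole y.
Proof.
rewrite /swap /untrivialize !row7s ltrN2 ltr_pdivrMr ?base2_gt0 // mul1r => h.
by rewrite /off_pole /=; apply: contraTN h => /eqP h; rewrite /base2 h -leNgt; lra.
Qed.

End BoltSpace.

(** * The Riemannian manifold *)

Lemma pullback_near {R : realType} {d m : nat} (F F' : 'rV[R]_d.+1 -> 'rV[R]_m.+1)
    (G : 'rV[R]_m.+1 -> 'M[R]_m.+1) x :
  {near x, F =1 F'} -> differentiable F' x -> pullback F G x = pullback F' G x.
Proof.
move=> FF' dF'; have dF : differentiable F x.
  by apply: near_eq_differentiable dF'; apply: filterS FF' => y ->.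
have JE : 'J F x = 'J F' x.
  by apply/matrixP => i j; exact: (etrans (jacobianE i j dF)
    (etrans (congr1 (fun M : 'rV[R]_m.+1 => M 0 j) (partial_near i FF')) (esym (jacobianE i j dF')))).
by rewrite /pullback JE (nbhs_singleton FF').
Qed.

Section BoltManifold.
Context {R : realType} (n : nat) (B x0 : R).
Hypotheses (n0 : (0 < n)%N) (B0 : 0 < B) (x00 : 0 < x0).
Local Notation V := 'rV[R]_4.
Local Notation W := 'rV[R]_7.
Implicit Types (b : bool) (y : V) (v : W).

Definition bolt_space : topologicalType := set_type (@bolt_set R n).
Implicit Type p : bolt_space.

Definition flip b v : W := if b then swap v else v.

Lemma flip_bolt b v : bolt_set n v -> bolt_set n (flip b v).
Proof. by case: b => //; exact: swap_bolt. Qed.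

Lemma flipK b : involutive (flip b).
Proof. by case: b => // v; exact: swapK. Qed.

Definition embed p : W := \val (p : set_type (@bolt_set R n)).

Lemma val_bolt p : bolt_set n (embed p).
Proof. exact: set_mem (valP p). Qed.

Lemma embed_continuous : continuous embed.
Proof. exact: val_continuous. Qed.

Lemma embed_inj : injective embed.
Proof. exact: val_inj. Qed.

Definition to_bolt v (vP : bolt_set n v) : bolt_space := exist _ v (mem_set vP).

Definition bolt_chart b : chart R 3 bolt_space := {|
  chart_dom := [set p | -1 < flip b (embed p) 0 0];
  chart_map := fun p => trivialize n (flip b (embed p));
  chart_inv := fun y => to_bolt (flip_bolt b (untrivialize_bolt n0 y)) |}.

Lemma bolt_chart_invP b y : chart_dom (bolt_chart b) (chart_inv (bolt_chart b) y) /\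
  chart_map (bolt_chart b) (chart_inv (bolt_chart b) y) = y.
Proof.
by split; rewrite /= flipK; [exact: untrivialize_dom | exact: untrivializeK].
Qed.

Lemma bolt_chart_cod b : chart_cod (bolt_chart b) = setT.
Proof.
apply/seteqP; split=> // y _; have [d e] := bolt_chart_invP b y.
by exists (chart_inv (bolt_chart b) y).
Qed.

Lemma smooth_flip b (U : set W) j : open U -> smooth_on U (fun v => flip b v 0 j).
Proof.
move=> oU; case: b; last exact: smooth_coord.
by elim/ord7P: j; rewrite /flip /swap; under eq_fun do rewrite row7s;
  (exact: smooth_coord || (apply: (smoothN oU); exact: smooth_coord)).
Qed.

Definition trivial_dom b : set W := [set v | -1 < flip b v 0 0].

Lemma trivial_dom_open b : open (trivial_dom b).
Proof.
have -> : trivial_dom b = (fun v => flip b v 0 0) @^-1` [set s : R | -1 < s] by [].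
apply: open_comp; last exact: open_gt.
by move=> v _; apply: differentiable_continuous; apply: (smooth_diff (smooth_flip b 0 openT)).
Qed.

Lemma smooth_trivialize b : smooth_on (trivial_dom b) (fun v => trivialize n (flip b v)).
Proof.
have oU := @trivial_dom_open b.
have sm : smooth_on (trivial_dom b) (fun v => (1 + flip b v 0 0) / 2).
  apply: (smoothM oU); last exact: smooth_cst.
  by apply: (smoothD oU); [exact: smooth_cst | exact: smooth_flip].
have m0 v : trivial_dom b v -> 0 < (1 + flip b v 0 0) / 2.
  by rewrite /trivial_dom /= => h; apply: divr_gt0 => //; lra.
have smV : smooth_on (trivial_dom b) (fun v => ((1 + flip b v 0 0) / 2)^-1).
  by apply: smoothV => // v /m0 /gt_eqF ->.
have sc : smooth_on (trivial_dom b) (fun v => (Num.sqrt ((1 + flip b v 0 0) / 2) ^+ n)^-1).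
  apply: smoothV => //; last by apply: (smoothX oU); exact: smooth_sqrt.
  by move=> v /m0 h; rewrite expf_neq0 // gt_eqF // sqrtr_gt0.
apply/(smooth_mxP _ oU) => i j; rewrite (ord1 i).
by elim/ord4P: j; rewrite /trivialize; under eq_fun do rewrite row4s;
  [|apply: (smoothN oU)| |]; apply: (smoothM oU) => //; exact: smooth_flip.
Qed.

Lemma smooth_untrivialize b : smooth_on setT (fun y => flip b (untrivialize n y)).
Proof.
have oT := @openT V.
have sc (j : 'I_4) : smooth_on setT (fun y : V => y 0 j) := smooth_coord oT j.
have sb : smooth_on setT (@base2 R).
  by apply: (smoothD oT); [exact: smooth_cst | apply: (smoothD oT); exact: smoothX].
have sbV : smooth_on setT (fun y : V => (base2 y)^-1).
  by apply: smoothV => // y _; rewrite gt_eqF // base2_gt0.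
have scV : smooth_on setT (fun y : V => (Num.sqrt (base2 y) ^+ n)^-1).
  apply: smoothV => //.
    by move=> y _; rewrite expf_neq0 // gt_eqF // sqrtr_gt0 base2_gt0.
  by apply: (smoothX oT); apply: smooth_sqrt => // y _; exact: base2_gt0.
have [s1 s2] := smooth_cpow n oT (sc 0) (sc 1).
have su (j : 'I_7) : smooth_on setT (fun y => untrivialize n y 0 j).
  elim/ord7P: j; rewrite /untrivialize; under eq_fun do rewrite row7s.
  - by apply: (smoothM oT) => //; apply: (smoothB oT) => //; exact: smooth_cst.
  - exact: smoothM.
  - by apply: (smoothN oT); exact: smoothM.
  - exact: smoothM.
  - exact: smoothM.
  - by apply: (smoothM oT) => //; apply: (smoothB oT); exact: smoothM.
  - by apply: (smoothM oT) => //; apply: (smoothD oT); exact: smoothM.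
apply/(smooth_mxP _ oT) => i j; rewrite (ord1 i).
case: b; last exact: su.
by elim/ord7P: j; rewrite /flip /swap; under eq_fun do rewrite row7s;
  (exact: su || (apply: (smoothN oT); exact: su)).
Qed.

Lemma bolt_chart_dom_open b : open (chart_dom (bolt_chart b)).
Proof.
have -> : chart_dom (bolt_chart b) = embed @^-1` trivial_dom b by [].
by apply: open_comp; [move=> p _; exact: embed_continuous | exact: trivial_dom_open].
Qed.

Lemma bolt_chart_map_continuous b p : chart_dom (bolt_chart b) p ->
  {for p, continuous (chart_map (bolt_chart b))}.
Proof.
move=> pb; apply: (@continuous_comp _ _ _ embed
  (fun v => trivialize n (flip b v))); first exact: embed_continuous.
by apply: differentiable_continuous; exact: smooth_diff (@smooth_trivialize b) pb.
Qed.

Lemma bolt_chart_inv_continuous b : continuous (chart_inv (bolt_chart b)).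
Proof.
move=> y; apply: continuous_set_type; apply: differentiable_continuous.
exact: smooth_diff (@smooth_untrivialize b) _.
Qed.

Lemma bolt_is_chart b : is_chart (bolt_chart b).
Proof.
split.
- exact: bolt_chart_dom_open.
- by rewrite bolt_chart_cod; exact: openT.
- move=> p pb; apply/embed_inj; rewrite /embed /= -/(embed p).
  by rewrite trivializeK ?flipK //; apply: flip_bolt; exact: val_bolt.
- by apply: continuous_in_subspaceT => p /set_mem; exact: bolt_chart_map_continuous.
- by apply: continuous_subspaceT; exact: bolt_chart_inv_continuous.
Qed.

Lemma bolt_chart_cover p : exists b, chart_dom (bolt_chart b) p.
Proof. by have [h|h] := bolt_cover (val_bolt p); [exists false | exists true]. Qed.

Lemma transition_id b y : transition (bolt_chart b) (bolt_chart b) y = y.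
Proof. by have [_] := bolt_chart_invP b y. Qed.

Lemma transition_clutch b y : off_pole y ->
  transition (bolt_chart b) (bolt_chart (~~ b)) y = clutch n y.
Proof.
move=> yU; rewrite /transition /= -trivialize_swap //.
by case: b; rewrite /= ?swapK.
Qed.

Lemma overlap_off_pole b p : chart_dom (bolt_chart b) p -> chart_dom (bolt_chart (~~ b)) p ->
  off_pole (chart_map (bolt_chart b) p).
Proof.
move=> pb pb'; apply: (@swap_untrivialize_dom R n) => /=.
rewrite trivializeK //; last by apply: flip_bolt; exact: val_bolt.
by case: b pb pb' => /=; rewrite ?swapK.
Qed.

Lemma bolt_atlas_smooth b b' : smooth_on
  (chart_map (bolt_chart b) @` (chart_dom (bolt_chart b) `&` chart_dom (bolt_chart b')))
  (transition (bolt_chart b) (bolt_chart b')).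
Proof.
have [->|bb] := eqVneq b' b.
  apply: (@smooth_sub _ _ _ setT) => //.
  apply: (smooth_eq openT) => [y _|]; first exact/esym/transition_id.
  by apply/(smooth_mxP _ openT) => i j; rewrite (ord1 i); exact: smooth_coord openT j.
have -> : b' = ~~ b by case: b b' bb => [] [].
apply: (@smooth_sub _ _ _ off_pole); first by move=> _ [p [pb pb'] <-]; exact: overlap_off_pole.
apply: (smooth_eq off_pole_open) => [y yU|]; first exact/esym/transition_clutch.
exact: clutch_smooth.
Qed.

Lemma differentiable_idV y : differentiable (fun z : V => z) y.
Proof. by apply/differentiable_mxP => i j; exact: differentiable_coord. Qed.

Lemma pullback_id (G : V -> 'M[R]_4) y : pullback (fun z : V => z) G y = G y.
Proof.
have did := @differentiable_idV y.
have JE : 'J (fun z : V => z) y = 1%:M.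
  apply/matrixP => i j; rewrite (jacobianE _ _ did) /partial derive_id !mxE eqxx /=.
  by rewrite eq_sym.
by rewrite /pullback JE trmx1 mulmx1 mul1mx.
Qed.

Lemma bolt_metric_compat b b' p : chart_dom (bolt_chart b) p -> chart_dom (bolt_chart b') p ->
  model_metric n B x0 (chart_map (bolt_chart b) p) =
  pullback (transition (bolt_chart b) (bolt_chart b')) (model_metric n B x0)
    (chart_map (bolt_chart b) p).
Proof.
move=> pb; have [->|bb] := eqVneq b' b.
  move=> _; rewrite -[LHS]pullback_id; apply/esym/pullback_near.
    by apply: filterE => y; exact: transition_id.
  exact: differentiable_idV.
have -> : b' = ~~ b by case: b b' bb pb => [] [].
move=> pb'; have yU := overlap_off_pole pb pb'.
rewrite -[LHS](clutch_pullback n B x0 yU); apply/esym/pullback_near.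
  move: (open_nbhs_nbhs (conj off_pole_open yU)); apply: filterS => y.
  exact: transition_clutch.
exact: smooth_diff (clutch_smooth _) yU.
Qed.

Lemma bolt_hausdorff : hausdorff_space bolt_space.
Proof. by apply: set_type_hausdorff; exact: norm_hausdorff. Qed.

Lemma bolt_second_countable : @second_countable bolt_space.
Proof. by apply: set_type_second_countable; exact: rV_second_countable. Qed.

(** One matrix serves in both charts, the transition map being an isometry of it. *)
Definition bolt_manifold : riemannian_manifold R 3 := {|
  mspace := bolt_space;
  mindex := bool;
  atlas := bolt_chart;
  metric := fun=> model_metric n B x0;
  mspace_hausdorff := bolt_hausdorff;
  mspace_second_countable := bolt_second_countable;
  atlas_chart := bolt_is_chart;
  atlas_cover := bolt_chart_cover;
  atlas_smooth := bolt_atlas_smooth;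
  metric_smooth := fun b => smooth_sub (@subsetT _ _) (model_metric_smooth n0 B0 x00);
  Defs.metric_sym := fun _ y _ => model_metric_sym n B x0 y;
  metric_pos := fun _ y w _ wn => model_metric_pos n0 B0 x00 y wn;
  metric_compat := bolt_metric_compat |}.

End BoltManifold.

(** * Completeness and scalar curvature *)

Section ScalarSmooth.
Context {R : realType} {d : nat}.
Local Notation V := 'rV[R]_d.+1.

Lemma smooth_scalar_curvature (U : set V) G : open U -> smooth_on U G ->
  (forall x, U x -> G x \in unitmx) -> smooth_on U (scalar_curvature_in G).
Proof.
move=> oU sG uG; have sGe := (smooth_mxP G oU).1 sG.
have sC k i j : smooth_on U (christoffel G k i j) by exact: smooth_christoffel.
rewrite /scalar_curvature_in.
apply: (smooth_sum oU) => i; apply: (smooth_sum oU) => j; apply: (smoothM oU).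
  by apply: (smooth_invmx oU).
apply: (smooth_sum oU) => k; rewrite /riemann; apply: (smoothD oU).
  by apply: (smoothB oU); exact: smooth_partial.
by apply: (smooth_sum oU) => m; apply: (smoothB oU); apply: (smoothM oU).
Qed.

End ScalarSmooth.

Section Completeness.
Context {R : realType} (n : nat) (B x0 : R).
Hypotheses (n0 : (0 < n)%N) (B0 : 0 < B) (x00 : 0 < x0).
Local Notation V := 'rV[R]_4.
Local Notation W := 'rV[R]_7.
Local Notation N := (bolt_manifold n0 B0 x00).
Local Notation M := (@bolt_space R n).

Lemma bolt_chart_fibre2 b (p : M) a x : S3 x -> embed p = squeeze a (hopf n x) ->
  chart_dom (bolt_chart n0 b) p -> fibre2 (chart_map (bolt_chart n0 b) p) = a ^+ 2.
Proof.
move=> xS pE /=; rewrite pE; case: b => /=; last exact: trivialize_fibre2.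
rewrite swap_squeeze; apply: trivialize_fibre2.
by apply/S3E; rewrite /swap4 !row4s addrC; exact/S3E.
Qed.

(** The chart, centred at one of the two poles, in which a point has a base
coordinate of modulus at most one. *)
Definition pole (p : M) : bool := embed p 0 0 < 0.

Lemma pole_ge0 p : 0 <= flip (pole p) (embed p) 0 0.
Proof.
rewrite /pole; case: ltP => h; last by [].
by rewrite /= /swap row7s oppr_ge0 ltW.
Qed.

Lemma pole_dom p : chart_dom (bolt_chart n0 (pole p)) p.
Proof. by rewrite /=; apply: lt_le_trans (pole_ge0 p); rewrite ltrN10. Qed.

Lemma pole_base2 p : base2 (chart_map (bolt_chart n0 (pole p)) p) <= 2.
Proof.
set y := chart_map _ p; have : 0 <= untrivialize n y 0 0.
  rewrite /y /= trivializeK //; first exact: pole_ge0.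
    by apply: flip_bolt; exact: val_bolt.
  exact: pole_dom.
rewrite /untrivialize row7s pmulr_lge0 ?invr_gt0 ?base2_gt0 //.
by rewrite subr_ge0.
Qed.

Definition log_radius (p : M) : R := ln (1 + fibre2 (chart_map (bolt_chart n0 (pole p)) p)).

Lemma log_radiusE b p : chart_dom (bolt_chart n0 b) p ->
  log_radius p = ln (1 + fibre2 (chart_map (bolt_chart n0 b) p)).
Proof.
move=> pb; have [a [x [_ xS pE]]] := val_bolt p.
by rewrite /log_radius (bolt_chart_fibre2 xS pE pb) (bolt_chart_fibre2 xS pE (pole_dom p)).
Qed.

Lemma base_ball r (y : V) : base2 y <= 2 -> ln (1 + fibre2 y) <= r -> `|y| <= 1 + expR r.
Proof.
move=> b2 Lp; have e0 := expR_ge0 r; have t0 := fibre2_ge0 y.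
have t1 : 0 < 1 + fibre2 y by rewrite ltr_wpDr.
have tr : 1 + fibre2 y <= expR r by rewrite -(lnK t1) ler_expR.
move: b2 tr; rewrite /base2 /fibre2 => b2 tr.
move: (expR r) e0 tr => e e0 tr.
have H a : a ^+ 2 <= 1 + e -> `|a| <= 1 + e.
  move=> ha; rewrite -(@ler_pXn2r _ 2) ?nnegrE ?normr_ge0 ?addr_ge0 //.
  by rewrite real_normK ?num_real //; nra.
apply: rV_norm_le; first by rewrite addr_ge0.
have s0 := sqr_ge0 (y 0 0); have s1 := sqr_ge0 (y 0 1).
have s2 := sqr_ge0 (y 0 2); have s3 := sqr_ge0 (y 0 3).
by elim/ord4P; apply: H; lra.
Qed.

Theorem bolt_complete : geodesically_complete N.
Proof.
have [k k0 kP] := log_fibre2_gradient n0 B0 x00.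
have p0 : M := chart_inv (bolt_chart n0 true) 0.
apply: (@complete_of_proper_function R 3 N (fun b => bolt_chart_cod n0 b) id log_radius k p0) => //.
  move=> r; exists (1 + expR r); first by rewrite addr_ge0 // expR_ge0.
  move=> p Lp; exists (pole p); split; first exact: pole_dom.
  exact: (base_ball (pole_base2 p) Lp).
move=> b y v.
have -> : log_radius \o chart_inv (@atlas _ _ N b) = (fun z => ln (1 + fibre2 z)).
  apply/funext => z; have [zd ze] := bolt_chart_invP n0 b z.
  by rewrite /comp (log_radiusE zd) ze.
exact: kP.
Qed.

End Completeness.

Section ModelCurvature.
Context {R : realType} (n : nat) (B r0 : R).
Hypotheses (n0 : (0 < n)%N) (B0 : 0 < B) (r00 : 0 < r0).
Local Notation V := 'rV[R]_4.
Local Notation mm := (model_metric n B (r0 ^+ 2)).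
Let x00 : 0 < r0 ^+ 2. Proof. exact: exprn_gt0. Qed.

Let mm_unit y : mm y \in unitmx.
Proof. by apply: posdef_unitmx => v; exact: model_metric_pos. Qed.

Lemma euler_chart_curvature (y : V) : euler_regular r0 y ->
  scalar_curvature_in mm (euler_chart n r0 y) = - (24 * B).
Proof.
move=> yU.
have CE := erefl ((n%:R - 2) * r0 ^+ 2 - 3 * B * r0 ^+ 4).
have AE := erefl ((1 - n%:R) * r0 ^+ 4 + 2 * B * r0 ^+ 6).
rewrite -(euler_metric_scalar n0 B0 r00 CE AE yU); apply/esym.
apply: (@scalar_curvature_transform _ _ (euler_regular r0) setT) => //.
- exact: euler_regular_open.
- exact: openT.
- exact: smooth_euler_chart.
- exact: model_metric_smooth.
- by move=> z _; exact: model_metric_sym.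
- move=> z zU; have := euler_metric_unit n0 B0 r00 zU.
  rewrite -(euler_chart_pullback n0 B0 r00 zU) /pullback -mulmxA unitmx_mul.
  by case/andP.
- by move=> z zU; rewrite euler_chart_pullback.
Qed.

Lemma euler_chart_onto (y : V) : 0 < y 0 0 ^+ 2 + y 0 1 ^+ 2 -> 0 < fibre2 y ->
  exists2 z, euler_regular r0 z & euler_chart n r0 z = y.
Proof.
move=> w0 f0; pose T := Num.sqrt (y 0 0 ^+ 2 + y 0 1 ^+ 2).
have T0 : 0 < T by rewrite sqrtr_gt0.
have T2 : T ^+ 2 = y 0 0 ^+ 2 + y 0 1 ^+ 2 by rewrite sqr_sqrtr // ltW.
pose rho := Num.sqrt (fibre2 y); have rho0 : 0 < rho by rewrite sqrtr_gt0.
have rho2 : rho ^+ 2 = fibre2 y by rewrite sqr_sqrtr // ltW.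
have Tn : T != 0 by rewrite gt_eqF.
have rhon : rho != 0 by rewrite gt_eqF.
have nn : n%:R != 0 :> R by rewrite pnatr_eq0 -lt0n.
have [|a [ac as_]] := @polar_angle _ (y 0 0 / T) (- (y 0 1 / T)).
  by rewrite sqrrN !expr_div_n -mulrDl -T2 divff // expf_neq0.
have [|b [bc bs]] := @polar_angle _ (y 0 2 / rho) (y 0 3 / rho).
  by rewrite !expr_div_n -mulrDl -/(fibre2 y) -rho2 divff // expf_neq0.
pose th := 2 * atan T; pose r := Num.sqrt (r0 ^+ 2 + fibre2 y).
have r2 : r ^+ 2 = r0 ^+ 2 + fibre2 y by rewrite sqr_sqrtr // addr_ge0 ?ltW ?exprn_gt0.
have rr : r0 < r.
  rewrite -(@ltr_pXn2r _ 2) ?nnegrE ?sqrtr_ge0 ?ltW //.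
  by rewrite r2 ltrDl.
exists (row4 r th a (2 * b / n%:R - a)).
  split; rewrite /coord_r /coord_theta row4s //.
  have [t1 t2] := (atan_ltpi2 T, lt_atan T0); rewrite atan0 in t2.
  by rewrite /th; apply/andP; split; lra.
rewrite /euler_chart /half_tan /fibre_radius /fibre_angle !row4s r2.
have -> : r0 ^+ 2 + fibre2 y - r0 ^+ 2 = fibre2 y by rewrite addrAC subrr add0r.
have -> : th / 2 = atan T by rewrite /th mulrAC divff ?mul1r // pnatr_eq0.
have -> : sin (atan T) / cos (atan T) = T by rewrite -/(tan _) atanK.
have -> : n%:R * ((2 * b / n%:R - a + a) / 2) = b by rewrite subrK; field.
rewrite -ac -as_ -bc -bs -/rho.
by apply/rowP; elim/ord4P; rewrite !row4s; field.
Qed.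

(** Where neither [w] nor [zeta] vanishes the value is found in Euler coordinates. These
points are dense, and the scalar curvature is continuous. *)
Theorem model_metric_curvature (y : V) : scalar_curvature_in mm y = - (24 * B).
Proof.
pose h (e : R) := scalar_curvature_in mm (y + e *: row4 1 0 1 0).
have s0 : smooth_on setT (scalar_curvature_in mm).
  by apply: smooth_scalar_curvature; [exact: openT | exact: model_metric_smooth | move=> z _].
have ch : {for (0 : R), continuous h}.
  apply: (@continuous_comp _ _ _ (fun e : R => y + e *: row4 1 0 1 0)).
    by apply: cvgD; [exact: cvg_cst | apply: cvgZl; exact: cvg_id].
  by apply: differentiable_continuous; exact: smooth_diff s0 _.
have hE (e : R) : e != - y 0 0 -> e != - y 0 2 -> h e = - (24 * B).
  move=> e0 e2; rewrite /h.
  have [] // := @euler_chart_onto (y + e *: row4 1 0 1 0).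
  - rewrite !mxE /= mulr1 ltr_wpDr ?sqr_ge0 // exprn_even_gt0 //=.
    by rewrite addrC addr_eq0.
  - rewrite /fibre2 !mxE /= mulr1 ltr_wpDr ?sqr_ge0 // exprn_even_gt0 //=.
    by rewrite addrC addr_eq0.
  by move=> z zU <-; exact: euler_chart_curvature.
have near_ne (a : R) : \forall e \near (0 : R)^', e != a.
  have [->|a0] := eqVneq a 0; first exact: nbhs_dnbhs_neq.
  by apply: nbhs_dnbhs; apply: open_nbhs_nbhs; split; [exact: open_neq | rewrite /= eq_sym].
have h1 : h e @[e --> (0 : R)^'] --> h 0 by apply: cvg_trans ch; apply: cvg_app; exact: nbhs_dnbhs.
have h2 : h e @[e --> (0 : R)^'] --> (- (24 * B)).
  apply: (@cvg_near_cst _ _ _ h).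
  near=> e; apply: hE; [near: e; exact: near_ne | near: e; exact: near_ne].
have <- : h 0 = scalar_curvature_in mm y by rewrite /h scale0r addr0.
exact: (cvg_unique _ h1 h2).
Unshelve. all: by end_near. Qed.

End ModelCurvature.

(** * The presentation by the half-line and the quotient of the sphere *)

Section Identification.
Context {R : realType} (n : nat).
Hypothesis n0 : (0 < n)%N.
Local Notation V := 'rV[R]_4.
Local Notation W := 'rV[R]_7.
Implicit Types (x : V) (a t : R).

Definition rotate x t : V := su2_mul x (su2_diag t).

Lemma rotateE x t : rotate x t =
  row4 (x 0 0 * cos t - x 0 1 * sin t) (x 0 0 * sin t + x 0 1 * cos t)
       (x 0 2 * cos t - x 0 3 * sin t) (x 0 2 * sin t + x 0 3 * cos t).
Proof.
rewrite /rotate /su2_mul /su2_diag !row4s.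
by apply/rowP; elim/ord4P; rewrite !row4s; ring.
Qed.

Lemma cmul1 (z : R * R) : cmul z (1, 0) = z.
Proof. by rewrite /cmul /= !mulr0 !mulr1 subr0 add0r -surjective_pairing. Qed.

Lemma cmul_fixed (z w : R * R) : 0 < cnorm2 z -> cmul z w = z -> w = (1, 0).
Proof.
case: z w => [p q] [u v]; rewrite /cnorm2 /cmul /= => z0 [e1 e2].
have h1 : (p ^+ 2 + q ^+ 2) * (u - 1) = 0.
  transitivity (p * (p * u - q * v) + q * (p * v + q * u) - (p ^+ 2 + q ^+ 2)); first by ring.
  by rewrite e1 e2; ring.
have h2 : (p ^+ 2 + q ^+ 2) * v = 0.
  transitivity (p * (p * v + q * u) - q * (p * u - q * v)); first by ring.
  by rewrite e1 e2; ring.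
move/eqP: h1; rewrite mulf_eq0 gt_eqF //= subr_eq0 => /eqP ->.
by move/eqP: h2; rewrite mulf_eq0 gt_eqF //= => /eqP ->.
Qed.

Lemma powers_rotate x t : cpow n (cos t, sin t) = (1, 0) -> powers n (rotate x t) = powers n x.
Proof.
move=> tn; rewrite /powers rotateE !row4s.
have E (z w : R * R) : cmul z w = (z.1 * w.1 - z.2 * w.2, z.1 * w.2 + z.2 * w.1) by [].
by congr (_, _); rewrite -[RHS]cmul1 -tn -cpowM E.
Qed.

Lemma hopf_rotate a x t : a = 0 \/ cpow n (cos t, sin t) = (1, 0) ->
  squeeze a (hopf n (rotate x t)) = squeeze a (hopf n x).
Proof.
move=> H; have ct := cos2Dsin2 t.
have E j : a * (row4 (powers n (rotate x t)).1.1 (powers n (rotate x t)).1.2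
      (powers n (rotate x t)).2.1 (powers n (rotate x t)).2.2) 0 j =
    a * (row4 (powers n x).1.1 (powers n x).1.2 (powers n x).2.1 (powers n x).2.2) 0 j.
  by case: H => [->|H]; [rewrite !mul0r | rewrite powers_rotate].
have [E0 E1 E2 E3] := And4 (E 0) (E 1) (E 2) (E 3); rewrite !row4s in E0 E1 E2 E3.
rewrite /squeeze /hopf !row7s E0 E1 E2 E3 rotateE !row4s.
have sE : sin t ^+ 2 = 1 - cos t ^+ 2 by rewrite -[X in X - _]ct addrAC subrr add0r.
by congr (row7 _ _ _ _ _ _ _); ring: sE.
Qed.

(** The last four coordinates determine [a], and when they do not vanish the [n]-th power
of the phase by which the two points differ. *)
Lemma rotate_of_hopf a a' x x' : 0 <= a -> 0 <= a' -> S3 x -> S3 x' ->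
  squeeze a (hopf n x) = squeeze a' (hopf n x') ->
  a = a' /\ exists2 t, x' = rotate x t & a = 0 \/ cpow n (cos t, sin t) = (1, 0).
Proof.
move=> a0 a0' /S3E xS /S3E xS' H.
have c j := congr1 (fun v : W => v 0 j) H.
have [c0 c1 c2 [c3 c4 c5 c6]] := And4 (c 0) (c 1) (c 2) (And4 (c 3) (c 4) (c 5) (c 6)).
rewrite /squeeze /hopf !row7s in c0 c1 c2 c3 c4 c5 c6.
have mE : x' 0 0 ^+ 2 + x' 0 1 ^+ 2 = x 0 0 ^+ 2 + x 0 1 ^+ 2 by lra.
have kE : x' 0 2 ^+ 2 + x' 0 3 ^+ 2 = x 0 2 ^+ 2 + x 0 3 ^+ 2 by lra.
have np (u : V) : cnorm2 (powers n u).1 = (u 0 0 ^+ 2 + u 0 1 ^+ 2) ^+ n /\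
    cnorm2 (powers n u).2 = (u 0 2 ^+ 2 + u 0 3 ^+ 2) ^+ n.
  by rewrite /powers /= !cnorm2X.
have [p1 p2] := np x; have [p1' p2'] := np x'.
have pos : 0 < cnorm2 (powers n x).1 + cnorm2 (powers n x).2.
  rewrite p1 p2; have m0 : 0 <= x 0 0 ^+ 2 + x 0 1 ^+ 2 by rewrite addr_ge0 ?sqr_ge0.
  have k0 : 0 <= x 0 2 ^+ 2 + x 0 3 ^+ 2 by rewrite addr_ge0 ?sqr_ge0.
  move: m0 k0 xS; move: (_ + x 0 1 ^+ 2) (_ + x 0 3 ^+ 2) => m k m0 k0 mk.
  have [m1|m1] := eqVneq m 0; last by rewrite ltr_pwDl ?exprn_ge0 // exprn_gt0 // lt_neqAle eq_sym m1.
  by rewrite ltr_wpDl ?exprn_ge0 // exprn_gt0 //; lra.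
have aa : a = a'.
  suff : a ^+ 2 = a' ^+ 2 by move/eqP; rewrite eqrXn2 // => /eqP.
  apply: (mulIf (lt0r_neq0 pos)).
  transitivity (a' ^+ 2 * (cnorm2 (powers n x').1 + cnorm2 (powers n x').2)).
    rewrite /cnorm2.
    transitivity ((a * (powers n x).1.1) ^+ 2 + (a * (powers n x).1.2) ^+ 2 +
      ((a * (powers n x).2.1) ^+ 2 + (a * (powers n x).2.2) ^+ 2)); first by ring.
    by rewrite c3 c4 c5 c6; ring.
  by rewrite p1 p2 p1' p2' mE kE.
split=> //.
(* the phase is the Hermitian product conj z1 z1' + conj z2 z2' of the two points *)
pose L := ((x 0 0 * x' 0 0 + x 0 1 * x' 0 1) + (x 0 2 * x' 0 2 + x 0 3 * x' 0 3),
  (x 0 0 * x' 0 1 - x 0 1 * x' 0 0) + (x 0 2 * x' 0 3 - x 0 3 * x' 0 2)).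
have s1 : x 0 0 ^+ 2 + x 0 1 ^+ 2 + (x' 0 2 ^+ 2 + x' 0 3 ^+ 2) = 1 by rewrite kE.
have s2 : x' 0 0 ^+ 2 + x' 0 1 ^+ 2 + (x 0 2 ^+ 2 + x 0 3 ^+ 2) = 1 by rewrite mE.
pose P := x 0 0 * x 0 2 + x 0 1 * x 0 3; pose Q := x 0 1 * x 0 2 - x 0 0 * x 0 3.
pose P' := x' 0 0 * x' 0 2 + x' 0 1 * x' 0 3; pose Q' := x' 0 1 * x' 0 2 - x' 0 0 * x' 0 3.
have PE : P = P' by []. have QE : Q = Q' by [].
have L1 : cmul (x 0 0, x 0 1) L = (x' 0 0, x' 0 1).
  rewrite /cmul /L /=; congr (_, _).
    transitivity ((x 0 0 ^+ 2 + x 0 1 ^+ 2) * x' 0 0 + (P * x' 0 2 - Q * x' 0 3)).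
      by rewrite /P /Q; ring.
    rewrite PE QE -[RHS]mul1r -s1 /P' /Q'; ring.
  transitivity ((x 0 0 ^+ 2 + x 0 1 ^+ 2) * x' 0 1 + (P * x' 0 3 + Q * x' 0 2)).
    by rewrite /P /Q; ring.
  rewrite PE QE -[RHS]mul1r -s1 /P' /Q'; ring.
have L2 : cmul (x 0 2, x 0 3) L = (x' 0 2, x' 0 3).
  rewrite /cmul /L /=; congr (_, _).
    transitivity ((x 0 2 ^+ 2 + x 0 3 ^+ 2) * x' 0 2 + (P * x' 0 0 + Q * x' 0 1)).
      by rewrite /P /Q; ring.
    rewrite PE QE -[RHS]mul1r -s2 /P' /Q'; ring.
  transitivity ((x 0 2 ^+ 2 + x 0 3 ^+ 2) * x' 0 3 + (P * x' 0 1 - Q * x' 0 0)).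
    by rewrite /P /Q; ring.
  rewrite PE QE -[RHS]mul1r -s2 /P' /Q'; ring.
have nL : L.1 ^+ 2 + L.2 ^+ 2 = 1.
  have : cnorm2 (cmul (x 0 0, x 0 1) L) + cnorm2 (cmul (x 0 2, x 0 3) L) = 1.
    by rewrite L1 L2 /cnorm2.
  by rewrite !cnorm2M -mulrDl {1 2}/cnorm2 /= xS mul1r.
have [t [Lc Ls]] := polar_angle nL.
have LE : L = (cos t, sin t) by rewrite -Lc -Ls.
exists t.
  rewrite rotateE; move: L1 L2; rewrite LE /cmul /= => -[e0 e1] [e2 e3].
  by apply/rowP; elim/ord4P; rewrite !row4s ?e0 ?e1 ?e2 ?e3.
have [->|an] := eqVneq a 0; first by left.
right; rewrite -aa in c3 c4 c5 c6.
have pE : powers n x' = powers n x.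
  have i3 := mulfI an c3; have i4 := mulfI an c4; have i5 := mulfI an c5; have i6 := mulfI an c6.
  move: i3 i4 i5 i6; move: (powers n x) (powers n x') => [[? ?] [? ?]] [[? ?] [? ?]] /=.
  by move=> -> -> -> ->.
have [q1 q2] : cmul (powers n x).1 (cpow n L) = (powers n x).1 /\
    cmul (powers n x).2 (cpow n L) = (powers n x).2.
  by split; rewrite -[in RHS]pE /powers /= -cpowM; rewrite ?L1 ?L2.
rewrite LE in q1 q2.
have [z1|z1] := ltP 0 (cnorm2 (powers n x).1); first exact: cmul_fixed z1 q1.
by apply: cmul_fixed q2; lra.
Qed.

Lemma root_of_unity t : cpow n (cos t, sin t) = (1, 0) ->
  exists k : int, t = k%:~R * (2 * pi / n%:R).
Proof.
rewrite cpow_unit => -[/cos_eq1[k kE] _]; exists k.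
have nn : n%:R != 0 :> R by rewrite pnatr_eq0 -lt0n.
by apply: (mulfI nn); rewrite kE; field.
Qed.

Lemma root_of_unityX (k : int) :
  cpow n (cos (k%:~R * (2 * pi / n%:R)), sin (k%:~R * (2 * pi / n%:R))) = (1, 0) :> R * R.
Proof.
have nn : n%:R != 0 :> R by rewrite pnatr_eq0 -lt0n.
rewrite cpow_unit; have -> : n%:R * (k%:~R * (2 * pi / n%:R)) = 0 + k%:~R * (2 * pi) :> R.
  by field.
by have [-> ->] := @cos_sin_period R k 0; rewrite cos0 sin0.
Qed.

End Identification.

Section Presentation.
Context {R : realType} (n : nat) (r0 : R).
Hypotheses (n0 : (0 < n)%N) (r00 : 0 < r0).
Local Notation V := 'rV[R]_4.
Local Notation W := 'rV[R]_7.
Local Notation M := (@bolt_space R n).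
Local Notation H := (set_type (@halfline R)).
Local Notation Q := (SU2_mod_Z R n).
Local Notation S := (set_type (@S3 R)).

Lemma S3_val (x : S) : S3 (\val x). Proof. exact: set_mem (valP x). Qed.
Lemma halfline_val (h : H) : 0 <= \val h. Proof. exact: set_mem (valP h). Qed.

Lemma zn_relP (x y : S) : zn_rel n x y <->
  exists2 t, \val y = rotate (\val x) t & cpow n (cos t, sin t) = (1, 0).
Proof.
split=> [/asboolP[k yE]|[t yE tn]].
  by exists (k%:~R * (2 * pi / n%:R)) => //; exact: root_of_unityX.
by have [k kE] := root_of_unity n0 tn; apply/asboolP; exists k; rewrite yE kE.
Qed.

Lemma SU2_projP (x y : S) : SU2_proj n x = SU2_proj n y <-> zn_rel n x y.
Proof.
rewrite /SU2_proj; split=> [/eqmodP h|h]; first exact: h.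
by apply/eqmodP; exact: h.
Qed.

Lemma repr_proj (x : S) : zn_rel n x (repr (SU2_proj n x : {eq_quot zn_equiv R n}%qT)).
Proof. by apply/SU2_projP; rewrite /SU2_proj reprK. Qed.

Lemma hopf_zn (x y : S) : zn_rel n x y -> hopf n (\val y) = hopf n (\val x).
Proof.
move=> /zn_relP[t -> tn]; have s1 v : squeeze 1 v = v.
  by apply: row7P; rewrite /squeeze !row7s ?mul1r.
by rewrite -[LHS]s1 -[RHS]s1; apply: hopf_rotate; right.
Qed.

Definition hopf_quot (c : Q) : W := hopf n (\val (repr (c : {eq_quot zn_equiv R n}%qT))).

Lemma hopf_quot_proj x : hopf_quot (SU2_proj n x) = hopf n (\val x).
Proof. by rewrite /hopf_quot; apply: hopf_zn; exact: repr_proj. Qed.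

(** The modulus of [zeta] at [r = r0 + s]. *)
Definition radius_sqrt (s : R) : R := Num.sqrt ((r0 + s) ^+ 2 - r0 ^+ 2).

Lemma bolt_map_bolt (u : H * Q) : bolt_set n (squeeze (radius_sqrt (\val u.1)) (hopf_quot u.2)).
Proof.
exists (radius_sqrt (\val u.1)), (\val (repr (u.2 : {eq_quot zn_equiv R n}%qT))); split=> //.
  exact: sqrtr_ge0.
exact: S3_val.
Qed.

Definition bolt_map (u : H * Q) : M := to_bolt (bolt_map_bolt u).

Lemma embed_bolt_map (h : H) (x : S) :
  embed (bolt_map (h, SU2_proj n x)) = squeeze (radius_sqrt (\val h)) (hopf n (\val x)).
Proof. by rewrite -hopf_quot_proj. Qed.

Lemma SU2_proj_surj (c : Q) : exists x, c = SU2_proj n x.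
Proof. by exists (repr (c : {eq_quot zn_equiv R n}%qT)); rewrite /SU2_proj reprK. Qed.

Lemma radius_sqrt_inj s s' : 0 <= s -> 0 <= s' -> radius_sqrt s = radius_sqrt s' -> s = s'.
Proof.
move=> s0 s0' E; have r0_ge0 := ltW r00.
have ge0 u : 0 <= u -> 0 <= (r0 + u) ^+ 2 - r0 ^+ 2.
  by move=> u0; rewrite subr_ge0 ler_pXn2r ?nnegrE ?addr_ge0 // lerDl.
have := congr1 (fun a => a ^+ 2) E; rewrite /radius_sqrt !sqr_sqrtr ?ge0 //.
move/(congr1 (fun a => a + r0 ^+ 2)); rewrite !subrK => /eqP.
rewrite eqrXn2 ?addr_ge0 // => /eqP; exact: addrI.
Qed.

Lemma radius_sqrt0 : radius_sqrt 0 = 0.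
Proof. by rewrite /radius_sqrt addr0 subrr sqrtr0. Qed.

Lemma bolt_map_surj (p : M) : exists h x, bolt_map (h, SU2_proj n x) = p.
Proof.
have [a [x [a0 xS pE]]] := val_bolt p.
pose s := Num.sqrt (r0 ^+ 2 + a ^+ 2) - r0.
have s0 : 0 <= s.
  rewrite subr_ge0; have {1}-> : r0 = Num.sqrt (r0 ^+ 2) by rewrite sqrtr_sqr gtr0_norm.
  by rewrite ler_wsqrtr // lerDl sqr_ge0.
exists (exist _ s (mem_set s0)), (exist _ x (mem_set xS)).
apply: embed_inj; rewrite embed_bolt_map pE /=; congr (squeeze _ _).
rewrite /radius_sqrt /s addrCA subrr addr0 sqr_sqrtr ?addr_ge0 ?sqr_ge0 //.
by rewrite addrAC subrr add0r sqrtr_sqr ger0_norm.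
Qed.

Lemma bolt_map_eq (u v : H * Q) : bolt_map u = bolt_map v <->
  u = v \/ [/\ \val u.1 = 0, \val v.1 = 0 & same_psi_circle u.2 v.2].
Proof.
case: u v => [h c] [h' c']; have [x ->] := SU2_proj_surj c; have [x' ->] := SU2_proj_surj c'.
split=> /= [E|[[-> ->]//|[h0 h0' [y [y' [t [yE yE' tE]]]]]]].
  have eE : squeeze (radius_sqrt (\val h)) (hopf n (\val x)) =
      squeeze (radius_sqrt (\val h')) (hopf n (\val x')) by rewrite -!embed_bolt_map E.
  have [rE [t tE tn]] := rotate_of_hopf (sqrtr_ge0 _) (sqrtr_ge0 _) (S3_val x) (S3_val x') eE.
  have hE := radius_sqrt_inj (halfline_val h) (halfline_val h') rE.
  have [tn1|tn1] := pselect (cpow n (cos t, sin t) = (1, 0) :> R * R).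
    left; congr (_, _); first exact: val_inj.
    by apply/SU2_projP/zn_relP; exists t.
  right; case: tn => // a0; have h0 : \val h = 0.
    by apply: radius_sqrt_inj => //; [exact: halfline_val | rewrite radius_sqrt0].
  by split=> //; [rewrite -hE | exists x, x', t].
have e0 : radius_sqrt (\val h) = 0 by rewrite -radius_sqrt0; congr radius_sqrt; exact: h0.
have e0' : radius_sqrt (\val h') = 0 by rewrite -radius_sqrt0; congr radius_sqrt; exact: h0'.
apply: embed_inj; rewrite yE yE' !embed_bolt_map e0 e0' tE.
by apply/esym; apply: hopf_rotate; left.
Qed.

Lemma hopf_continuous j : continuous (fun x : V => hopf n x 0 j).
Proof.
have oT := @openT V; suff s : smooth_on setT (fun x : V => hopf n x 0 j).
  by move=> x; apply: differentiable_continuous; exact: smooth_diff s _.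
have sc (k : 'I_4) : smooth_on setT (fun x : V => x 0 k) := smooth_coord oT k.
have [s1 s2] := smooth_cpow n oT (sc 0) (sc 1).
have [s3 s4] := smooth_cpow n oT (sc 2) (sc 3).
elim/ord7P: j; rewrite /hopf; under eq_fun do rewrite row7s.
- by apply: (smoothB oT); apply: (smoothD oT); exact: smoothX.
- by apply: (smoothD oT); exact: smoothM.
- by apply: (smoothB oT); exact: smoothM.
- exact: s1.
- exact: s2.
- exact: s3.
- exact: s4.
Qed.

Lemma radius_sqrt_continuous : continuous radius_sqrt.
Proof.
move=> s; apply: continuous_comp; last exact: sqrt_continuous.
have d : is_derive s (1 : R) (fun s : R => (r0 + s) * (r0 + s) + - r0 ^+ 2)
    ((1 * (r0 + s) + (r0 + s) * 1) + 0).
  have c a : is_derive s (1 : R) (fun=> a : R) 0 by exact: is_derive_cst.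
  have i : is_derive s (1 : R) (fun u : R => r0 + u) 1.
    by apply: is_derive_eq (is_derive_addr (c r0) (is_derive_id _ _)) _; rewrite add0r.
  exact: is_derive_addr (is_derive_mulr i i) (c _).
apply: differentiable_continuous; apply/derivable1_diffP.
exact: (@ex_derive _ _ _ _ _ _ _ d).
Qed.

Lemma hopf_quot_continuous j : continuous (fun c : Q => hopf_quot c 0 j).
Proof.
have cg : continuous (fun x : S => hopf n (\val x) 0 j).
  move=> x; apply: (@continuous_comp _ _ _ (fun x : S => \val x) (fun x : V => hopf n x 0 j)).
    exact: val_continuous.
  exact: hopf_continuous.
apply: (@repr_comp_continuous S {eq_quot zn_equiv R n}%qT R _ cg) => x y /eqP xy.
by apply/eqP; rewrite (@hopf_zn y x) //; apply/SU2_projP/esym.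
Qed.

Lemma bolt_map_continuous : continuous bolt_map.
Proof.
move=> u; apply: continuous_set_type; apply: continuous_rV => j.
have cq (k : 'I_7) : {for u, continuous (fun v : H * Q => hopf_quot v.2 0 k)}.
  apply: (@continuous_comp _ _ _ snd (fun c : Q => hopf_quot c 0 k)); first exact: cvg_snd.
  exact: hopf_quot_continuous.
have cr : {for u, continuous (fun v : H * Q => radius_sqrt (\val v.1))}.
  apply: (@continuous_comp _ _ _ fst (fun h : H => radius_sqrt (\val h))); first exact: cvg_fst.
  apply: (@continuous_comp _ _ _ (fun h : H => \val h) radius_sqrt).
    exact: val_continuous.
  exact: radius_sqrt_continuous.
have cM (k : 'I_7) : {for u, continuous (fun v : H * Q => radius_sqrt (\val v.1) * hopf_quot v.2 0 k)}.
  exact: continuousM cr (cq k).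
have -> : (fun s : H * Q => \val (bolt_map s) 0 j) =
  (fun s => squeeze (radius_sqrt (\val s.1)) (hopf_quot s.2) 0 j) by [].
have ext (f g : H * Q -> R) : f =1 g -> {for u, continuous f} -> {for u, continuous g}.
  by move=> /funext ->.
elim/ord7P: j.
- by apply: ext (cq 0) => v; rewrite /squeeze row7s.
- by apply: ext (cq 1) => v; rewrite /squeeze row7s.
- by apply: ext (cq 2) => v; rewrite /squeeze row7s.
- by apply: ext (cM 3) => v; rewrite /squeeze row7s.
- by apply: ext (cM 4) => v; rewrite /squeeze row7s.
- by apply: ext (cM 5) => v; rewrite /squeeze row7s.
- by apply: ext (cM 6) => v; rewrite /squeeze row7s.
Qed.

Lemma S3_compact : compact (@S3 R).
Proof.
apply: bounded_closed_compact.
  exists 1; split=> // e e1 x xS /=; apply: rV_norm_le; first by rewrite ltW // (lt_trans _ e1).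
  move=> j; apply: le_trans (ltW e1).
  rewrite -(@ler_pXn2r _ 2) ?nnegrE ?normr_ge0 // real_normK ?num_real // expr1n -xS.
  by rewrite (bigD1 j) //= lerDl sumr_ge0 // => k _; exact: sqr_ge0.
have -> : @S3 R = (fun x : V => \sum_i x 0 i ^+ 2) @^-1` [set 1] by [].
apply: preimage_closed; last exact: closed_eq.
have oT := @openT V.
have s : smooth_on setT (fun x : V => \sum_i x 0 i ^+ 2).
  by apply: (smooth_sum oT) => i; apply: (smoothX oT); exact: smooth_coord oT i.
by move=> x _; apply: differentiable_continuous; exact: smooth_diff s _.
Qed.

Definition polar_map (v : R * S) : H * Q := (to_halfline v.1, SU2_proj n v.2).

Lemma polar_map_continuous : continuous polar_map.
Proof.
move=> v.
have c1 : {for v, continuous (fun w : R * S => to_halfline w.1)}.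
  apply: (@continuous_comp _ _ _ fst (@to_halfline R)); first exact: cvg_fst.
  apply: continuous_set_type => /=; apply: (@continuous_max _ _ (fun=> 0) id v.1).
    exact: cvg_cst.
  exact: cvg_id.
have c2 : {for v, continuous (fun w : R * S => SU2_proj n w.2)}.
  apply: (@continuous_comp _ _ _ snd (@SU2_proj R n)); first exact: cvg_snd.
  exact: pi_continuous.
exact: cvg_pair c1 c2.
Qed.

Lemma to_halfline_val (h : H) : to_halfline (\val h) = h.
Proof. by apply: val_inj => /=; apply: max_r; exact: halfline_val. Qed.

Definition powers_norm (p : M) : R :=
  embed p 0 3 ^+ 2 + embed p 0 4 ^+ 2 + (embed p 0 5 ^+ 2 + embed p 0 6 ^+ 2).

Lemma powers_norm_continuous : continuous powers_norm.
Proof.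
move=> p; apply: (@continuous_comp _ _ _ (@embed R n)
  (fun v : W => v 0 3 ^+ 2 + v 0 4 ^+ 2 + (v 0 5 ^+ 2 + v 0 6 ^+ 2))).
  exact: embed_continuous.
have oT := @openT W; apply: differentiable_continuous; apply: (smooth_diff (U := setT)) => //.
by apply: (smoothD oT); apply: (smoothD oT); apply: (smoothX oT); exact: smooth_coord.
Qed.

(** One of [|z1| ^ 2] and [|z2| ^ 2] is at least one half, so the two powers control
the radius. *)
Lemma powers_norm_proper (h : H) (x : S) :
  \val h ^+ 2 <= 2 ^+ n * powers_norm (bolt_map (h, SU2_proj n x)).
Proof.
have h0 := halfline_val h; have /S3E := S3_val x.
pose m := \val x 0 0 ^+ 2 + \val x 0 1 ^+ 2; pose k := \val x 0 2 ^+ 2 + \val x 0 3 ^+ 2.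
rewrite -/m -/k => mk.
have m0 : 0 <= m by rewrite addr_ge0 ?sqr_ge0.
have k0 : 0 <= k by rewrite addr_ge0 ?sqr_ge0.
have half a : 2^-1 <= a -> 1 <= 2 ^+ n * a ^+ n :> R.
  by move=> ha; rewrite -exprMn exprn_ege1 // mulrC -ler_pdivrMr // mul1r.
have mk1 : 1 <= 2 ^+ n * (m ^+ n + k ^+ n).
  have q0 : 0 <= 2 ^+ n :> R by rewrite exprn_ge0.
  rewrite mulrDr; have [hm|hm] := leP 2^-1 m.
    by apply: le_trans (half _ hm) _; rewrite lerDl mulr_ge0 ?exprn_ge0.
  have hk : 2^-1 <= k by lra.
  by apply: le_trans (half _ hk) _; rewrite lerDr mulr_ge0 ?exprn_ge0.
have aE : radius_sqrt (\val h) ^+ 2 = \val h ^+ 2 + 2 * r0 * \val h.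
  rewrite sqr_sqrtr; first by move: (\val h) => s; ring.
  by rewrite subr_ge0 ler_pXn2r ?nnegrE ?addr_ge0 ?(ltW r00) // lerDl.
have -> : powers_norm (bolt_map (h, SU2_proj n x)) =
    radius_sqrt (\val h) ^+ 2 * (m ^+ n + k ^+ n).
  rewrite /powers_norm embed_bolt_map /squeeze /hopf !row7s !exprMn -!mulrDr.
  by rewrite -!/(cnorm2 _) /powers !cnorm2X.
rewrite mulrCA; have a2 : \val h ^+ 2 <= radius_sqrt (\val h) ^+ 2.
  by rewrite aE lerDl mulr_ge0 // mulr_ge0 // ltW.
by apply: le_trans a2 _; rewrite ler_peMr // sqr_ge0.
Qed.

(** Over a bounded range of radii the presentation is a continuous image of a
compact space, hence closed; boundedness is witnessed by the last four coordinates. *)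
Lemma bolt_map_quotient : quotient_map bolt_map.
Proof.
split; first by move=> p; have [h [x <-]] := bolt_map_surj p; exists (h, SU2_proj n x).
move=> A; split=> [oA|oA]; first by apply: open_comp oA => u _; exact: bolt_map_continuous.
rewrite -[A]setCK; apply: closed_openC => p pF.
pose K := 2 ^+ n * (powers_norm p + 1).
pose O : set M := [set w | powers_norm w < powers_norm p + 1].
have Op : nbhs p O.
  have nb : nbhs (powers_norm p) [set s | s < powers_norm p + 1].
    by apply: open_nbhs_nbhs; split; [exact: open_lt | rewrite /= ltrDl].
  exact: (@powers_norm_continuous p _ nb).
pose C := (bolt_map \o polar_map) @`
  ((`[0, 1 + K]%classic `*` [set: S]) `&` (polar_map @^-1` (bolt_map @^-1` ~` A))).
have cC : compact C.
  apply: continuous_compact.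
    apply: continuous_subspaceT => v; apply: continuous_comp; first exact: polar_map_continuous.
    exact: bolt_map_continuous.
  apply: compact_closedI.
    by apply: compact_setX; [exact: segment_compact | apply: compact_set_type; exact: S3_compact].
  apply: preimage_closed; first by move=> v _; exact: polar_map_continuous.
  by rewrite preimage_setC; exact: open_closedC.
have clC : closed C by apply: compact_closed cC; exact: bolt_hausdorff.
suff : C p by move=> [v [_ vA] <-].
apply: clC => U Up.
have [w [wA [wU wO]]] := pF _ (filterI Up Op).
exists w; split=> //; have [h [x wE]] := bolt_map_surj w.
exists (\val h, x); last by rewrite /= /polar_map /= to_halfline_val.
have h0 := halfline_val h.
split; last by rewrite /= /polar_map /= to_halfline_val wE.
split=> //=; rewrite in_itv /= h0 /=.
have hK : \val h ^+ 2 <= K.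
  apply: le_trans (powers_norm_proper h x) _; rewrite wE ler_wpM2l ?exprn_ge0 //.
  exact: ltW.
have K0 : 0 <= K by apply: le_trans hK; exact: sqr_ge0.
change (\val h <= 1 + K); move: (\val h) h0 hK => s s0 sK; nra.
Qed.

Theorem bolt_map_presentation : polar_presentation bolt_map.
Proof. by split; [exact: bolt_map_quotient | exact: bolt_map_eq]. Qed.

End Presentation.

(** * Surjectivity and injectivity of the Euler coordinates *)

Section EulerAngles.
Context {R : realType} (n : nat) (r0 : R).
Hypotheses (n0 : (0 < n)%N) (r00 : 0 < r0).
Local Notation V := 'rV[R]_4.
Implicit Types (y : V).

Lemma polar_pair (p q : R) : exists t, p = Num.sqrt (p ^+ 2 + q ^+ 2) * cos t /\
  q = Num.sqrt (p ^+ 2 + q ^+ 2) * sin t.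
Proof.
have s0 : 0 <= p ^+ 2 + q ^+ 2 by rewrite addr_ge0 ?sqr_ge0.
have [/eqP|a0] := eqVneq (Num.sqrt (p ^+ 2 + q ^+ 2)) 0.
  rewrite sqrtr_eq0 => h; have /eqP : p ^+ 2 + q ^+ 2 = 0 by apply/eqP; rewrite eq_le h s0.
  rewrite paddr_eq0 ?sqr_ge0 // !expf_eq0 /= => /andP[/eqP -> /eqP ->].
  by exists 0; rewrite expr0n /= addr0 sqrtr0 !mul0r.
have [|t [tc ts]] := @polar_angle _ (p / Num.sqrt (p ^+ 2 + q ^+ 2)) (q / Num.sqrt (p ^+ 2 + q ^+ 2)).
  by rewrite !expr_div_n -mulrDl sqr_sqrtr // divff // -(sqr_sqrtr s0) expf_neq0.
by exists t; rewrite -tc -ts ![Num.sqrt _ * _]mulrC !divfK.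
Qed.

Lemma int_mul_small (k : int) (P : R) : 0 < P -> - P < k%:~R * P < P -> k = 0.
Proof.
move=> P0 /andP[h1 h2].
have {}h1 : (- 1)%:~R < k%:~R :> R by rewrite -(ltr_pM2r P0) mulrN1z mulN1r.
have {}h2 : k%:~R < 1%:~R :> R by rewrite -(ltr_pM2r P0) mul1r.
by rewrite !ltr_int in h1 h2; case: k h1 h2 => [[|m]|m].
Qed.

Lemma rotate_euler (th phi psi t : R) :
  rotate (euler_point th phi psi) t = euler_point th phi (psi + 2 * t).
Proof.
rewrite rotateE /euler_point !row4s.
have -> : (psi + 2 * t + phi) / 2 = (psi + phi) / 2 + t by field.
have -> : (psi + 2 * t - phi) / 2 = (psi - phi) / 2 + t by field.
by rewrite !cosD !sinD; apply/rowP; elim/ord4P; rewrite !row4s; ring.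
Qed.

Lemma zn_rel_euler (th phi psi : R) (k : int) :
  zn_rel n (euler th phi psi) (euler th phi (psi + k%:~R * (4 * pi / n%:R))).
Proof.
apply/zn_relP => //; exists (k%:~R * (2 * pi / n%:R)); last exact: root_of_unityX.
rewrite /= rotate_euler; congr (euler_point _ _ (_ + _)).
have nn : n%:R != 0 :> R by rewrite pnatr_eq0 -lt0n.
by field.
Qed.

(** The phases of [z1] and [z2] determine [phi] modulo [2 pi]; multiplying both by an
element of the cyclic group changes [psi] by a multiple of [4 pi / n]. *)
Lemma euler_surj (x : set_type (@S3 R)) : exists th phi psi,
  [/\ 0 <= th <= pi, 0 <= phi <= 2 * pi, 0 <= psi <= 4 * pi / n%:R &
      zn_rel n (euler th phi psi) x].
Proof.
have /S3E := S3_val x; set v := \val x => vS.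
pose a := Num.sqrt (v 0 0 ^+ 2 + v 0 1 ^+ 2); pose b := Num.sqrt (v 0 2 ^+ 2 + v 0 3 ^+ 2).
have a0 : 0 <= a by exact: sqrtr_ge0.
have b0 : 0 <= b by exact: sqrtr_ge0.
have a2 : a ^+ 2 = v 0 0 ^+ 2 + v 0 1 ^+ 2 by rewrite sqr_sqrtr // addr_ge0 ?sqr_ge0.
have b2 : b ^+ 2 = v 0 2 ^+ 2 + v 0 3 ^+ 2 by rewrite sqr_sqrtr // addr_ge0 ?sqr_ge0.
have ab : a ^+ 2 + b ^+ 2 = 1 by rewrite a2 b2.
have a1 : a <= 1 by nra.
have pi0 : 0 < pi :> R := pi_gt0 R.
have ai : a \in `[-1, 1] by rewrite in_itv /= a1 (le_trans _ a0) // lerN10.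
have ca : cos (acos a) = a by rewrite acosK.
have t0 : 0 <= acos a by apply: acos_ge0; rewrite a1 (le_trans _ a0) // lerN10.
have tpi : acos a <= pi by apply: acos_lepi; rewrite a1 (le_trans _ a0) // lerN10.
have t1 : acos a <= pi / 2.
  rewrite leNgt; apply/negP => h.
  have : cos (acos a) < 0.
    have := @sin_gt0_pi R (acos a - pi / 2); rewrite sinB cos_pihalf sin_pihalf mulr0 mulr1 sub0r.
    by rewrite oppr_gt0; apply; apply/andP; split; lra.
  by rewrite ca ltNge a0.
have sb : sin (acos a) = b.
  have s0 : 0 <= sin (acos a) by apply: sin_ge0_pi; rewrite t0 tpi.
  apply/eqP; rewrite -(@eqrXn2 _ 2) // sin2cos2 ca; apply/eqP.
  by rewrite -ab addrAC subrr add0r.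
have [al [v0E v1E]] := polar_pair (v 0 0) (v 0 1).
have [be [v2E v3E]] := polar_pair (v 0 2) (v 0 3).
rewrite -/a in v0E v1E; rewrite -/b in v2E v3E.
have p2 : 0 < 2 * pi :> R by rewrite mulr_gt0.
have n1 : 0 < n%:R :> R by rewrite ltr0n.
have p4 : 0 < 4 * pi / n%:R :> R by rewrite divr_gt0 // mulr_gt0.
have [m /andP[m1 m2]] := reduce_period (al - be) p2.
pose phi := al - be + m%:~R * (2 * pi); pose be' := be + (- m)%:~R * (2 * pi).
have [k /andP[k1 k2]] := reduce_period (al + be') p4.
exists (2 * acos a), phi, (al + be' + k%:~R * (4 * pi / n%:R)).
split; [apply/andP; split; lra | by rewrite m1 ltW | by rewrite k1 ltW |].
rewrite zn_rel_sym.
suff -> : x = euler (2 * acos a) phi (al + be') by exact: zn_rel_euler.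
apply: val_inj => /=; rewrite -/v /euler_point.
have -> : 2 * acos a / 2 = acos a by field.
have -> : (al + be' + phi) / 2 = al by rewrite /be' /phi mulrNz; field.
have -> : (al + be' - phi) / 2 = be'.
  by rewrite /be' /phi mulrNz; field.
have [-> ->] := @cos_sin_period R (- m) be.
by rewrite ca sb -v0E -v1E -v2E -v3E; apply/rowP; elim/ord4P; rewrite !row4s.
Qed.

Lemma bolt_map_euler y : r0 <= y 0 0 -> embed (bolt_map r0 (euler_map n r0 y)) =
  squeeze (fibre_radius r0 y) (hopf n (euler_point (y 0 1) (y 0 2) (y 0 3))).
Proof.
move=> ry; rewrite /euler_map embed_bolt_map //; congr (squeeze _ _).
rewrite /radius_sqrt /fibre_radius; congr (Num.sqrt (_ ^+ 2 - _)).
by rewrite /coord_r /= max_r ?subr_ge0 // addrCA subrr addr0.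
Qed.

Lemma euler_onto : (bolt_map r0 \o euler_map n r0) @` euler_ranges n r0 = setT.
Proof.
apply/seteqP; split=> // p _; have [h [x <-]] := bolt_map_surj n0 r00 p.
have [th [phi [psi [hth hphi hpsi /SU2_projP E]]]] := euler_surj x.
have h0 := halfline_val h.
exists (row4 (r0 + \val h) th phi psi).
  by split; rewrite /coord_r /coord_theta /coord_phi /coord_psi row4s // lerDl.
rewrite /= /euler_map /coord_r /coord_theta /coord_phi /coord_psi !row4s E.
congr (bolt_map _ (_, _)); rewrite addrAC subrr add0r; exact: to_halfline_val.
Qed.

Lemma euler_injective :
  {in euler_ranges_interior n r0 &, injective (bolt_map r0 \o euler_map n r0)}.
Proof.
have pi0 : 0 < pi :> R := pi_gt0 R.
have n1 : 0 < n%:R :> R by rewrite ltr0n.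
have nn : n%:R != 0 :> R by rewrite gt_eqF.
move=> y y' /set_mem[yr /andP[yt0 yt1] /andP[yf0 yf1] /andP[yp0 yp1]].
move=> /set_mem[yr' /andP[yt0' yt1'] /andP[yf0' yf1'] /andP[yp0' yp1']] /= /(bolt_map_eq n0 r00).
rewrite /coord_r /coord_theta /coord_phi /coord_psi in yr yt0 yt1 yf0 yf1 yp0 yp1 yr' yt0' yt1'
  yf0' yf1' yp0' yp1'.
case=> [|[/= + _ _]]; last first.
  rewrite /coord_r max_r ?subr_ge0 ?(ltW yr) // => /eqP.
  by rewrite subr_eq0 gt_eqF.
move=> E; have := congr1 (fun u : set_type (@halfline R) * SU2_mod_Z R n => \val u.1) E.
rewrite /= /coord_r !max_r ?subr_ge0 ?(ltW yr) ?(ltW yr') // => /addIr rE.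
have /SU2_projP/asboolP[k /=] := congr1 (fun u : set_type (@halfline R) * SU2_mod_Z R n => u.2) E.
rewrite -/(rotate _ _) rotate_euler => {}E; move: E.
rewrite /coord_theta /coord_phi /coord_psi.
move tE : (_ + 2 * _) => ps E.
have c j := congr1 (fun v : V => v 0 j) E.
have [c0 c1 c2 c3] := And4 (c 0) (c 1) (c 2) (c 3).
rewrite /euler_point !row4s in c0 c1 c2 c3.
have half (th : R) : 0 < th -> th < pi -> 0 < cos (th / 2) /\ 0 < sin (th / 2).
  move=> h1 h2; split; first by apply: cos_gt0_pihalf; apply/andP; split; lra.
  by apply: sin_gt0_pi; apply/andP; split; lra.
have [ca sa] := half _ yt0 yt1; have [ca' sa'] := half _ yt0' yt1'.
have sq (d u : R) : (d * cos u) ^+ 2 + (d * sin u) ^+ 2 = d ^+ 2.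
  by rewrite !exprMn -mulrDr cos2Dsin2 mulr1.
have cE : cos (y' 0 1 / 2) = cos (y 0 1 / 2).
  apply/eqP; rewrite -(@eqrXn2 _ 2) ?(ltW ca) ?(ltW ca') //; apply/eqP.
  by rewrite -(sq (cos (y' 0 1 / 2)) ((y' 0 3 + y' 0 2) / 2)) c0 c1 sq.
have sE : sin (y' 0 1 / 2) = sin (y 0 1 / 2).
  apply/eqP; rewrite -(@eqrXn2 _ 2) ?(ltW sa) ?(ltW sa') //; apply/eqP.
  by rewrite -(sq (sin (y' 0 1 / 2)) ((y' 0 3 - y' 0 2) / 2)) c2 c3 sq.
have thE : y' 0 1 = y 0 1.
  have : y' 0 1 / 2 = y 0 1 / 2.
    by apply: (@cos_inj R) cE; rewrite in_itv /=; apply/andP; split; lra.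
  by move=> h; lra.
rewrite cE in c0 c1; rewrite sE in c2 c3.
have [i iE] := same_angle (mulfI (lt0r_neq0 ca) c0) (mulfI (lt0r_neq0 ca) c1).
have [j jE] := same_angle (mulfI (lt0r_neq0 sa) c2) (mulfI (lt0r_neq0 sa) c3).
have ij : i - j = 0.
  apply: (@int_mul_small _ (2 * pi)); first by rewrite mulr_gt0.
  rewrite intrB; move: iE jE; move: (i%:~R) (j%:~R) => I J iE jE.
  by apply/andP; split; nra.
have ijE : i = j by apply/eqP; rewrite -subr_eq0 ij.
have phE : y' 0 2 = y 0 2 by rewrite ijE in iE; lra.
have psE : y' 0 3 = y 0 3 + (k + n%:Z * i)%:~R * (4 * pi / n%:R).
  rewrite intrD intrM; rewrite phE -tE in iE.
  have nE : n%:Z%:~R = n%:R :> R by [].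
  rewrite nE; move: iE; move: (i%:~R) (k%:~R) => I K iE.
  have -> : y' 0 3 = 2 * ((y' 0 3 + y 0 2) / 2) - y 0 2 by field.
  by rewrite iE; field.
have k0 : k + n%:Z * i = 0.
  apply: (@int_mul_small _ (4 * pi / n%:R)); first by rewrite divr_gt0 // mulr_gt0.
  by move: psE; move: (_ * (4 * pi / n%:R)) => X psE; apply/andP; split; lra.
rewrite k0 mul0r addr0 in psE.
by apply/rowP; elim/ord4P.
Qed.

(** All assertions about the Euler coordinates reduce by this formula to the explicit map
[euler_chart]. *)
Lemma euler_chart_inv y : euler_regular r0 y ->
  bolt_map r0 (euler_map n r0 y) = chart_inv (bolt_chart n0 false) (euler_chart n r0 y).
Proof.
move=> yU; apply: embed_inj; rewrite bolt_map_euler; last by case: yU => /ltW.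
have [c0 s0] := regular_half yU; have c1 : cos (y 0 1 / 2) != 0 by rewrite gt_eqF.
change (squeeze (fibre_radius r0 y) (hopf n (euler_point (y 0 1) (y 0 2) (y 0 3))) =
  untrivialize n (euler_chart n r0 y)).
pose c := cos (y 0 1 / 2); pose s := sin (y 0 1 / 2).
have cs : c ^+ 2 + s ^+ 2 = 1 by exact: cos2Dsin2.
have sE : s ^+ 2 = 1 - c ^+ 2 by rewrite -[X in X - _]cs addrAC subrr add0r.
have fE := cos2Dsin2 (y 0 2).
have base_eq : base2 (euler_chart n r0 y) = (c ^+ 2)^-1.
  rewrite /base2 /euler_chart !row4s /half_tan -/c -/s.
  transitivity (1 + (s / c) ^+ 2 * (cos (y 0 2) ^+ 2 + sin (y 0 2) ^+ 2)); first by ring.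
  by rewrite fE mulr1 expr_div_n sE; field.
have cE : (Num.sqrt (base2 (euler_chart n r0 y)) ^+ n)^-1 = c ^+ n.
  by rewrite base_eq sqrtrV ?sqr_ge0 // sqrtr_sqr gtr0_norm // exprVn invrK.
pose al := (y 0 3 + y 0 2) / 2.
have alE : (y 0 3 - y 0 2) / 2 = al - y 0 2 by rewrite /al; field.
pose w := (half_tan y * cos (y 0 2), half_tan y * - sin (y 0 2)).
have z1E : cpow n (c * cos al, c * sin al) = (c ^+ n * cos (n%:R * al), c ^+ n * sin (n%:R * al)).
  have -> : (c * cos al, c * sin al) = cmul (c, 0) (cos al, sin al).
    by rewrite /cmul /=; congr (_, _); ring.
  by rewrite cpowM cpow_real cpow_unit /cmul /=; congr (_, _); ring.
have z2E : cpow n (s * cos (al - y 0 2), s * sin (al - y 0 2)) =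
    cmul (cpow n (c * cos al, c * sin al)) (cpow n w).
  rewrite -cpowM; congr (cpow n _); rewrite /w /half_tan -/c -/s cosB sinB /cmul /=.
  by congr (_, _); field.
rewrite /untrivialize base_eq; rewrite base_eq in cE; rewrite cE /squeeze /hopf /powers.
rewrite /euler_point alE -/al -/c -/s !row7s !row4s z2E z1E.
rewrite ?row4s -/w /fibre_angle -/al.
move: (cpow n w) (c ^+ n) => u C; rewrite /half_tan -/c -/s /cmul /=.
have aE := cos2Dsin2 al; have bE := cos2Dsin2 (al - y 0 2).
apply: row7P; rewrite !row7s.
- transitivity (c ^+ 2 * (cos al ^+ 2 + sin al ^+ 2) -
    s ^+ 2 * (cos (al - y 0 2) ^+ 2 + sin (al - y 0 2) ^+ 2)); first by ring.
  by rewrite aE bE sE; field.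
- transitivity (c * s * (cos al ^+ 2 + sin al ^+ 2) * cos (y 0 2)); first by rewrite cosB sinB; ring.
  by rewrite aE; field.
- transitivity (c * s * (cos al ^+ 2 + sin al ^+ 2) * sin (y 0 2)); first by rewrite cosB sinB; ring.
  by rewrite aE; field.
- by ring.
- by ring.
- by ring.
- by ring.
Qed.

End EulerAngles.

(** * The theorem *)

Section Expression.
Context {R : realType} (n : nat) (B r0 A C : R).
Hypotheses (n0 : (0 < n)%N) (B0 : 0 < B) (r00 : 0 < r0).
Hypotheses (CE : C = (n%:R - 2) * r0 ^+ 2 - 3 * B * r0 ^+ 4)
  (AE : A = (1 - n%:R) * r0 ^+ 4 + 2 * B * r0 ^+ 6).
Local Notation V := 'rV[R]_4.
Local Notation N := (bolt_manifold n0 B0 (exprn_gt0 2 r00)).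
Local Notation U := (euler_regular r0 : set V).
Local Notation mm := (model_metric n B (r0 ^+ 2)).
Local Notation E := (@bolt_map R n r0 \o euler_map n r0).

Lemma euler_chart_off_pole (y : V) : U y -> off_pole (euler_chart n r0 y).
Proof.
move=> yU; have [c0 s0] := regular_half yU.
rewrite /off_pole /= /euler_chart !row4s.
have -> : (half_tan y * cos (y 0 2)) ^+ 2 + (half_tan y * - sin (y 0 2)) ^+ 2 =
    half_tan y ^+ 2 * (cos (y 0 2) ^+ 2 + sin (y 0 2) ^+ 2) by ring.
by rewrite cos2Dsin2 mulr1 expf_eq0 /= gt_eqF // divr_gt0.
Qed.

(** In the chart around the other pole the Euler coordinates are followed by the
transition map, an isometry of the model metric. *)
Lemma euler_expression b : exists F : V -> V,
  [/\ smooth_on U F, forall y, U y -> chart_map (bolt_chart n0 b) (E y) = F y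
   & forall y, U y -> pullback F mm y = g_matrix A B C y].
Proof.
have oU := @euler_regular_open R r0; have sF := @smooth_euler_chart R n r0 r00.
have pF y : U y -> pullback (euler_chart n r0) mm y = g_matrix A B C y.
  by move=> yU; rewrite (g_matrixE n0 B0 r00 CE AE yU) euler_chart_pullback.
case: b; last first.
  exists (euler_chart n r0); split=> // y yU.
  rewrite [X in chart_map _ X](euler_chart_inv n0 yU).
  exact: transition_id.
exists (@clutch R n \o euler_chart n r0); split.
- apply/(smooth_mxP _ oU) => i j; rewrite (ord1 i).
  apply: (smooth_comp oU sF euler_chart_off_pole (h := fun z => clutch n z 0 j)).
  exact: ((smooth_mxP _ off_pole_open).1 (clutch_smooth _) 0 j).
- move=> y yU; rewrite [X in chart_map _ X](euler_chart_inv n0 yU).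
  exact: (@transition_clutch R n n0 false) (euler_chart_off_pole yU).
- move=> y yU; rewrite -(pF y yU) /pullback.
  have dF := smooth_diff sF yU; have wU := euler_chart_off_pole yU.
  have dC := smooth_diff (@clutch_smooth R n) wU.
  rewrite (jacobian_comp dF dC) -(clutch_pullback n B (r0 ^+ 2) wU) /pullback trmx_mul.
  by rewrite !mulmxA.
Qed.

Lemma bolt_metric_expression : metric_expression U (E : V -> mspace N) (g_matrix A B C).
Proof.
have oU := @euler_regular_open R r0.
split.
  apply: (@subspace_eq_continuous _ _ _ (chart_inv (bolt_chart n0 false) \o euler_chart n r0)).
    by move=> y /set_mem yU; exact/esym/(euler_chart_inv n0 yU).
  apply: continuous_in_subspaceT => y /set_mem yU; apply: continuous_comp.
    by apply: differentiable_continuous; exact: smooth_diff (smooth_euler_chart n r00) yU.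
  exact: bolt_chart_inv_continuous.
move=> b; have [F [sF FE pF]] := euler_expression b; move=> V'.
have VU : V' `<=` U by move=> y [].
have EF y : U y -> F y = (chart_map (@atlas _ _ N b) \o (E : V -> mspace N)) y.
  by move=> yU; rewrite -FE.
split; first exact: smooth_sub VU (smooth_eq oU EF sF).
move=> y /VU yU; rewrite -(pF y yU); apply: pullback_near.
  by move: (open_nbhs_nbhs (conj oU yU)); apply: filterS => z zU; exact/esym/EF.
exact: smooth_diff sF yU.
Qed.

Lemma bolt_scalar_curvature : has_scalar_curvature N (- (24 * B)).
Proof. by move=> b p _; exact: (model_metric_curvature n0 B0 r00). Qed.

End Expression.

Theorem theorem3p1 (R : realType) (B C : R) (n : nat) :
  0 < B -> (3 <= n)%N -> C <= (n%:R - 2) ^+ 2 / (12 * B) ->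
  let r0 := bolt_radius n B C in
  let A := bolt_A n B C in
  0 < r0 /\
  exists (N : riemannian_manifold R 3)
         (q : set_type (@halfline R) * SU2_mod_Z R n -> mspace N),
    let E : 'rV[R]_4 -> mspace N := q \o euler_map n r0 in
    [/\ polar_presentation q,
        E @` euler_ranges n r0 = setT /\
          {in euler_ranges_interior n r0 &, injective E},
        metric_expression (euler_regular r0) E (g_matrix A B C),
        geodesically_complete N &
        has_scalar_curvature N (- (24 * B))].
Proof.
move=> B0 n3 CB r0 A.
have r00 : 0 < r0 by exact: bolt_radius_gt0.
have n0 : (0 < n)%N by exact: leq_trans n3.
split=> //; exists (bolt_manifold n0 B0 (exprn_gt0 2 r00)), (@bolt_map R n r0) => E.
split.
- exact: bolt_map_presentation.
- by split; [exact: euler_onto | exact: euler_injective].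
- by apply: bolt_metric_expression; [exact: bolt_C | exact: bolt_AE].
- exact: bolt_complete.
- exact: bolt_scalar_curvature.
Qed.
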